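(* Let $S^1=[0,2\pi]$ with $0\sim2\pi$, let $\Omega=[0,\pi]\subset S^1$, and let $D=-\partial_x^2$ act on functions on $S^1$. Let $\alpha\in\mathbb{C}$ with $\Re(\alpha)<1$, let $\phi\in\mathcal{K}_\alpha$ and let $\rho$ be smooth on $\Omega$. Then in the complete asymptotic series as $t\downarrow0$ $$\beta_\Omega(\phi,\rho,D)(t)\sim\sum_{n=0}^\infty t^n\beta_n^\Omega+\sum_{j=0}^\infty t^{(1+j-\alpha)/2}\beta_{j,\alpha}^{\partial\Omega}$$ one may take $$\beta_n^\Omega=\frac{(-1)^n}{n!}\int_\Omega\phi\cdot D^n\rho\,dx\qquad\text{and}\qquad\beta_{j,\alpha}^{\partial\Omega}=\sum_{k+\ell=j}\int_{\partial\Omega}c_{k,\ell,\alpha}\phi_k\rho_\ell\,dy,$$ where $$c_{k,\ell,\alpha}=(-1)^{\ell+1}\frac1{\sqrt{4\pi}}\int_0^\infty\int_0^\infty e^{-(u+\tilde u)^2/4}u^{k-\alpha}\tilde u^\ell\,du\,d\tilde u .$$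
   Context: The heat content is $\beta_\Omega(\phi,\rho,D)(t)=\int_\Omega\int_\Omega K(x,\tilde x;t)\phi(x)\rho(\tilde x)\,dx\,d\tilde x$, where $K$ is the heat kernel of $\partial_t+D$ on the circle $S^1$ (of length $2\pi$). With $r$ the distance to $\partial\Omega=\{0,\pi\}$, $\mathcal{K}_\alpha$ is the space of functions on $\Omega$ that are smooth in the interior and for which $r^\alpha\phi$ is smooth near (and up to) $\partial\Omega$; $\rho$ is smooth up to the boundary. Near the boundary point $x=0$, $\phi_k$ and $\rho_\ell$ are the coefficients (no factorials inserted) of the expansions $$\phi(x)\sim x^{-\alpha}\{\phi_0+\phi_1x+\phi_2x^2+\cdots\},\qquad\rho(x)\sim\rho_0+\rho_1x+\rho_2x^2+\cdots\qquad(x>0);$$ near $x=\pi$ they are defined by the same expansions with $x$ replaced by $\pi-x$. The measure $dy$ on $\partial\Omega=\{0,\pi\}$ is counting measure. Asymptotic series: for every $N$ the difference between $\beta_\Omega(t)$ and sufficiently long partial sums is $O(t^N)$ as $t\downarrow0$. *)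

(* Defs.v *)
From mathcomp Require Import all_boot all_order all_algebra.
From mathcomp Require Export complex.
From mathcomp Require Import all_classical all_reals all_analysis.
Import Order.TTheory GRing.Theory Num.Theory numFieldNormedType.Exports.

Set Implicit Arguments.
Unset Strict Implicit.
Unset Printing Implicit Defensive.

Local Open Scope classical_set_scope.
Local Open Scope ring_scope.

Section HeatContent.
Context {R : realType}.
Local Notation C := R[i].
Local Notation mu := (@lebesgue_measure R).

(* [x ^ a = exp (a ln x)] for [0 < x] and complex [a]; only used for [0 < x]
   up to Lebesgue null sets. *)
Definition cpow (x : R) (a : C) : C :=
  (expR (complex.Re a * ln x))%:C%C *
  (cos (complex.Im a * ln x) +i* sin (complex.Im a * ln x))%C.

Definition Cint (A : set R) (f : R -> C) : C :=
  (\int[mu]_(x in A) complex.Re (f x) +i* \int[mu]_(x in A) complex.Im (f x))%C.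

Definition smooth_on (A : set R) (f : R -> C) : Prop :=
  forall (n : nat) (x : R), A x ->
    derivable (derive1n n (fun y => complex.Re (f y))) x 1 /\
    derivable (derive1n n (fun y => complex.Im (f y))) x 1.

(* [f] is smooth on [A] up to the boundary of [A]: it is the restriction to
   [A] of a smooth function on the line. *)
Definition smooth_upto (A : set R) (f : R -> C) : Prop :=
  exists2 g : R -> C, smooth_on setT g & forall x, A x -> f x = g x.

(* The operator D = - d^2/dx^2 on real-valued functions, then on
   complex-valued ones. *)
Definition DopR (f : R -> R) (x : R) : R := - derive1n 2 f x.

Definition Dop (f : R -> C) (x : R) : C :=
  (DopR (fun y => complex.Re (f y)) x +i* DopR (fun y => complex.Im (f y)) x)%C.

(* Functions on the circle are 2 pi-periodic functions on the line. *)
Definition periodic2pi (T : Type) (f : R -> T) : Prop :=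
  forall x, f (x + 2 * pi) = f x.

(* [K x y t] is the heat kernel of d/dt + D on the circle: it is C^1 in t and
   C^2 in x (with jointly continuous derivatives) for t > 0, solves the heat
   equation, and the associated operators tend to the identity, uniformly on
   the circle, as t decreases to 0. The values of [K] for t <= 0 are
   irrelevant. *)
Record is_heat_kernel (K : R -> R -> R -> R) : Prop := {
  hk_periodicl : forall y t : R, 0 < t -> periodic2pi (fun x => K x y t);
  hk_periodicr : forall x t : R, 0 < t -> periodic2pi (fun y => K x y t);
  hk_derivable_t : forall x y t : R, 0 < t -> derivable (fun s => K x y s) t 1;
  hk_derivable_x : forall x y t : R, 0 < t -> derivable (fun z => K z y t) x 1;
  hk_derivable_xx :
    forall x y t : R, 0 < t -> derivable (derive1 (fun z => K z y t)) x 1;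
  hk_continuous : forall p : R * R * R, 0 < p.2 ->
    {for p, continuous (fun q : R * R * R => K q.1.1 q.1.2 q.2)};
  hk_continuous_t : forall p : R * R * R, 0 < p.2 ->
    {for p, continuous
       (fun q : R * R * R => derive1 (fun s => K q.1.1 q.1.2 s) q.2)};
  hk_continuous_x : forall p : R * R * R, 0 < p.2 ->
    {for p, continuous
       (fun q : R * R * R => derive1 (fun z => K z q.1.2 q.2) q.1.1)};
  hk_continuous_xx : forall p : R * R * R, 0 < p.2 ->
    {for p, continuous
       (fun q : R * R * R => derive1n 2 (fun z => K z q.1.2 q.2) q.1.1)};
  hk_equation : forall x y t : R, 0 < t ->
    derive1 (fun s => K x y s) t + DopR (fun z => K z y t) x = 0;
  hk_initial : forall f : R -> R, continuous f -> periodic2pi f ->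
    forall e : R, 0 < e -> \forall t \near 0^'+, forall x : R,
      `| \int[mu]_(y in `[0, 2 * pi]) (K x y t * f y) - f x | <= e }.

Definition Omega : set R := `[0, pi].

Definition int_Omega : set R := `]0, pi[.

Definition bdry_Omega : set R := [set 0; pi].

(* The integral over the boundary for the counting measure. *)
Definition bdry_int (f : R -> C) : C := f 0 + f pi.

(* Equals the distance to the boundary only on Omega. *)
Definition bdry_dist (x : R) : R := Num.min x (pi - x).

(* The point of Omega at (small) distance [s] from the boundary point [b]. *)
Definition inward (b s : R) : R := if b == 0 then s else pi - s.

Definition K_space (alpha : C) (phi : R -> C) : Prop :=
  smooth_on int_Omega phi /\
  exists2 e : R, 0 < e &
    smooth_upto [set x | int_Omega x /\ bdry_dist x < e]
      (fun x => cpow (bdry_dist x) alpha * phi x).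

(* f(x) ~ x^(-alpha) (a_0 + a_1 x + a_2 x^2 + ...) as x decreases to 0. *)
Definition expansion (alpha : C) (f : R -> C) (a : nat -> C) : Prop :=
  forall m : nat, exists M : R, \forall x \near 0^'+,
    `| f x - cpow x (- alpha) * \sum_(k < m) a k * (x ^+ k)%:C%C |
    <= (M * x `^ (m%:R - complex.Re alpha))%:C%C.

Definition heat_content (K : R -> R -> R -> R) (phi rho : R -> C) (t : R) : C :=
  Cint Omega (fun y => Cint Omega (fun x => (K x y t)%:C%C * phi x * rho y)).

Definition beta_interior (phi rho : R -> C) (n : nat) : C :=
  (-1) ^+ n / (n`!)%:R * Cint Omega (fun x => phi x * iter n Dop rho x).

Definition c_coef (k l : nat) (alpha : C) : C :=
  (-1) ^+ l.+1 * ((Num.sqrt (4 * pi))^-1)%:C%C *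
  Cint `]0, +oo[ (fun v => Cint `]0, +oo[ (fun u =>
    (expR (- (u + v) ^+ 2 / 4))%:C%C * cpow u (k%:R - alpha) * (v ^+ l)%:C%C)).

(* [phik b k] and [rhol b l] are the coefficients at the boundary point [b];
   the sum over k + l = j is indexed by k <= j, with l = j - k. *)
Definition beta_boundary (alpha : C) (phik rhol : R -> nat -> C) (j : nat) : C :=
  \sum_(k < j.+1)
    bdry_int (fun b => c_coef k (j - k)%N alpha * phik b k * rhol b (j - k)%N).

(* beta(t) ~ sum_n t^n a_n + sum_j t^((1 + j - alpha)/2) b_j, complete
   asymptotic series as t decreases to 0. *)
Definition asymptotic_series (alpha : C) (beta : R -> C) (a b : nat -> C) : Prop :=
  forall N : nat, exists m0 : nat, forall m1 m2 : nat,
    (m0 <= m1)%N -> (m0 <= m2)%N ->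
    exists M : R, \forall t \near 0^'+,
      `| beta t - (\sum_(n < m1) (t ^+ n)%:C%C * a n
                   + \sum_(j < m2) cpow t ((1 + j%:R - alpha) / 2) * b j) |
      <= (M * t ^+ N)%:C%C.

End HeatContent.

(* Main.v *)
Require Import Defs.
From mathcomp Require Import all_boot all_order all_algebra.
From mathcomp Require Import all_classical all_reals all_analysis.
From mathcomp Require Import measurable_realfun zify ring lra.
Import Order.TTheory GRing.Theory Num.Theory numFieldNormedType.Exports.
Local Open Scope classical_set_scope.
Local Open Scope ring_scope.

(** Write s for the square root of t and gam w = (4 pi)^(-1/2) exp(-w^2/4).

    The kernel.  On 2 pi-periodic functions f every kernel as in the statement
    is a Gaussian average over the line: the integral of K(x,y,t) f(y) over a
    period is the integral of gam(w) f(x + s w) over the line.  Indeed, let h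
    be the heat kernel of the line.  Since the heat operator is symmetric, the
    integral over z of h(z, t - r) K(x + z, y, r) does not depend on r in
    (0, t); it tends to K(x, y, t) as r increases to t, and after integration
    against f the initial condition gives its limit as r decreases to 0
    ([bounded_solution_gauss], [heat_kernel_gauss]).  Dominated convergence
    extends this to the discontinuous function [arc rho], which is rho on the
    half circle Omega and 0 on the other half ([half_circle_gauss]).

    The solution inside Omega.  Fix x in (0, pi).  Up to O(|y - x|^m), uniformly
    in x and in y on the whole line, [arc rho] at y is the Taylor polynomial of
    rho at x, minus the Taylor polynomial of rho at 0 cut off to y <= 0, minus
    that at pi cut off to y >= pi ([arc_expansion]).  The Gaussian average of
    the first one is the sum of t^n/n! times the derivative of order 2n of rho
    at x, by the values of the Gaussian moments.  The average of the other two
    is made of the boundary layers rho_l (-s)^l p_l(r/s), with r the distance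
    from x to the end point and p_l(u) the integral of gam(w) (w - u)^l over
    w >= u ([gauss_arc_expansion], [kernel_expansion]).

    Integration against phi.  As Re(alpha) < 1, phi is integrable, and so is
    the remainder; the first sum yields the interior coefficients.  In a
    boundary layer p_l decays faster than any power, so that only the expansion
    of phi at the end point matters: x = s u turns the integral of
    x^(k - alpha) p_l(x/s) into s^(1 + k - alpha) times a Mellin transform of
    p_l ([boundary_term]), and Fubini shows that this Mellin transform is
    c_(k,l,alpha) up to the sign (-1)^(l+1) ([c_coef_mellin]).  With the factor
    s^l the exponent of t is (1 + k + l - alpha)/2.  For an error O(t^N), 2N
    terms of each series suffice. *)

Set Implicit Arguments.
Unset Strict Implicit.
Unset Printing Implicit Defensive.

(** * Integrable functions on the line *)
Section Integration.
Context {R : realType}.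
Local Notation mu := (@lebesgue_measure R).
Implicit Types f g h : R -> R.

Definition L1 f := mu.-integrable setT (EFin \o f).

Lemma L1_measurable f : L1 f -> measurable_fun setT f.
Proof. by move=> /integrableP[/measurable_EFinP]. Qed.

Lemma L1_dom f g : measurable_fun setT f -> L1 g ->
  (forall x, `|f x| <= g x) -> L1 f.
Proof.
move=> mf ig fg; apply: (le_integrable _ _ _ ig) => //.
  exact/measurable_EFinP.
by move=> x _ /=; rewrite lee_fin (le_trans (fg x))// ler_norm.
Qed.

Lemma L1D f g : L1 f -> L1 g -> L1 (fun x => f x + g x).
Proof. by move=> i1 i2; have := integrableD measurableT i1 i2. Qed.

Lemma L1B f g : L1 f -> L1 g -> L1 (fun x => f x - g x).
Proof. by move=> i1 i2; have := integrableB measurableT i1 i2. Qed.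

Lemma L1Z (c : R) f : L1 f -> L1 (fun x => c * f x).
Proof. by move=> i1; have := integrableZl measurableT c i1. Qed.

Lemma L1_norm f : L1 f -> L1 (fun x => `|f x|).
Proof. by move=> i1; exact: integrable_norm. Qed.

Lemma L1_0 : L1 (fun _ => 0).
Proof. exact: integrable0. Qed.

Lemma L1_sum n (F : nat -> R -> R) : (forall i, (i < n)%N -> L1 (F i)) ->
  L1 (fun x => \sum_(i < n) F i x).
Proof.
elim: n => [|n IH] H; first by under [X in L1 X]eq_fun do rewrite big_ord0; exact: L1_0.
under [X in L1 X]eq_fun do rewrite big_ord_recr/=.
by apply: L1D; [apply: IH => i ni; apply: H; exact: leqW | exact: H].
Qed.

Lemma Rintegral_sum n (F : nat -> R -> R) : (forall i, (i < n)%N -> L1 (F i)) ->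
  \int[mu]_x (\sum_(i < n) F i x) = \sum_(i < n) \int[mu]_x F i x.
Proof.
elim: n => [|n IH] H.
  by rewrite big_ord0 (_ : (fun _ => _) = cst 0) ?Rintegral_cst ?mul0r//; apply/funext => x; rewrite big_ord0.
rewrite big_ord_recr/= -IH; last by move=> i ni; apply: H; exact: leqW.
transitivity (\int[mu]_x (\sum_(i < n) F i x + F n x)).
  by apply: eq_Rintegral => x _; rewrite big_ord_recr.
rewrite RintegralD//; last exact: H.
by apply: L1_sum => i ni; apply: H; exact: leqW.
Qed.

Lemma Rintegral_le_dom f g : L1 f -> L1 g ->
  (forall x, `|f x| <= g x) -> `|\int[mu]_x f x| <= \int[mu]_x g x.
Proof.
move=> i1 i2 H; apply: le_trans (le_normr_Rintegral _ _) _ => //.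
by apply: le_Rintegral => //; exact: L1_norm.
Qed.

Lemma Rdominated_cvg (F : nat -> R -> R) f g :
  (forall n, measurable_fun setT (F n)) -> L1 g ->
  (forall n x, `|F n x| <= g x) ->
  (forall x, F n x @[n --> \oo] --> f x) ->
  \int[mu]_x F n x @[n --> \oo] --> \int[mu]_x f x.
Proof.
move=> mF ig Fg Ff.
have mEF n : measurable_fun setT (EFin \o F n) by exact/measurable_EFinP.
have mf : measurable_fun setT f.
  by apply/measurable_EFinP; apply: (emeasurable_fun_cvg (fun n => EFin \o F n)) => [n|x _];
    [exact: mEF | apply: cvg_EFin; [exact: nearW|exact: Ff]].
have [] := @dominated_convergence _ _ _ mu setT measurableT
  (fun n => EFin \o F n) (EFin \o f) (EFin \o g).
- by move=> n; exact: mEF.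
- exact/measurable_EFinP.
- by apply/aeW => x _; apply: cvg_EFin; [exact: nearW|exact: Ff].
- exact: ig.
- by apply/aeW => x n _; rewrite /= lee_fin.
move=> If _.
have -> : (\int[mu]_x (EFin \o f) x)%E = (\int[mu]_x f x)%:E.
  by rewrite /Rintegral fineK//; exact: integrable_fin_num.
by move=> /fine_cvg.
Qed.

Lemma affine_measurable (a b : R) : measurable_fun setT (fun x : R => a + b * x).
Proof. by apply: measurable_funD => //; apply: measurable_funM. Qed.

(** The image of Lebesgue measure under x |-> a + b x, multiplied by |b|, is
    Lebesgue measure: they agree on the intervals ]x, y]. *)
Lemma ge0_integral_affine (a b : R) (f : R -> \bar R) : b != 0 ->
  measurable_fun setT f -> (forall x, 0 <= f x)%E ->
  (\int[mu]_x f x = `|b|%:E * \int[mu]_x f (a + b * x)%R)%E.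
Proof.
move=> b0 mf f0.
have nb0 : 0 <= `|b| by [].
pose nu := mscale (NngNum nb0) (pushforward mu (fun x : R => a + b * x : measurableTypeR R)).
have nuE A : measurable A -> mu A = nu (@affine_measurable a b) A.
  apply: lebesgue_measure_unique => X.
  case/ocitvP => [->|[[x y]/= xy ->]]; first by rewrite !measure0.
  rewrite /nu/= /mscale/= /pushforward.
  have xyb : (y - x = `|b| * (`|b|^-1 * (y - x))) by rewrite mulrA divff ?mul1r// normr_eq0.
  rewrite lebesgue_measure_itv/= lte_fin xy.
  have [b_gt0|b_lt0|] := ltgtP 0 b; last by move/eqP; rewrite eq_sym (negbTE b0).
    rewrite (_ : (fun x0 => a + b * x0) @^-1` `]x, y] = `](x - a) / b, (y - a) / b]%classic).
          rewrite lebesgue_measure_itv/= lte_fin ltr_pM2r ?invr_gt0// ltrD2r xy.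
      by rewrite -!EFinD -EFinM; congr EFin; rewrite gtr0_norm//; field.
    by apply/seteqP; split => z /=; rewrite !in_itv/= ltr_pdivrMr// ler_pdivlMr// !(mulrC z) ltrBlDl lerBrDl.
  rewrite (_ : (fun x0 => a + b * x0) @^-1` `]x, y] = `[(y - a) / b, (x - a) / b[%classic).
    rewrite lebesgue_measure_itv/= lte_fin ltr_nM2r ?invr_lt0// ltrD2r xy.
    by rewrite -!EFinD -EFinM; congr EFin; rewrite ltr0_norm//; field.
  apply/seteqP; split => z /=; rewrite !in_itv/= ltr_ndivlMr// ler_ndivrMr// !(mulrC z) ltrBlDl lerBrDl andbC//.
rewrite (eq_measure_integral (nu (@affine_measurable a b))); last by move=> A mA _; exact: nuE.
rewrite ge0_integral_mscale//.
rewrite ge0_integral_pushforward//; exact: affine_measurable.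
Qed.

End Integration.

Section AffineChange.
Context {R : realType}.
Local Notation mu := (@lebesgue_measure R).
Implicit Types f g h : R -> R.

Lemma L1_affine a b f : b != 0 -> L1 f -> L1 (fun x => f (a + b * x)).
Proof.
move=> b0 /integrableP[mf fi]; apply/integrableP; split.
  apply/measurable_EFinP; apply: measurableT_comp; last exact: affine_measurable.
  exact/measurable_EFinP.
move: fi; rewrite (ge0_integral_affine a b0)//; last exact: measurableT_comp.
rewrite -/(comp _ _); set I := (X in (_ * X)%E).
rewrite (_ : (\int[mu]_x _ )%E = I)//.
case: I => [r| |]; rewrite ?ltry ?ltNyr//=.
by rewrite mulry gtr0_sg ?normr_gt0// mul1e.
Qed.

Lemma Rintegral_affine a b f : b != 0 -> L1 f ->
  \int[mu]_x f x = `|b| * \int[mu]_x f (a + b * x).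
Proof.
move=> b0 i1; have i2 := L1_affine a b0 i1.
pose h x := a + b * x.
rewrite /Rintegral integralE [in RHS]integralE.
have mf := measurable_int _ i1.
rewrite (ge0_integral_affine a b0)//; last exact: measurable_funepos.
rewrite [X in (_ - X)%E](ge0_integral_affine a b0)//; last exact: measurable_funeneg.
have ip := integrable_pos_fin_num measurableT i2.
have im := integrable_neg_fin_num measurableT i2.
rewrite -![fun x => (f (a + b * x))%:E]/((EFin \o f) \o h).
rewrite -[EFin \o _]/((EFin \o f) \o h) (funepos_comp (EFin \o f)) in ip.
rewrite -[EFin \o _]/((EFin \o f) \o h) (funeneg_comp (EFin \o f)) in im.
rewrite -/(EFin \o f).
move: ip im.
set P := (\int[mu]_x ((EFin \o f)^\+ \o h) x)%E.
set N := (\int[mu]_x ((EFin \o f)^\- \o h) x)%E.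
move=> ip im.
rewrite -[X in fine (_ * X - _)%E]/P.
rewrite -[X in fine (_ - _ * X)%E]/N.
rewrite -muleBr//; last by apply: fin_num_adde_defl; rewrite fin_numN.
rewrite fineM//; last by rewrite fin_numB ip.
by rewrite (funepos_comp (EFin \o f)) (funeneg_comp (EFin \o f)).
Qed.

Lemma Rintegral_indic f (A : set R) :
  \int[mu]_(x in A) f x = \int[mu]_x (\1_A x * f x).
Proof.
rewrite Rintegral_mkcond; apply: eq_Rintegral => x _.
by rewrite patchE indicE; case: ifP => xA; rewrite ?mul1r ?mul0r.
Qed.

(** The fundamental theorem of calculus on [-n, n], as n tends to infinity:
    a bound on x F(x) makes the end point values disappear. *)
Lemma Rintegral_derive0 (F f : R -> R) :
  (forall x : R, is_derive x 1 F (f x)) -> continuous f -> L1 f ->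
  (exists C : R, forall x, `|x * F x| <= C) ->
  \int[mu]_x f x = 0.
Proof.
move=> dF cf i1 [C FC].
have Fcvg (s : nat -> R) : (forall n, `|s n| = n.+1%:R) -> F (s n) @[n --> \oo] --> 0.
  move=> sn; apply: norm_cvg0.
  apply: (@squeeze_cvgr _ _ _ _ (fun=> 0) (fun n : nat => C * n.+1%:R^-1)).
  - by apply: nearW => n; rewrite normr_ge0/= ler_pdivlMr// -(sn n) -normrM mulrC.
  - exact: cvg_cst.
  - by rewrite -[X in _ --> X](mulr0 C); apply: cvgM; [exact: cvg_cst|exact: cvg_harmonic].
have cF : continuous F.
  by move=> x; apply/differentiable_continuous/derivable1_diffP; have [] := dF x.
have H1 n : \int[mu]_x (\1_(`[- n.+1%:R, n.+1%:R] : set R) x * f x) = F n.+1%:R - F (- n.+1%:R).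
  rewrite -Rintegral_indic /Rintegral (@continuous_FTC2 _ f F)//.
  - by rewrite ltrNl (@lt_trans _ _ 0)// ?ltr0n// oppr_lt0 ltr0n.
  - exact: continuous_subspaceT.
  - split.
    + by move=> x _; have [] := dF x.
    + by apply: cvg_at_right_filter; exact: cF.
    + by apply: cvg_at_left_filter; exact: cF.
  - by move=> x _; rewrite derive1E; exact: derive_val.
have H2 : \int[mu]_x (\1_(`[- n.+1%:R, n.+1%:R] : set R) x * f x) @[n --> \oo] --> \int[mu]_x f x.
  apply: (@Rdominated_cvg _ _ _ (fun x => `|f x|)).
  - by move=> n; apply: measurable_funM => //; exact: L1_measurable.
  - exact: L1_norm.
  - move=> n x; rewrite normrM indicE; case: (x \in _); by rewrite ?normr1 ?normr0 ?mul1r ?mul0r.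
  - move=> x; apply: cvg_near_cst.
    near=> n; rewrite indicE mem_set ?mul1r//= in_itv/= -ler_norml.
    apply: (@le_trans _ _ n%:R); last by rewrite ler_nat.
    near: n; exact: nbhs_infty_ger.
have H3 : F n.+1%:R - F (- n.+1%:R) @[n --> \oo] --> 0 - 0.
  apply: cvgB; first by apply: Fcvg => n; rewrite normr_nat.
  by apply: (Fcvg (fun n => - n.+1%:R)) => n; rewrite normrN normr_nat.
rewrite subr0 in H3.
rewrite (_ : (fun n => _) = (fun n => \int[mu]_x (\1_(`[- n.+1%:R, n.+1%:R] : set R) x * f x))) in H3; last first.
  by apply/funext => n; rewrite H1.
by apply: (cvg_unique _ H2 H3).
Unshelve. all: by end_near.
Qed.

End AffineChange.

Section ProductMeasure.
Context {R : realType}.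
Local Notation mu := (@lebesgue_measure R).
Implicit Types f g h : R -> R.

(** An open set of the plane is the union of the boxes with rational centre
    and radius 1/(k+1) that it contains, and those are countably many. *)
Lemma open_measurable_pair (O : set (R * R)) : open O -> measurable O.
Proof.
move=> oO.
pose B (q : rat * rat * nat) : set (R * R) :=
  [set x | `|x - ratr q.1.1| < q.2.+1%:R^-1] `*` [set x | `|x - ratr q.1.2| < q.2.+1%:R^-1].
pose C (i : nat) := if unpickle i is Some q then (if `[< B q `<=` O >] then B q else set0) else set0.
have mB q : measurable (B q).
  have mb (a e : R) : measurable [set x : R | `|x - a| < e].
    rewrite (_ : [set x | _] = `]a - e, a + e[%classic) //.
    by apply/seteqP; split => x/=; rewrite in_itv/= ltr_distl.
  by apply: measurableX; exact: mb.
rewrite (_ : O = \bigcup_i C i).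
  apply: bigcup_measurable => i _; rewrite /C; case: unpickle => // q.
  by case: ifP.
apply/seteqP; split => [p Op|p [i _]]; last first.
  rewrite /C; case: unpickle => // q; case: ifPn => // /asboolP; exact.
have /nbhs_ballP[e /= e0 eO] : nbhs p O by exact: open_nbhs_nbhs.
have [k ke] : exists k : nat, (k.+1%:R : R)^-1 < e / 2.
  have := near_infty_natSinv_lt (PosNum (divr_gt0 e0 (ltr0Sn R 1))).
  by case=> k _ /(_ k (leqnn _))/= ?; exists k.
have k0 : 0 < (k.+1%:R : R)^-1 by rewrite invr_gt0 ltr0n.
have rd (x : R) : exists q : rat, `|x - ratr q| < (k.+1%:R : R)^-1.
  move: k0 {ke}; move: (k.+1%:R^-1) => d d0.
  have [q] := @rat_in_itvoo R x (x + d) ltac:(by rewrite ltrDl).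
  rewrite in_itv/= => /andP[xq qx]; exists q.
  by rewrite ltr_distl; apply/andP; split; lra.
have [q1 H1] := rd p.1; have [q2 H2] := rd p.2.
exists (pickle (q1, q2, k)); first exact: I.
rewrite /C pickleK.
suff BO : B (q1, q2, k) `<=` O by rewrite asboolT.
move=> z [/= z1 z2].
move: ke H1 H2 z1 z2 => /=; move: (k.+1%:R^-1) => d ke H1 H2 z1 z2.
apply: eO; split => /=; rewrite -ball_normE/=.
  by have := ler_distD (ratr q1) p.1 z.1; rewrite (distrC (ratr q1)); lra.
by have := ler_distD (ratr q2) p.2 z.2; rewrite (distrC (ratr q2)); lra.
Qed.

Lemma continuous_measurable_pair (f : R * R -> R) : continuous f -> measurable_fun setT f.
Proof.
move=> cf; apply: (measurability _ (RGenOInfty.measurableE R)).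
move=> _ [_ [x ->] <-]; rewrite setTI; apply: open_measurable_pair.
by apply: open_comp => [p _|]; [exact: cf|exact: interval_open].
Qed.

(** The product bound gives the integrability for the product measure that
    Fubini's theorem asks for, and makes every slice integrable, not only
    almost every one. *)
Lemma Rfubini (F : R -> R -> R) (a b : R -> R) :
  measurable_fun setT (fun p : R * R => F p.1 p.2) ->
  L1 a -> L1 b -> (forall x y, `|F x y| <= a x * b y) ->
  [/\ forall x, L1 (F x), forall y, L1 (F^~ y),
      L1 (fun x => \int[mu]_y F x y) &
      \int[mu]_x (\int[mu]_y F x y) = \int[mu]_y (\int[mu]_x F x y)].
Proof.
move=> mF ia ib Fab.
have i1 x : L1 (F x).
  apply: (L1_dom _ (L1Z (a x) ib)) => //.
  exact: (measurableT_comp mF (measurable_pair1 x)).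
have i2 y : L1 (F^~ y).
  apply: (L1_dom _ (L1Z (b y) ia)); last by move=> x; rewrite mulrC.
  exact: (measurableT_comp mF (measurable_pair2 y)).
pose G (p : R * R) := (F p.1 p.2)%:E.
have mG : measurable_fun setT G by exact/measurable_EFinP.
have iG : (mu \x mu)%E.-integrable setT G.
  apply/(@integrable12ltyP _ _ _ _ _ mu mu G mG).
  apply: (@le_lt_trans _ _ (\int[mu]_x (`|a x| * \int[mu]_y `|b y|)%:E)%E).
    apply: ge0_le_integral => //.
    - by move=> x _; exact: integral_ge0.
    - apply: (@measurable_fun_fubini_tonelli_F _ _ _ _ _ mu (abse \o G)) => //=.
      exact: measurableT_comp.
    - apply/measurable_EFinP; apply: measurable_funM => //.
      by apply: measurableT_comp => //; exact: L1_measurable.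
    move=> x _ /=; rewrite EFinM /Rintegral fineK; last first.
      by apply: integrable_fin_num => //; exact: L1_norm.
    have mb : measurable_fun setT (fun y => `|b y|%:E).
      by apply/measurable_EFinP; apply: measurableT_comp => //; exact: L1_measurable.
    rewrite -ge0_integralZl//; apply: ge0_le_integral => //.
    - by apply/measurable_EFinP; apply: measurableT_comp => //; exact: L1_measurable.
    - exact: (measurable_funeM `|a x|%:E mb).
    by move=> y _; rewrite lee_fin (le_trans (Fab _ _))// -normrM ler_norm.
  have := L1Z (\int[mu]_y `|b y|) (L1_norm ia).
  move=> /integrableP[_]; under eq_integral => x _ /=.
    rewrite ger0_norm; last by rewrite mulr_ge0// Rintegral_ge0.
    rewrite mulrC; over.
  by [].
have e1 x : (\int[mu]_y G (x, y))%E = (\int[mu]_y F x y)%:E.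
  by rewrite /Rintegral fineK//; apply: integrable_fin_num => //; exact: i1.
have e2 y : (\int[mu]_x G (x, y))%E = (\int[mu]_x F x y)%:E.
  by rewrite /Rintegral fineK//; apply: integrable_fin_num => //; exact: i2.
split => //.
- have := integrable_fubini_F iG; rewrite /L1; congr (_.-integrable _ _).
  by apply/funext => x; rewrite /fubini_F e1.
- have := Fubini iG; rewrite /Rintegral => E.
  by congr fine; under eq_integral do rewrite -e1; rewrite E; apply: eq_integral => y _; rewrite e2.
Qed.

End ProductMeasure.

(** * Gaussian moments *)
Section Gauss.
Context {R : realType}.
Local Notation mu := (@lebesgue_measure R).
Implicit Types f g h : R -> R.

Lemma continuous_gauss (c : R) : continuous (fun x : R => expR (- (c * x ^+ 2))).
Proof.
move=> x; apply: (@continuous_comp _ _ _ (fun x : R => - (c * x ^+ 2)) expR); last exact: continuous_expR.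
apply: continuousN; apply: continuousM; [exact: cvg_cst|exact: exprn_continuous].
Qed.

Lemma gauss_L1 (c : R) : 0 < c -> L1 (fun x => expR (- (c * x ^+ 2))).
Proof.
move=> c0.
have sc : 0 < Num.sqrt c by rewrite sqrtr_gt0.
have := @L1_affine R 0 (Num.sqrt c) _ (lt0r_neq0 sc) (@integrableT_gauss R).
rewrite (_ : (fun x => _) = (fun x => expR (- (c * x ^+ 2))))//.
by apply/funext => x; rewrite /gauss_fun add0r exprMn sqr_sqrtr// ltW.
Qed.

(** Exponentials dominate powers: this is exp(c y) >= (c y)^(k+1)/(k+1)! for
    y = x^2. *)
Lemma gauss_pow_bound (k : nat) (c : R) : 0 < c ->
  exists2 C : R, 0 <= C & forall x : R, `|x| ^+ k * expR (- (c * x ^+ 2)) <= C.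
Proof.
move=> c0; exists (1 + k.+1`!%:R / c ^+ k.+1).
  by rewrite addr_ge0// divr_ge0// exprn_ge0// ltW.
move=> x; set y := x ^+ 2.
have y0 : 0 <= y by rewrite sqr_ge0.
have xy : `|x| ^+ k <= 1 + y ^+ k.+1.
  have [x1|x1] := leP `|x| 1.
    by rewrite (le_trans (exprn_ile1 _ _ _))// lerDl exprn_ge0.
  rewrite (@le_trans _ _ (y ^+ k.+1))// ?lerDr// /y -(@real_normK _ x)// ?num_real// -exprM.
  by rewrite ler_weXn2l// ?(ltW x1)//; lia.
have ce : y ^+ k.+1 * expR (- (c * y)) <= k.+1`!%:R / c ^+ k.+1.
  rewrite expRN ler_pdivrMr ?expR_gt0//.
  rewrite mulrAC ler_pdivlMr ?exprn_gt0// -exprMn (mulrC y) -ler_pdivrMl ?ltr0n ?fact_gt0//.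
  have := @expR_ge1Dxn R (c * y) k ltac:(by rewrite mulr_ge0// ltW).
  by apply: le_trans; rewrite [leLHS]mulrC lerDr.
have e1 : expR (- (c * y)) <= 1 by rewrite -expR0 ler_expR oppr_le0 mulr_ge0// ltW.
apply: (@le_trans _ _ ((1 + y ^+ k.+1) * expR (- (c * y)))).
  by rewrite ler_wpM2r// expR_ge0.
by rewrite mulrDl mul1r lerD.
Qed.

Lemma gauss_pow_L1 (k : nat) (c : R) : 0 < c ->
  L1 (fun x => `|x| ^+ k * expR (- (c * x ^+ 2))).
Proof.
move=> c0; have c20 : 0 < c / 2 by rewrite divr_gt0.
have [C C0 HC] := gauss_pow_bound k c20.
apply: (L1_dom _ (L1Z C (gauss_L1 c20))).
  apply: measurable_funM; apply: continuous_measurable_fun; last exact: continuous_gauss.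
  move=> x; apply: (@continuous_comp _ _ _ (fun x : R => `|x|) (fun x => x ^+ k)); last exact: exprn_continuous.
  exact: norm_continuous.
move=> x; rewrite ger0_norm; last by rewrite mulr_ge0// ?expR_ge0// exprn_ge0.
rewrite (_ : expR (- (c * x ^+ 2)) = expR (- (c / 2 * x ^+ 2)) * expR (- (c / 2 * x ^+ 2))).
  by rewrite mulrA ler_wpM2r// expR_ge0.
by rewrite -expRD; congr expR; field.
Qed.

Definition gam (w : R) : R := (Num.sqrt (4 * pi))^-1 * expR (- w ^+ 2 / 4).

Lemma gamE w : gam w = (Num.sqrt (4 * pi))^-1 * expR (- (4^-1 * w ^+ 2)).
Proof. by rewrite /gam mulNr mulrC (mulrC (w ^+ 2)) mulrC. Qed.

Lemma sqrt4pi_gt0 : 0 < Num.sqrt (4 * pi) :> R.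
Proof. by rewrite sqrtr_gt0 mulr_gt0// pi_gt0. Qed.

Lemma gam_gt0 w : 0 < gam w.
Proof. by rewrite mulr_gt0 ?expR_gt0// invr_gt0 sqrt4pi_gt0. Qed.

Lemma gamN w : gam (- w) = gam w.
Proof. by rewrite /gam sqrrN. Qed.

Lemma continuous_gam : continuous gam.
Proof.
rewrite (_ : gam = fun w => (Num.sqrt (4 * pi))^-1 * expR (- (4^-1 * w ^+ 2))); last exact/funext/gamE.
by move=> x; apply: cvgM; [exact: cvg_cst|exact: continuous_gauss].
Qed.

Lemma gam_pow_L1 (k : nat) : L1 (fun w => `|w| ^+ k * gam w).
Proof.
have := L1Z (Num.sqrt (4 * pi))^-1 (@gauss_pow_L1 k 4^-1 ltac:(by [])).
by congr L1; apply/funext => w; rewrite gamE mulrCA.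
Qed.

Lemma gam_powX_L1 (k : nat) : L1 (fun w => w ^+ k * gam w).
Proof.
apply: (L1_dom _ (gam_pow_L1 k)).
  by apply: measurable_funM; apply: continuous_measurable_fun; [exact: exprn_continuous|exact: continuous_gam].
by move=> x; rewrite normrM normrX (ger0_norm (ltW (gam_gt0 _))).
Qed.

Lemma gam_L1 : L1 gam.
Proof. by have := gam_powX_L1 0; congr L1; apply/funext => w; rewrite expr0 mul1r. Qed.

Lemma gam_int1 : \int[mu]_w gam w = 1.
Proof.
have i1 : L1 (fun x : R => expR (- x ^+ 2)) by exact: integrableT_gauss.
have E : \int[mu]_x expR (- x ^+ 2) = Num.sqrt pi.
  by rewrite -[RHS]/(fine (Num.sqrt pi)%:E) -integralT_gauss.
have := @Rintegral_affine R 0 2^-1 _ ltac:(by rewrite invr_eq0) i1.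
rewrite E => H; rewrite /gam RintegralZl//.
- rewrite (_ : \int[mu]_x _ = \int[mu]_x expR (- (0 + 2^-1 * x) ^+ 2)); last first.
    by apply: eq_Rintegral => x _; congr expR; rewrite add0r exprMn; field.
  rewrite sqrtrM// (_ : 4 = 2 ^+ 2 :> R); last by rewrite -natrX.
  rewrite sqrtr_sqr ger0_norm// H ger0_norm ?invr_ge0//.
  rewrite invfM; set I := \int[mu]_x _.
  have I0 : I != 0.
    apply/eqP => I0; move: H; rewrite -/I I0 mulr0 => /eqP.
    by rewrite gt_eqF// sqrtr_gt0 pi_gt0.
  by rewrite invfM invrK; field.
- have := @gauss_L1 4^-1 ltac:(by []); congr L1; apply/funext => w.
  by congr expR; ring.
Qed.

Definition moment (k : nat) : R := \int[mu]_w (w ^+ k * gam w).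

(** The substitution of -w for w. *)
Lemma momentN k : moment k = (-1) ^+ k * moment k.
Proof.
rewrite {1}/moment (@Rintegral_affine R 0 (-1) _ ltac:(by rewrite oppr_eq0 oner_neq0) (gam_powX_L1 k)).
rewrite normrN1 mul1r -RintegralZl//; last exact: gam_powX_L1.
by apply: eq_Rintegral => w _; rewrite add0r mulN1r gamN [(- w) ^+ k]exprNn mulrA.
Qed.

Lemma moment_odd k : odd k -> moment k = 0.
Proof.
move=> ok; have := momentN k; rewrite -signr_odd ok expr1 mulN1r => /eqP.
by rewrite -addr_eq0 -mulr2n mulrn_eq0/= => /eqP.
Qed.

Lemma is_derive_gam (w : R) : is_derive w 1 gam (- (w / 2) * gam w).
Proof.
have H : is_derive w 1 (fun x : R => - (4^-1 * x ^+ 2)) (- (w / 2)).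
  by apply: is_derive_eq; rewrite /GRing.scale/=; field.
have H2 : is_derive w 1 (expR \o (fun x : R => - (4^-1 * x ^+ 2))) _ := is_derive1_comp (is_derive_expR _) H.
rewrite (_ : gam = (Num.sqrt (4 * pi))^-1 *: (expR \o (fun x : R => - (4^-1 * x ^+ 2)))); last exact/funext/gamE.
by apply: is_derive_eq; rewrite /GRing.scale/= -[X in _ = _ * X]/(_ * _); ring.
Qed.

(** Integration by parts, from gam'(w) = - (w/2) gam(w): the derivative of
    w^(k+1) gam(w) has integral 0. *)
Lemma moment_rec k : moment k.+2 = 2 * k.+1%:R * moment k.
Proof.
have H : \int[mu]_w (k.+1%:R * (w ^+ k * gam w) - 2^-1 * (w ^+ k.+2 * gam w)) = 0.
  apply: (@Rintegral_derive0 _ (fun w => w ^+ k.+1 * gam w)).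
  - move=> x.
    have H1 : is_derive x 1 (fun w : R => w ^+ k.+1) (k.+1%:R * x ^+ k).
      have := @is_deriveX _ _ id k.+1 x 1 1 (is_derive_id x 1).
      by rewrite exprfctE /GRing.scale/= mulr1.
    apply: (is_derive_eq (is_deriveM H1 (is_derive_gam x))).
    by rewrite /GRing.scale/= !exprS; field.
  - move=> x; apply: cvgB; (apply: cvgM; first exact: cvg_cst); apply: cvgM; try exact: exprn_continuous; exact: continuous_gam.
  - by apply: L1B; apply: L1Z; exact: gam_powX_L1.
  - have [C _ HC] := @gauss_pow_bound k.+2 4^-1 ltac:(by []).
    exists ((Num.sqrt (4 * pi))^-1 * C) => x.
    rewrite mulrA -exprS normrM normrX (ger0_norm (ltW (gam_gt0 _))) gamE mulrCA.
    by rewrite ler_wpM2l// invr_ge0 (ltW sqrt4pi_gt0).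
move: H; rewrite RintegralB//; try by apply: L1Z; exact: gam_powX_L1.
rewrite !RintegralZl//; try exact: gam_powX_L1.
rewrite -/(moment k) -/(moment k.+2) => H.
lra.
Qed.

Lemma moment_even n : moment n.*2 = (n.*2)`!%:R / n`!%:R.
Proof.
elim: n => [|n IH].
  rewrite divr1 -[RHS]gam_int1 /moment.
  by apply: eq_Rintegral => w _; rewrite expr0 mul1r.
rewrite doubleS moment_rec IH !factS !natrM.
rewrite (_ : (n.*2.+2)%:R = 2 * n.+1%:R :> R); last by rewrite -natrM; congr (_%:R); lia.
have n0 : n`!%:R != 0 :> R by rewrite pnatr_eq0 -lt0n fact_gt0.
have n1 : n.+1%:R != 0 :> R by rewrite pnatr_eq0.
by field; rewrite n0 addrC natr1.
Qed.

End Gauss.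

(** * The heat kernel of the circle as a Gaussian average *)
Section Kernel.
Context {R : realType}.
Local Notation mu := (@lebesgue_measure R).
Implicit Types f g h : R -> R.

Lemma periodic2pi_int f (n : int) x : periodic2pi f -> f (x + n%:~R * (2 * pi)) = f x.
Proof.
move=> pf; have nat_case (m : nat) y : f (y + m%:R * (2 * pi)) = f y.
  elim: m => [|m IH]; first by rewrite mul0r addr0.
  by rewrite -natr1 mulrDl mul1r addrA pf.
case: n => m; first exact: nat_case.
by rewrite NegzE -(nat_case m.+1 (x + _)) mulrNz mulNr subrK.
Qed.

Lemma periodic2pi_reduce (x : R) : exists n : int, 0 <= x + n%:~R * (2 * pi) <= 2 * pi.
Proof.
have p0 : 0 < 2 * pi :> R by rewrite mulr_gt0// pi_gt0.
exists (- Num.floor (x / (2 * pi))).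
have := real_floor_itv (num_real (x / (2 * pi))) => /andP[h1 h2].
rewrite ler_pdivlMr// in h1; rewrite ltr_pdivrMr// intrD mulrDl mul1r in h2.
by rewrite mulrNz mulNr subr_ge0 h1/= lerBlDl ltW.
Qed.

(** By periodicity, the maximum over a compact rectangle is a bound for every
    x. *)
Lemma periodic2pi_bounded (F : R * R -> R) (a b : R) :
  (forall p, a <= p.2 <= b -> {for p, continuous F}) ->
  (forall s, a <= s <= b -> periodic2pi (fun x => F (x, s))) ->
  exists C : R, forall x s, a <= s <= b -> `|F (x, s)| <= C.
Proof.
move=> cF pF.
have [ab|ab] := leP a b; last by exists 0 => x s /andP[h1 h2]; lra.
have p0 : 0 < 2 * pi :> R by rewrite mulr_gt0// pi_gt0.
pose A : set (R * R) := `[0, 2 * pi]%classic `*` `[a, b]%classic.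
have cA : compact A by apply: compact_setX; exact: segment_compact.
have A0 : A !=set0 by exists (0, a); split => /=; rewrite in_itv/= lexx ?(ltW p0)// ab.
have cNF : {within A, continuous (fun p => `|F p|)}.
  apply: continuous_in_subspaceT => p /set_mem[_ /=]; rewrite in_itv/= => ap.
  by apply: continuous_comp; [exact: cF|exact: norm_continuous].
have [c _ Hc] := compact_EVT_max A0 cA cNF.
exists `|F c| => x s /andP[h1 h2].
have [n Hn] := periodic2pi_reduce x.
rewrite -(periodic2pi_int n x (pF s _)) ?h1//.
by apply: Hc; rewrite inE; split => /=; rewrite in_itv/= ?h1.
Qed.

Lemma periodic2pi_derive1 f : periodic2pi f -> periodic2pi (derive1 f).
Proof.
move=> pf x; rewrite /derive1.
rewrite (_ : (fun e : R => e^-1 *: (f (e + (x + 2 * pi)) - f (x + 2 * pi))) = (fun e : R => e^-1 *: (f (e + x) - f x)))//.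
by apply/funext => e; rewrite addrA !pf.
Qed.

(** The heat kernel of the line.  The factor t^(-1/2) is written as an
    exponential to ease differentiation in t. *)
Definition hker (z t : R) : R := (Num.sqrt (4 * pi))^-1 * expR (- (ln t / 2) - z ^+ 2 / (4 * t)).

Lemma hker_gt0 z t : 0 < hker z t.
Proof. by rewrite mulr_gt0 ?expR_gt0// invr_gt0 sqrt4pi_gt0. Qed.

Lemma hker_gam (w t : R) : 0 < t -> Num.sqrt t * hker (Num.sqrt t * w) t = gam w.
Proof.
move=> t0; have st : Num.sqrt t = expR (ln t / 2).
  by rewrite -powR12_sqrt ?ltW// /powR gt_eqF// mulrC.
rewrite /hker {1}st mulrCA -expRD; congr (_ * expR _).
by rewrite exprMn sqr_sqrtr ?ltW//; field; rewrite gt_eqF.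
Qed.

Lemma is_derive_hker_x (z t : R) : 0 < t ->
  is_derive z 1 (hker^~ t) (- (z / (2 * t)) * hker z t).
Proof.
move=> t0.
have H : is_derive z 1 (fun x : R => - (ln t / 2) - (4 * t)^-1 * x ^+ 2) (- (z / (2 * t))).
  by apply: is_derive_eq; rewrite /GRing.scale/=; field; rewrite gt_eqF.
have H2 := is_derive1_comp (is_derive_expR _) H.
have -> : hker^~ t = (Num.sqrt (4 * pi))^-1 *: (expR \o (fun x : R => - (ln t / 2) - (4 * t)^-1 * x ^+ 2)).
  by apply/funext => x; rewrite /hker/= (mulrC (x ^+ 2)).
apply: is_derive_eq; rewrite /hker /GRing.scale/= (mulrC (z ^+ 2)); ring.
Qed.

(** Together with [is_derive_hker_x] this is the heat equation for [hker]. *)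
Lemma is_derive_hker_t (z t : R) : 0 < t ->
  is_derive t 1 (hker z) ((z ^+ 2 / (4 * t ^+ 2) - (2 * t)^-1) * hker z t).
Proof.
move=> t0.
have H1 := is_derive1_ln t0.
have H3 : is_derive t 1 (fun s : R => s^-1) (- (t ^- 2)).
  have := @is_deriveV _ id t 1 1 (lt0r_neq0 t0) (is_derive_id t 1).
  by rewrite /GRing.scale/= mulr1.
have H : is_derive t 1 (fun s : R => 2^-1 * (- ln s) - (z ^+ 2 / 4) * s^-1) (z ^+ 2 / (4 * t ^+ 2) - (2 * t)^-1).
  by apply: is_derive_eq; rewrite /GRing.scale/=; field; rewrite gt_eqF.
have H2 := is_derive1_comp (is_derive_expR _) H.
have -> : hker z = (Num.sqrt (4 * pi))^-1 *: (expR \o (fun s : R => 2^-1 * (- ln s) - (z ^+ 2 / 4) * s^-1)).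
  by apply/funext => s; rewrite /hker/=; congr (_ * expR _); rewrite invfM mulrA; ring.
apply: is_derive_eq; rewrite /hker /GRing.scale/= (_ : _ - _ * t^-1 = - (ln t / 2) - z ^+ 2 / (4 * t)).
  rewrite -[X in _ = _ * X]/(_ * _); ring.
by field; rewrite gt_eqF.
Qed.

End Kernel.

Section Duality.
Context {R : realType}.
Local Notation mu := (@lebesgue_measure R).
Implicit Types f g h : R -> R.

(** For t in a compact interval of positive times, one Gaussian bounds every
    kernel at time t; this is the majorant for dominated convergence. *)
Lemma hker_dom (x t t1 t2 : R) : 0 < t1 -> t1 <= t <= t2 ->
  hker x t <= hker 0 t1 * expR (- ((4 * t2)^-1 * x ^+ 2)).
Proof.
move=> t10 /andP[h1 h2]; have t0 : 0 < t by lra.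
rewrite /hker -[leRHS]mulrA -expRD ler_wpM2l ?invr_ge0 ?(ltW sqrt4pi_gt0)// ler_expR.
rewrite expr0n/= mul0r subr0; apply: lerB.
  by rewrite lerN2 ler_pM2r// ler_ln ?posrE.
rewrite mulrC ler_wpM2l ?sqr_ge0// lef_pV2 ?posrE ?mulr_gt0//; last by lra.
by rewrite ler_pM2l.
Qed.

Lemma hker_continuous (t : R) : continuous (hker^~ t).
Proof.
move=> x; apply: cvgM; first exact: cvg_cst.
apply: (@continuous_comp _ _ _ (fun x : R => - (ln t / 2) - x ^+ 2 / (4 * t)) expR); last exact: continuous_expR.
apply: cvgB; first exact: cvg_cst.
by apply: cvgM; [exact: exprn_continuous|exact: cvg_cst].
Qed.

Variables (k kx ks : R -> R -> R).
Hypothesis dk_t : forall x s : R, 0 < s -> is_derive s 1 (k x) (ks x s).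
Hypothesis dk_x : forall x s : R, 0 < s -> is_derive x 1 (k^~ s) (kx x s).
Hypothesis dkx_x : forall x s : R, 0 < s -> is_derive x 1 (kx^~ s) (ks x s).
Hypothesis ck : forall p : R * R, 0 < p.2 -> {for p, continuous (fun q : R * R => k q.1 q.2)}.
Hypothesis cks : forall s : R, 0 < s -> continuous (ks^~ s).
Hypothesis bk : forall a b : R, 0 < a -> exists C : R, forall x s : R, a <= s <= b -> `|k x s| <= C.
Hypothesis bkx : forall a b : R, 0 < a -> exists C : R, forall x s : R, a <= s <= b -> `|kx x s| <= C.
Hypothesis bks : forall a b : R, 0 < a -> exists C : R, forall x s : R, a <= s <= b -> `|ks x s| <= C.

Variable t0 : R.

Let F s x := hker x (t0 - s) * k x s.
Let dF s x := - ((x ^+ 2 / (4 * (t0 - s) ^+ 2) - (2 * (t0 - s))^-1) * hker x (t0 - s)) * k x s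
  + hker x (t0 - s) * ks x s.

Let k_continuous (s : R) : 0 < s -> continuous (k^~ s).
Proof.
by move=> s0 x; apply/differentiable_continuous/derivable1_diffP; have [] := dk_x x s0.
Qed.

Let is_derive_F (s x : R) : 0 < s < t0 -> is_derive s 1 (F^~ x) (dF s x).
Proof.
move=> /andP[s0 st]; have ts : 0 < t0 - s by rewrite subr_gt0.
have H1 : is_derive s 1 (fun u : R => t0 - u) (-1).
  by apply: (is_derive_eq (is_deriveB (is_derive_cst t0 s 1) (is_derive_id s 1))); rewrite sub0r.
have H2 := @is_derive1_comp R (hker x) (fun u : R => t0 - u) s _ _ (is_derive_hker_t x ts) H1.
have H3 := is_deriveM H2 (dk_t x s0).
apply: (is_derive_eq H3); rewrite /dF /GRing.scale/= ; ring.
Qed.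

(** The majorant that allows differentiation under the integral. *)
Let dom (a b : R) : 0 < a -> b < t0 -> exists G : R -> R, [/\ (forall x, 0 <= G x), L1 G &
  forall s x : R, a <= s <= b -> `|F s x| <= G x /\ `|dF s x| <= G x].
Proof.
move=> a0 bt.
have [C Ck] := bk b a0; have [C' Cks] := bks b a0.
pose c := (4 * (t0 - a))^-1; pose D := hker 0 (t0 - b).
pose P x := expR (- (c * x ^+ 2)).
have [ba|ab] := ltP b a.
  by exists (fun=> 0); split => [//||s x /andP[h1 h2]]; [exact: L1_0|lra].
have C0 : 0 <= C by apply: (le_trans _ (Ck 0 a _)) => //; rewrite lexx ab.
have C'0 : 0 <= C' by apply: (le_trans _ (Cks 0 a _)) => //; rewrite lexx ab.
have t10 : 0 < t0 - b by lra.
have ta0 : 0 < t0 - a by lra.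
have c0 : 0 < c by rewrite invr_gt0 mulr_gt0//.
have D0 : 0 < D by exact: hker_gt0.
pose G x := (C * D / (4 * (t0 - b) ^+ 2)) * (`|x| ^+ 2 * P x) + (C * D / (2 * (t0 - b)) + C * D + C' * D) * P x.
have P0 x : 0 < P x by exact: expR_gt0.
have e1 : 0 <= C * D / (4 * (t0 - b) ^+ 2) by rewrite divr_ge0 ?mulr_ge0 ?exprn_ge0 ?(ltW D0) ?(ltW t10).
have e2 : 0 <= C * D / (2 * (t0 - b)) by rewrite divr_ge0 ?mulr_ge0 ?(ltW D0) ?(ltW t10).
have e3 : 0 <= C * D by rewrite mulr_ge0 ?(ltW D0).
have e4 : 0 <= C' * D by rewrite mulr_ge0 ?(ltW D0).
exists G; split.
- move=> x; rewrite /G addr_ge0// mulr_ge0 ?(ltW (P0 _))//; last by lra.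
  by rewrite mulr_ge0 ?(ltW (P0 _)).
- by apply: L1D; apply: L1Z; [exact: gauss_pow_L1|exact: gauss_L1].
- move=> s x sab.
  have st : t0 - b <= t0 - s <= t0 - a by move: sab => /andP[? ?]; lra.
  have st0 : 0 < t0 - s by lra.
  have Hh : hker x (t0 - s) <= D * P x by exact: hker_dom.
  have h0 := hker_gt0 x (t0 - s).
  have Fle : `|F s x| <= C * D * P x.
    rewrite /F normrM gtr0_norm// mulrC -mulrA.
    by apply: ler_pM => //; [exact: ltW|exact: Ck].
  have x2 : `|x| ^+ 2 = x ^+ 2 by rewrite real_normK// num_real.
  have q1 : x ^+ 2 / (4 * (t0 - s) ^+ 2) <= x ^+ 2 / (4 * (t0 - b) ^+ 2).
    rewrite ler_wpM2l ?sqr_ge0// lef_pV2 ?posrE ?mulr_gt0 ?exprn_gt0// ler_pM2l//.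
    by rewrite lerXn2r ?nnegrE ?(ltW t10) ?(ltW st0)//; case/andP: st.
  have q2 : (2 * (t0 - s))^-1 <= (2 * (t0 - b))^-1.
    by rewrite lef_pV2 ?posrE ?mulr_gt0// ler_pM2l//; case/andP: st.
  have q3 : `|x ^+ 2 / (4 * (t0 - s) ^+ 2) - (2 * (t0 - s))^-1| <= x ^+ 2 / (4 * (t0 - b) ^+ 2) + (2 * (t0 - b))^-1.
    have q4 : 0 <= x ^+ 2 / (4 * (t0 - s) ^+ 2).
      by rewrite divr_ge0 ?sqr_ge0// mulr_ge0// exprn_ge0// ltW.
    have q5 : 0 <= (2 * (t0 - s))^-1 by rewrite invr_ge0 mulr_ge0// ltW.
    by rewrite (le_trans (ler_normB _ _))// (ger0_norm q4) (ger0_norm q5) lerD.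
  have PC : 0 <= x ^+ 2 * P x by rewrite mulr_ge0 ?sqr_ge0 ?ltW.
  split.
    apply: (le_trans Fle); rewrite /G x2.
    have := mulr_ge0 e1 PC; have := mulr_ge0 e2 (ltW (P0 x)); have := mulr_ge0 e4 (ltW (P0 x)); lra.
  have dle : `|dF s x| <= (x ^+ 2 / (4 * (t0 - b) ^+ 2) + (2 * (t0 - b))^-1) * (D * P x) * C + D * P x * C'.
    rewrite (le_trans (ler_normD _ _))// lerD//.
      rewrite normrM normrN normrM; apply: ler_pM => //; last exact: Ck.
      by apply: ler_pM => //; rewrite gtr0_norm.
    by rewrite normrM gtr0_norm//; apply: ler_pM; [exact: ltW|by []|by []|exact: Cks].
  apply: (le_trans dle); rewrite /G x2.
  rewrite -subr_ge0 (_ : _ - _ = C * D * P x).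
    by rewrite mulr_ge0// ltW.
  by rewrite /=; field; rewrite gt_eqF.
Qed.

Let F_continuous (s : R) : 0 < s -> continuous (F s).
Proof.
by move=> s0 x; apply: cvgM; [exact: hker_continuous|exact: k_continuous].
Qed.

Let dF_continuous (s : R) : 0 < s -> continuous (dF s).
Proof.
move=> s0 x; apply: cvgD.
  apply: cvgM; last exact: k_continuous.
  apply: cvgN; apply: cvgM; last exact: hker_continuous.
  apply: cvgB; last exact: cvg_cst.
  by apply: cvgM; [exact: exprn_continuous|exact: cvg_cst].
by apply: cvgM; [exact: hker_continuous|exact: cks].
Qed.

Let F_L1 (s : R) : 0 < s < t0 -> L1 (F s).
Proof.
move=> /andP[s0 st]; have [G [G0 iG HG]] := dom s0 st.
apply: (L1_dom _ iG); first by apply: continuous_measurable_fun; exact: F_continuous.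
by move=> x; have [] := HG s x ltac:(by rewrite !lexx).
Qed.

Let dF_L1 (s : R) : 0 < s < t0 -> L1 (dF s).
Proof.
move=> /andP[s0 st]; have [G [G0 iG HG]] := dom s0 st.
apply: (L1_dom _ iG); first by apply: continuous_measurable_fun; exact: dF_continuous.
by move=> x; have [] := HG s x ltac:(by rewrite !lexx).
Qed.

(** The heat operator is symmetric: with h the backward kernel, dF is
    h k'' - h'' k, the derivative in x of the flux h k' - h' k, and the flux
    decays at infinity. *)
Let int_dF (s : R) : 0 < s < t0 -> \int[mu]_x dF s x = 0.
Proof.
move=> s0t; have /andP[s0 st] := s0t; have ts : 0 < t0 - s by rewrite subr_gt0.
(* The flux h k' - h' k, as the space derivative of h at time t0 - s is
   - x/(2 (t0 - s)) h. *)
pose W x := hker x (t0 - s) * kx x s + (2 * (t0 - s))^-1 * x * (hker x (t0 - s) * k x s).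
apply: (@Rintegral_derive0 R W (dF s)); [|exact: dF_continuous|exact: dF_L1|].
  move=> x; have h1 := is_derive_hker_x x ts; have h2 := dk_x x s0; have h3 := dkx_x x s0.
  have h4 : is_derive x 1 (fun y : R => (2 * (t0 - s))^-1 * y) (2 * (t0 - s))^-1.
    by apply: (is_derive_eq (is_deriveM (is_derive_cst _ x 1) (is_derive_id x 1))); rewrite /GRing.scale/= mulr0 mulr1 addr0.
  apply: (is_derive_eq (is_deriveD (is_deriveM h1 h3) (is_deriveM h4 (is_deriveM h1 h2)))).
  by rewrite /dF /GRing.scale/= mulrfctE; field; rewrite gt_eqF.
have [C Ck] := bk s s0; have [C' Ckx] := bkx s s0.
have c0 : 0 < (4 * (t0 - s))^-1 by rewrite invr_gt0 mulr_gt0.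
have [B1 B10 HB1] := gauss_pow_bound 1 c0.
have [B2 B20 HB2] := gauss_pow_bound 2 c0.
have C0 : 0 <= C by apply: (le_trans _ (Ck 0 s _)) => //; rewrite lexx.
have C'0 : 0 <= C' by apply: (le_trans _ (Ckx 0 s _)) => //; rewrite lexx.
exists (hker 0 (t0 - s) * B1 * C' + (2 * (t0 - s))^-1 * (hker 0 (t0 - s) * B2 * C)) => x.
have Hh : hker x (t0 - s) <= hker 0 (t0 - s) * expR (- ((4 * (t0 - s))^-1 * x ^+ 2)).
  by apply: hker_dom; rewrite // lexx.
have Hp (j : nat) B : `|x| ^+ j * expR (- ((4 * (t0 - s))^-1 * x ^+ 2)) <= B ->
    `|x| ^+ j * hker x (t0 - s) <= hker 0 (t0 - s) * B.
  move=> HB; apply: (@le_trans _ _ (`|x| ^+ j * (hker 0 (t0 - s) * expR (- ((4 * (t0 - s))^-1 * x ^+ 2))))).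
    by rewrite ler_wpM2l// exprn_ge0.
  by rewrite mulrCA ler_wpM2l// ltW// hker_gt0.
have h0 := hker_gt0 x (t0 - s).
rewrite /W mulrDr (le_trans (ler_normD _ _))// lerD//.
  rewrite mulrA normrM; apply: ler_pM => //; last by apply: Ckx; rewrite lexx.
  by rewrite normrM (gtr0_norm h0) -(expr1 `|x|); exact: Hp.
rewrite -mulrA mulrCA normrM gtr0_norm ?invr_gt0 ?mulr_gt0// ler_wpM2l// ?invr_ge0 ?mulr_ge0 ?(ltW ts)//.
have -> : x * (x * (hker x (t0 - s) * k x s)) = (x * x * hker x (t0 - s)) * k x s by ring.
rewrite normrM; apply: ler_pM => //; last by apply: Ck; rewrite lexx.
rewrite (normrM (x * x)) (gtr0_norm h0) normrM -expr2; exact: Hp.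
Qed.

Let Phi (s : R) := \int[mu]_x F s x.

Let is_derive_Phi (s : R) : 0 < s < t0 -> is_derive s 1 Phi 0.
Proof.
move=> /andP[s0 st].
have a0 : 0 < s / 2 by lra.
have bt : (s + t0) / 2 < t0 by lra.
have [G [G0 iG HG]] := dom a0 bt.
have Is : (`]s / 2, (s + t0) / 2[%classic : set R) s by rewrite /= in_itv/=; apply/andP; split; lra.
have itvP x : `]s / 2, (s + t0) / 2[%classic x -> 0 < x < t0 /\ s / 2 <= x <= (s + t0) / 2.
  by rewrite /= in_itv/= => /andP[? ?]; split; apply/andP; split; lra.
have H1 x : `]s / 2, (s + t0) / 2[%classic x -> L1 (F x) by move=> /itvP[? _]; exact: F_L1.
have H2 x y : `]s / 2, (s + t0) / 2[%classic x -> [set: R] y -> derivable (F^~ y) x 1.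
  by move=> /itvP[h1 _] _; have [] := is_derive_F y h1.
have H3 x y : `]s / 2, (s + t0) / 2[%classic x -> [set: R] y -> `|partial1of2 F x y| <= G y.
  move=> /itvP[h1 h2] _; rewrite partial1of2E.
  have h3 := is_derive_F y h1.
  by rewrite derive_val; have [] := HG x y h2.
apply: DeriveDef.
  exact: (@derivable_under_integral R _ _ mu F setT measurableT s _ _ Is H1 H2 G G0 iG H3).
rewrite -derive1E (@differentiation_under_integral R _ _ mu F setT measurableT s _ _ Is H1 H2 G G0 iG H3).
rewrite -[RHS](int_dF (s := s)) ?s0//.
apply: eq_Rintegral => x _; rewrite partial1of2E.
have h3 := is_derive_F x (s := s) ltac:(by rewrite s0).
by rewrite derive_val.
Qed.

Let Phi_cst (s1 s2 : R) : 0 < s1 -> s1 < s2 -> s2 < t0 -> Phi s1 = Phi s2.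
Proof.
move=> s10 s12 s2t.
have [| |c _] := @MVT R Phi (fun=> 0) s1 s2 s12.
- by move=> x; rewrite in_itv/= => /andP[? ?]; apply: is_derive_Phi; apply/andP; split; lra.
- apply: derivable_within_continuous => x; rewrite in_itv/= => /andP[? ?].
  by have [] := @is_derive_Phi x ltac:(apply/andP; split; lra).
- by rewrite mul0r => /eqP; rewrite subr_eq0 => /eqP.
Qed.

Let Phi_scale (s : R) : 0 < s < t0 ->
  Phi s = \int[mu]_w (gam w * k (Num.sqrt (t0 - s) * w) s).
Proof.
move=> s0t; have /andP[s0 st] := s0t; have ts : 0 < t0 - s by rewrite subr_gt0.
have b0 : 0 < Num.sqrt (t0 - s) by rewrite sqrtr_gt0.
rewrite /Phi (@Rintegral_affine R 0 _ _ (lt0r_neq0 b0) (F_L1 s0t)).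
rewrite -RintegralZl//; last exact: L1_affine (lt0r_neq0 b0) (F_L1 s0t).
apply: eq_Rintegral => w _; rewrite add0r /F mulrA gtr0_norm//.
by rewrite hker_gam.
Qed.

(** A solution of the heat equation that is bounded, with its derivatives, on
    compact time intervals is propagated by the heat kernel of the line: the
    integral does not depend on s by [int_dF], and in the form given by
    [Phi_scale] its limit as s tends to t0 is k(0, t0). *)
Lemma bounded_solution_gauss (s : R) : 0 < s < t0 ->
  \int[mu]_x (hker x (t0 - s) * k x s) = k 0 t0.
Proof.
move=> s0t; have /andP[s0 st] := s0t.
(* A sequence of times in ]s, t0[ that tends to t0. *)
pose u (n : nat) : R := t0 - (t0 - s) / n.+2%:R.
have uP n : s < u n < t0.
  have n0 : (0 < n.+2%:R :> R) by [].
  rewrite /u; apply/andP; split; last by rewrite ltrBlDr ltrDl divr_gt0// subr_gt0.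
  rewrite ltrBrDr -ltrBrDl ltr_pdivrMr// ltr_pMr ?subr_gt0//.
  by rewrite ltr1n.
have E n : \int[mu]_x F s x = \int[mu]_w (gam w * k (Num.sqrt (t0 - u n) * w) (u n)).
  have /andP[? ?] := uP n.
  by rewrite -[LHS]/(Phi s) (@Phi_cst s (u n))// Phi_scale//; apply/andP; split => //; lra.
have [C Ck] := bk t0 s0.
have ut : u n @[n --> \oo] --> t0.
  rewrite -[X in _ --> X]subr0; apply: cvgB; first exact: cvg_cst.
  rewrite -(mulr0 (t0 - s)); apply: cvgM; first exact: cvg_cst.
  by rewrite (cvg_shiftS (fun n => n.+1%:R^-1 : R)); exact: cvg_harmonic.
(* After scaling, the mass sits at points that tend to 0 with u n to t0. *)
have L : \int[mu]_w (gam w * k (Num.sqrt (t0 - u n) * w) (u n)) @[n --> \oo] --> \int[mu]_w (gam w * k 0 t0).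
  apply: (@Rdominated_cvg _ _ _ (fun w => C * gam w)).
  - move=> n; have /andP[h1 h2] := uP n.
    apply: continuous_measurable_fun => w; apply: cvgM; first exact: continuous_gam.
    apply: (@continuous_comp _ _ _ (fun w : R => Num.sqrt (t0 - u n) * w) (k^~ (u n))).
      by apply: cvgM; [exact: cvg_cst|exact: cvg_id].
    by apply: k_continuous; lra.
  - exact: L1Z gam_L1.
  - move=> n w; have /andP[h1 h2] := uP n.
    rewrite normrM gtr0_norm ?gam_gt0// mulrC ler_wpM2r ?(ltW (gam_gt0 _))//.
    by apply: Ck; rewrite !ltW.
  - move=> w; apply: cvgM; first exact: cvg_cst.
    have H0 : t0 - u n @[n --> \oo] --> 0.
      by rewrite -[X in _ --> X](subrr t0); apply: cvgB => //; exact: cvg_cst.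
    have H1 : Num.sqrt (t0 - u n) * w @[n --> \oo] --> 0.
      have E0 : Num.sqrt 0 * w = 0 by rewrite sqrtr0 mul0r.
      rewrite -[X in _ --> X]E0.
      by apply: cvgM; [apply: continuous_cvg => //; exact: sqrt_continuous|exact: cvg_cst].
    have H : (Num.sqrt (t0 - u n) * w, u n) @[n --> \oo] --> ((0 : R), t0).
      apply: (@cvg_pair nat R R \oo (nbhs (0:R)) (nbhs t0) _ _ _ (fun n => Num.sqrt (t0 - u n) * w) u); [exact: H1|exact: ut].
    have := @ck (0, t0) ltac:(by rewrite /=; lra).
    move=> H2; exact: (@continuous_cvg _ _ _ _ _ (fun n => (Num.sqrt (t0 - u n) * w, u n)) (fun q : R * R => k q.1 q.2) ((0 : R), t0) H2 H).
have -> : k 0 t0 = \int[mu]_w (gam w * k 0 t0).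
  by rewrite RintegralZr//; [rewrite gam_int1 mul1r|exact: gam_L1].
apply: (cvg_unique _ _ L) => //.
rewrite (_ : (fun n => _) = (fun=> \int[mu]_x F s x)); first exact: cvg_cst.
by apply/funext => n; rewrite -E.
Qed.

End Duality.

Section HeatKernel.
Context {R : realType}.
Local Notation mu := (@lebesgue_measure R).
Implicit Types f g h : R -> R.

Lemma cvg_to_pair {T : Type} {U V : topologicalType} (G : set_system T) (FG : Filter G)
    (f : T -> U) (g : T -> V) (a : U) (b : V) :
  f x @[x --> G] --> a -> g x @[x --> G] --> b -> (f x, g x) @[x --> G] --> (a, b).
Proof. by move=> fa gb; apply: (@cvg_pair T U V G (nbhs a) (nbhs b)). Qed.

Lemma is_derive_derive1 (f : R -> R) (x : R) : derivable f x 1 -> is_derive x 1 f (derive1 f x).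
Proof. by move=> df; rewrite derive1E; exact/derivableP. Qed.

Lemma is_derive_translate (f : R -> R) (a x d : R) :
  is_derive (a + x) 1 f d -> is_derive x 1 (fun y => f (a + y)) d.
Proof.
move=> df; have H : is_derive x 1 (fun y : R => a + y) 1.
  by apply: (is_derive_eq (is_deriveD (is_derive_cst a x 1) (is_derive_id x 1))); rewrite add0r.
by have := @is_derive1_comp R f (fun y => a + y) x _ _ df H; rewrite mulr1.
Qed.

Variable K : R -> R -> R -> R.
Hypothesis hK : is_heat_kernel K.

Lemma hker_int1 (t : R) : 0 < t -> L1 (hker^~ t) /\ \int[mu]_x hker x t = 1.
Proof.
move=> t0.
have i1 : L1 (hker^~ t).
  have c0 : 0 < (4 * t)^-1 by rewrite invr_gt0 mulr_gt0.
  apply: (L1_dom _ (L1Z (hker 0 t) (gauss_L1 c0))).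
    by apply: continuous_measurable_fun; exact: hker_continuous.
  by move=> x; rewrite gtr0_norm ?hker_gt0// hker_dom// lexx.
split => //; have b0 : 0 < Num.sqrt t by rewrite sqrtr_gt0.
rewrite (@Rintegral_affine R 0 _ _ (lt0r_neq0 b0) i1) -RintegralZl//; last exact: L1_affine (lt0r_neq0 b0) i1.
by rewrite -[RHS]gam_int1; apply: eq_Rintegral => w _; rewrite add0r gtr0_norm// hker_gam.
Qed.

(** The kernel of the circle, lifted to the line, is a periodic hence bounded
    solution of the heat equation. *)
Lemma heat_kernel_reproducing (x0 y t s : R) : 0 < s < t ->
  \int[mu]_x (hker x (t - s) * K (x0 + x) y s) = K x0 y t.
Proof.
move=> s0t.
(* In [ks] the time derivative serves as second space derivative, by the
   heat equation. *)
pose k x s := K (x0 + x) y s.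
pose kx x s := derive1 (fun z => K z y s) (x0 + x).
pose ks x s := derive1 (fun u => K (x0 + x) y u) s.
have ksE x u : 0 < u -> ks x u = derive1 (derive1 (fun z => K z y u)) (x0 + x).
  move=> u0; have /eqP := hk_equation hK (x0 + x) y u0.
  by rewrite /DopR subr_eq0 => /eqP.
have pk u : 0 < u -> periodic2pi (k^~ u).
  by move=> u0 x; rewrite /k addrA (hk_periodicl hK y u0).
have pkx u : 0 < u -> periodic2pi (kx^~ u).
  by move=> u0 x; rewrite /kx addrA (periodic2pi_derive1 (hk_periodicl hK y u0)).
have pks u : 0 < u -> periodic2pi (ks^~ u).
  move=> u0 x; rewrite (ksE _ _ u0) (ksE x _ u0) addrA.
  by rewrite (periodic2pi_derive1 (periodic2pi_derive1 (hk_periodicl hK y u0))).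
have cpt (p : R * R) : {for p, continuous (fun q : R * R => (x0 + q.1, y, q.2))}.
  apply: (@cvg_to_pair _ _ _ _ _ (fun q : R * R => (x0 + q.1, y)) snd); last exact: cvg_snd.
  apply: (@cvg_to_pair _ _ _ _ _ (fun q : R * R => x0 + q.1) (fun=> y)); last exact: cvg_cst.
  by apply: cvgD; [exact: cvg_cst|exact: cvg_fst].
have ck (p : R * R) : 0 < p.2 -> {for p, continuous (fun q : R * R => k q.1 q.2)}.
  by move=> p0; exact: (@continuous_cvg _ _ _ _ _ (fun q : R * R => (x0 + q.1, y, q.2)) (fun q : R * R * R => K q.1.1 q.1.2 q.2) (x0 + p.1, y, p.2) (@hk_continuous  _ _ hK (x0 + p.1, y, p.2) p0) (cpt p)).
have ckx2 (p : R * R) : 0 < p.2 -> {for p, continuous (fun q : R * R => kx q.1 q.2)}.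
  by move=> p0; exact: (@continuous_cvg _ _ _ _ _ (fun q : R * R => (x0 + q.1, y, q.2)) (fun q : R * R * R => derive1 (fun z => K z q.1.2 q.2) q.1.1) (x0 + p.1, y, p.2) (@hk_continuous_x  _ _ hK (x0 + p.1, y, p.2) p0) (cpt p)).
have cks2 (p : R * R) : 0 < p.2 -> {for p, continuous (fun q : R * R => ks q.1 q.2)}.
  by move=> p0; exact: (@continuous_cvg _ _ _ _ _ (fun q : R * R => (x0 + q.1, y, q.2)) (fun q : R * R * R => derive1 (fun s => K q.1.1 q.1.2 s) q.2) (x0 + p.1, y, p.2) (@hk_continuous_t  _ _ hK (x0 + p.1, y, p.2) p0) (cpt p)).
have slice (F : R -> R -> R) : (forall p : R * R, 0 < p.2 -> {for p, continuous (fun q : R * R => F q.1 q.2)}) ->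
    forall u : R, 0 < u -> continuous (F^~ u).
  move=> cF u u0 x.
  apply: (@continuous_cvg _ _ _ _ _ (fun x : R => (x, u)) (fun q : R * R => F q.1 q.2) (x, u) (cF (x, u) u0)).
  by apply: (@cvg_to_pair _ _ _ _ _ id (fun=> u)); [exact: cvg_id|exact: cvg_cst].
have bd (F : R -> R -> R) : (forall p : R * R, 0 < p.2 -> {for p, continuous (fun q : R * R => F q.1 q.2)}) ->
    (forall u, 0 < u -> periodic2pi (F^~ u)) ->
    forall a b : R, 0 < a -> exists C : R, forall x s : R, a <= s <= b -> `|F x s| <= C.
  move=> cF pF a b a0.
  have [] := @periodic2pi_bounded R (fun q => F q.1 q.2) a b.
  - by move=> p /andP[h1 _]; apply: cF; lra.
  - by move=> u /andP[h1 _]; apply: pF; lra.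
  - by move=> C HC; exists C.
rewrite (@bounded_solution_gauss R k kx ks _ _ _ ck (slice _ cks2) (bd _ ck pk) (bd _ ckx2 pkx) (bd _ cks2 pks))//.
- by rewrite /k addr0.
- by move=> x u u0; apply: is_derive_derive1; exact: hk_derivable_t.
- move=> x u u0; apply: (@is_derive_translate (fun z => K z y u)); apply: is_derive_derive1.
  exact: (hk_derivable_x hK).
- move=> x u u0; rewrite (ksE x u u0); apply: (@is_derive_translate (derive1 (fun z => K z y u))).
  by apply: is_derive_derive1; exact: (hk_derivable_xx hK).
Qed.

Lemma heat_kernel_continuous (t : R) : 0 < t -> continuous (fun q : R * R => K q.1 q.2 t).
Proof.
move=> t0 p.
apply: (@continuous_cvg _ _ _ _ _ (fun q : R * R => (q.1, q.2, t)) (fun q : R * R * R => K q.1.1 q.1.2 q.2) (p.1, p.2, t)).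
  exact: (@hk_continuous _ _ hK (p.1, p.2, t)).
apply: (@cvg_to_pair _ _ _ _ _ (fun q : R * R => (q.1, q.2)) (fun=> t)); last exact: cvg_cst.
by apply: (@cvg_to_pair _ _ _ _ _ fst snd); [exact: cvg_fst|exact: cvg_snd].
Qed.

Lemma heat_kernel_bounded (t : R) : 0 < t -> exists C : R, forall x y, 0 <= y <= 2 * pi -> `|K x y t| <= C.
Proof.
move=> t0.
have [p _|s _|C HC] := @periodic2pi_bounded R (fun q => K q.1 q.2 t) 0 (2 * pi).
- exact: heat_kernel_continuous.
- exact: (hk_periodicl hK s t0).
- by exists C.
Qed.

Lemma gam_average_cvg (f : R -> R) (C x0 : R) : continuous f -> (forall x, `|f x| <= C) ->
  forall (u : nat -> R) (t : R), u n @[n --> \oo] --> t ->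
  \int[mu]_w (gam w * f (x0 + Num.sqrt (u n) * w)) @[n --> \oo] --> \int[mu]_w (gam w * f (x0 + Num.sqrt t * w)).
Proof.
move=> cf bf u t ut; apply: (@Rdominated_cvg _ _ _ (fun w => C * gam w)).
- move=> n; apply: continuous_measurable_fun => w; apply: cvgM; first exact: continuous_gam.
  apply: (@continuous_comp _ _ _ (fun w : R => x0 + Num.sqrt (u n) * w) f); last exact: cf.
  by apply: cvgD; [exact: cvg_cst|apply: cvgM; [exact: cvg_cst|exact: cvg_id]].
- exact: L1Z gam_L1.
- move=> n w; rewrite normrM gtr0_norm ?gam_gt0// mulrC ler_wpM2r ?(ltW (gam_gt0 _))//.
- move=> w; apply: cvgM; first exact: cvg_cst.
  apply: (@continuous_cvg _ _ _ _ _ (fun n => x0 + Num.sqrt (u n) * w) f); first exact: cf.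
  apply: cvgD; first exact: cvg_cst.
  by apply: cvgM; [apply: continuous_cvg => //; exact: sqrt_continuous|exact: cvg_cst].
Qed.

(** Integrate [heat_kernel_reproducing] against f and let s tend to 0: the
    integral of K(x0 + x, y, s) f(y) over y then tends to f(x0 + x), uniformly
    in x. *)
Lemma heat_kernel_gauss (f : R -> R) (x0 t : R) : 0 < t -> continuous f -> periodic2pi f ->
  \int[mu]_(y in `[0, 2 * pi]) (K x0 y t * f y) = \int[mu]_w (gam w * f (x0 + Num.sqrt t * w)).
Proof.
move=> t0 cf pf.
have [C bf] : exists C : R, forall x, `|f x| <= C.
  have [p _|s _|C HC] := @periodic2pi_bounded R (fun q => f q.1) 0 0.
  - by apply: (@continuous_comp _ _ _ fst f); [exact: cvg_fst|exact: cf].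
  - exact: pf.
  - by exists C => x; apply: (HC x 0); rewrite lexx.
pose I : set R := `[0, 2 * pi]%classic.
have mI : measurable I by exact: measurable_itv.
pose u s x := \int[mu]_(y in I) (K x y s * f y).
have fub (s : R) : 0 < s < t ->
    L1 (fun x => hker x (t - s) * u s (x0 + x)) /\
    \int[mu]_(y in I) (K x0 y t * f y) = \int[mu]_x (hker x (t - s) * u s (x0 + x)).
  move=> s0t; have /andP[s0 st] := s0t; have ts : 0 < t - s by rewrite subr_gt0.
  have [CK bK] := heat_kernel_bounded s0.
  have [ih _] := hker_int1 ts.
  have C0 : 0 <= CK by apply: (le_trans _ (bK 0 0 _)) => //; rewrite lexx mulr_ge0// ltW// pi_gt0.
  pose F x y := hker x (t - s) * (\1_I y * (K (x0 + x) y s * f y)).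
  have mF : measurable_fun setT (fun p : R * R => F p.1 p.2).
    apply: measurable_funM.
      apply: (measurableT_comp (f := fun x => hker x (t - s))) => //.
      by apply: continuous_measurable_fun; exact: hker_continuous.
    apply: measurable_funM; first exact: (measurableT_comp (measurable_indic mI)).
    apply: measurable_funM; last by apply: (measurableT_comp (f := f)) => //; exact: continuous_measurable_fun.
    apply: continuous_measurable_pair => p.
    apply: (@continuous_cvg _ _ _ _ _ (fun q : R * R => (x0 + q.1, q.2)) (fun q => K q.1 q.2 s) (x0 + p.1, p.2)).
      exact: heat_kernel_continuous.
    apply: (@cvg_to_pair _ _ _ _ _ (fun q : R * R => x0 + q.1) snd); last exact: cvg_snd.
    by apply: cvgD; [exact: cvg_cst|exact: cvg_fst].
  have ib : L1 (fun y => CK * C * \1_I y).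
    by apply: L1Z; exact: integrable_indic_itv.
  have Fb x y : `|F x y| <= hker x (t - s) * (CK * C * \1_I y).
    rewrite /F normrM (gtr0_norm (hker_gt0 _ _)) ler_wpM2l ?(ltW (hker_gt0 _ _))//.
    rewrite indicE; case: (boolP (y \in I)) => yI; last by rewrite mul0r normr0 mulr0.
    rewrite mul1r mulr1 normrM ler_pM//.
    by apply: bK; move: yI; rewrite inE /I/= in_itv.
  have [F1 F2 F3 F4] := Rfubini mF ih ib Fb.
  have E x : \int[mu]_y F x y = hker x (t - s) * u s (x0 + x).
    rewrite /F RintegralZl//; first by rewrite -Rintegral_indic.
    have := L1Z (hker x (t - s))^-1 (F1 x); congr L1; apply/funext => y.
    by rewrite /F mulrA mulVf ?mul1r// gt_eqF// hker_gt0.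
  split; first by move: F3; congr L1; apply/funext => x; rewrite E.
  rewrite Rintegral_indic -[RHS](_ : \int[mu]_x \int[mu]_y F x y = _); last by apply: eq_Rintegral => x _; rewrite E.
  rewrite F4; apply: eq_Rintegral => y _.
  rewrite indicE; case: (boolP (y \in I)) => yI; last first.
    rewrite mul0r (_ : (fun x => F x y) = cst 0) ?Rintegral_cst ?mul0r//.
    by apply/funext => x; rewrite /F indicE (negbTE yI) mul0r mulr0.
  rewrite mul1r -(heat_kernel_reproducing x0 y s0t) -RintegralZr//; last first.
    apply: (L1_dom _ (L1Z CK ih)).
      apply: continuous_measurable_fun => x; apply: cvgM; first exact: hker_continuous.
      apply: (@continuous_cvg _ _ _ _ _ (fun x : R => (x0 + x, y)) (fun q => K q.1 q.2 s) (x0 + x, y)).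
        exact: heat_kernel_continuous.
      apply: (@cvg_to_pair _ _ _ _ _ (fun x : R => x0 + x) (fun=> y)); last exact: cvg_cst.
      by apply: cvgD; [exact: cvg_cst|exact: cvg_id].
    move=> x; rewrite normrM (gtr0_norm (hker_gt0 _ _)) mulrC ler_wpM2r ?(ltW (hker_gt0 _ _))//.
    by apply: bK; move: yI; rewrite inE /I/= in_itv.
  by apply: eq_Rintegral => x _; rewrite /F indicE yI mul1r mulrA.
pose s (n : nat) : R := t / n.+2%:R.
have s0t n : 0 < s n < t.
  by rewrite /s divr_gt0//= ltr_pdivrMr// ltr_pMr// ltr1n.
have s0 : s n @[n --> \oo] --> 0.
  rewrite -(mulr0 t); apply: cvgM; first exact: cvg_cst.
  by rewrite (cvg_shiftS (fun n => n.+1%:R^-1 : R)); exact: cvg_harmonic.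
have ts : t - s n @[n --> \oo] --> t.
  by rewrite -[X in _ --> X]subr0; apply: cvgB => //; exact: cvg_cst.
have L := @gam_average_cvg f C x0 cf bf _ _ ts.
apply: (cvg_unique _ _ L) => //.
apply/cvgrPdist_le => e e0.
have [d /= d0 Hd] := hk_initial hK cf pf e0.
have : \forall n \near \oo, s n < d.
  by have /cvgrPdist_lt/(_ d d0) := s0; apply: filterS => n; rewrite sub0r normrN; exact: le_lt_trans (ler_norm _).
apply: filterS => n snd; have /andP[sn0 snt] := s0t n.
have tsn : 0 < t - s n by rewrite subr_gt0.
have [iu ->] := fub _ (s0t n).
have [ih ih1] := hker_int1 tsn.
have b0 : 0 < Num.sqrt (t - s n) by rewrite sqrtr_gt0.
have ihf : L1 (fun x => hker x (t - s n) * f (x0 + x)).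
  apply: (L1_dom _ (L1Z C ih)).
    apply: continuous_measurable_fun => x; apply: cvgM; first exact: hker_continuous.
    apply: (@continuous_comp _ _ _ (fun x : R => x0 + x) f); last exact: cf.
    by apply: cvgD; [exact: cvg_cst|exact: cvg_id].
  by move=> x; rewrite normrM (gtr0_norm (hker_gt0 _ _)) mulrC ler_wpM2r ?(ltW (hker_gt0 _ _)).
have -> : \int[mu]_w (gam w * f (x0 + Num.sqrt (t - s n) * w)) = \int[mu]_x (hker x (t - s n) * f (x0 + x)).
  rewrite [RHS](@Rintegral_affine R 0 _ _ (lt0r_neq0 b0) ihf) -RintegralZl//; last exact: L1_affine (lt0r_neq0 b0) ihf.
  by apply: eq_Rintegral => w _; rewrite add0r gtr0_norm// mulrA hker_gam.
rewrite -RintegralB//.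
have -> : e = \int[mu]_x (e * hker x (t - s n)) by rewrite RintegralZl// ih1 mulr1.
apply: Rintegral_le_dom; [exact: L1B|exact: L1Z|] => x.
rewrite -mulrBr normrM (gtr0_norm (hker_gt0 _ _)) mulrC ler_wpM2r ?(ltW (hker_gt0 _ _))//.
apply: Hd => //=; rewrite sub0r normrN gtr0_norm//.
Qed.

End HeatKernel.

(** * Functions supported in a half circle *)
Section CutOff.
Context {R : realType}.
Local Notation mu := (@lebesgue_measure R).
Implicit Types f g h : R -> R.

(** The 2 pi-periodic even map that is the identity on [0, pi].  Composing with
    it extends a function on Omega continuously to the whole circle. *)
Definition fold (y : R) : R := acos (cos y).

(** The periodic function equal to [g] on the open half circle ]0, pi[ and to 0
    on the complementary closed half circle. *)
Definition arc (g : R -> R) (y : R) : R := if 0 < sin y then g (fold y) else 0.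

Lemma arc_in g y : 0 < y < pi -> arc g y = g y.
Proof.
by move=> y0; rewrite /arc sin_gt0_pi// /fold cosK// in_itv/= !ltW; case/andP: y0.
Qed.

Lemma arc_outl g y : - pi <= y <= 0 -> arc g y = 0.
Proof.
move=> y0; rewrite /arc ifF//; apply/negbTE; rewrite -leNgt -oppr_ge0 -sinN.
by apply: sin_ge0_pi; case/andP: y0 => ? ?; apply/andP; split; lra.
Qed.

Lemma arc_outr g y : pi <= y <= 2 * pi -> arc g y = 0.
Proof.
move=> y0; rewrite /arc ifF//; apply/negbTE; rewrite -leNgt.
rewrite -(subrK pi y) sinDpi oppr_le0.
by apply: sin_ge0_pi; case/andP: y0 => ? ?; apply/andP; split; lra.
Qed.

Lemma fold_itv y : 0 <= fold y <= pi.
Proof. by apply/andP; split; [apply: acos_ge0|apply: acos_lepi]; rewrite cos_geN1 cos_le1. Qed.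

Lemma arc_bounded g : continuous g -> exists2 C : R, 0 <= C & forall y, `|g (fold y)| <= C /\ `|arc g y| <= C.
Proof.
move=> cg.
have cNg : {within `[0, pi], continuous (fun y => `|g y|)}.
  by apply: continuous_subspaceT => y; apply: continuous_comp; [exact: cg|exact: norm_continuous].
have [c _ Hc] := EVT_max (pi_ge0 R) cNg.
exists `|g c| => // y; have H : `|g (fold y)| <= `|g c| by apply: Hc; rewrite in_itv/= fold_itv.
by split => //; rewrite /arc; case: ifP => // _; rewrite normr0.
Qed.

(** Continuous cut-offs that converge to the indicator of ]0, +oo[. *)
Let ramp (n : nat) (s : R) : R := Num.min 1 (Num.max 0 (n.+1%:R * s - 1)).

Let ramp_itv n s : 0 <= ramp n s <= 1.
Proof. by rewrite /ramp le_min ler01/= le_max lexx/= ge_min lexx. Qed.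

Let ramp0 n s : n.+1%:R * s <= 1 -> ramp n s = 0.
Proof. by move=> h; rewrite /ramp max_l ?min_r// subr_le0. Qed.

Let ramp1 n s : 2 <= n.+1%:R * s -> ramp n s = 1.
Proof. by move=> h; rewrite /ramp max_r ?min_l; lra. Qed.

Let ramp_continuous n : continuous (ramp n).
Proof.
move=> s.
have c1 : {for s, continuous (fun s : R => n.+1%:R * s - 1)}.
  by apply: cvgB; [apply: cvgM; [exact: cvg_cst|exact: cvg_id]|exact: cvg_cst].
have c0 (a : R) : {for s, continuous (fun _ : R => a)} by exact: cvg_cst.
exact: (continuous_min (c0 1) (continuous_max (c0 0) c1)).
Qed.

Let smoothed (g : R -> R) (n : nat) (y : R) := ramp n (sin y) * g (fold y).

(** Where sin y > 0, cos y is in ]-1, 1[ and acos is smooth there; near the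
    points where sin y <= 0 the cut-off makes the product vanish. *)
Let smoothed_continuous g n : continuous g -> continuous (smoothed g n).
Proof.
move=> cg y; have [s0|s0] := ltP 0 (sin y).
  apply: cvgM.
    apply: (@continuous_comp _ _ _ sin (ramp n)); [exact: continuous_sin|exact: ramp_continuous].
  apply: (@continuous_comp _ _ _ fold g); last exact: cg.
  apply: (@continuous_comp _ _ _ cos acos); first exact: continuous_cos.
  apply: continuous_acos.
  have h1 := cos2Dsin2 y; have h2 : 0 < sin y ^+ 2 by rewrite exprn_gt0.
  have : cos y ^+ 2 < 1 by lra.
  rewrite -[X in _ < X](expr1n _ 2) => h.
  by rewrite -ltr_norml -(@ltr_pXn2r _ 2)// ?nnegrE// real_normK// num_real.
have h : \forall z \near y, smoothed g n z = 0.
  have : \forall z \near y, sin z < n.+1%:R^-1.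
    have := @continuous_sin R y; move=> /cvgr_lt; apply.
    by rewrite (le_lt_trans s0)// invr_gt0.
  apply: filterS => z sz; rewrite /smoothed ramp0 ?mul0r//.
  by rewrite -ler_pdivlMl// mulr1 ltW.
have E : smoothed g n y = 0 by exact: nbhs_singleton h.
by apply: cvg_near_cst; apply: filterS h => z ->; rewrite E.
Qed.

Let smoothed_cvg g y : smoothed g n y @[n --> \oo] --> arc g y.
Proof.
rewrite /arc; case: ltP => s0; last first.
  apply: cvg_near_cst; apply: nearW => n; rewrite /smoothed ramp0 ?mul0r//.
  by rewrite (@le_trans _ _ 0)// mulr_ge0_le0.
apply: cvg_near_cst; near=> n; rewrite /smoothed ramp1 ?mul1r//.
rewrite -ler_pdivrMr// (@le_trans _ _ n%:R)// ?ler_nat//.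
by near: n; exact: nbhs_infty_ger.
Unshelve. all: by end_near.
Qed.

Lemma arc_measurable g : continuous g -> measurable_fun setT (arc g).
Proof.
move=> cg; apply/measurable_EFinP; apply: (emeasurable_fun_cvg (fun n => EFin \o smoothed g n)) => [n|y _].
  by apply/measurable_EFinP; apply: continuous_measurable_fun; exact: smoothed_continuous.
by apply: cvg_EFin; [exact: nearW|exact: smoothed_cvg].
Qed.

Variable K : R -> R -> R -> R.
Hypothesis hK : is_heat_kernel K.

(** The averaging formula for the discontinuous [arc g], by dominated
    convergence along [smoothed g n] in both integrals. *)
Lemma half_circle_gauss (g : R -> R) (x0 t : R) : 0 < t -> continuous g ->
  \int[mu]_(y in `]0, pi[) (K x0 y t * g y) = \int[mu]_w (gam w * arc g (x0 + Num.sqrt t * w)).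
Proof.
move=> t0 cg; have [C C0 bg] := arc_bounded cg.
have p0 : 0 < pi :> R := pi_gt0 R.
have bs n y : `|smoothed g n y| <= C.
  rewrite /smoothed normrM -(mul1r C) ler_pM//; last by have [] := bg y.
  by have /andP[h0 h1] := ramp_itv n (sin y); rewrite ger0_norm.
have ps n : periodic2pi (smoothed g n).
  by move=> y; rewrite /smoothed /fold (_ : 2 * pi = pi *+ 2) ?sinD2pi ?cosD2pi// mulr_natl.
pose I : set R := `[0, 2 * pi]%classic.
have mI : measurable I by exact: measurable_itv.
have [CK bK] := heat_kernel_bounded hK t0.
have CK0 : 0 <= CK by apply: (le_trans _ (bK 0 0 _)) => //; rewrite lexx mulr_ge0// ltW.
have mK : measurable_fun setT (fun y => K x0 y t).
  apply: continuous_measurable_fun => y.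
  apply: (@continuous_cvg _ _ _ _ _ (fun y : R => (x0, y)) (fun q => K q.1 q.2 t) (x0, y)).
    exact: (heat_kernel_continuous hK).
  by apply: (@cvg_to_pair _ _ _ _ _ (fun=> x0) id); [exact: cvg_cst|exact: cvg_id].
have L1' : \int[mu]_y (\1_I y * (K x0 y t * smoothed g n y)) @[n --> \oo] --> \int[mu]_y (\1_I y * (K x0 y t * arc g y)).
  apply: (@Rdominated_cvg _ _ _ (fun y => CK * C * \1_I y)).
  - move=> n; apply: measurable_funM => //; apply: measurable_funM => //.
    by apply: continuous_measurable_fun; exact: smoothed_continuous.
  - by apply: L1Z; exact: integrable_indic_itv.
  - move=> n y; rewrite indicE; case: (boolP (y \in I)) => yI; last by rewrite mul0r normr0 mulr0.
    rewrite mul1r mulr1 normrM ler_pM//.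
    by apply: bK; move: yI; rewrite inE /I/= in_itv.
  - move=> y; apply: cvgM; first exact: cvg_cst.
    by apply: cvgM; [exact: cvg_cst|exact: smoothed_cvg].
have L2' : \int[mu]_w (gam w * smoothed g n (x0 + Num.sqrt t * w)) @[n --> \oo] --> \int[mu]_w (gam w * arc g (x0 + Num.sqrt t * w)).
  apply: (@Rdominated_cvg _ _ _ (fun w => C * gam w)).
  - move=> n; apply: measurable_funM; first by apply: continuous_measurable_fun; exact: continuous_gam.
    apply: (measurableT_comp (f := smoothed g n)); last exact: affine_measurable.
    by apply: continuous_measurable_fun; exact: smoothed_continuous.
  - exact: L1Z gam_L1.
  - by move=> n w; rewrite normrM gtr0_norm ?gam_gt0// mulrC ler_wpM2r ?(ltW (gam_gt0 _)).
  - by move=> w; apply: cvgM; [exact: cvg_cst|exact: smoothed_cvg].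
transitivity (\int[mu]_y (\1_I y * (K x0 y t * arc g y))).
  rewrite Rintegral_indic; apply: eq_Rintegral => y _; rewrite !indicE.
  case: (boolP (y \in I)) => yI; case: (boolP (y \in _)) => yJ.
  - by rewrite arc_in//; move: yJ; rewrite inE/= in_itv.
  - rewrite mul0r mul1r; move: yI; rewrite inE /I/= in_itv/= => /andP[y1 y2].
    move: yJ; rewrite notin_setE/= in_itv/= => /negP; rewrite negb_and -!leNgt => /orP[h|h].
    + by rewrite arc_outl ?mulr0//; apply/andP; split; lra.
    + by rewrite arc_outr ?mulr0// h.
  - move: yI yJ; rewrite notin_setE inE /I/= !in_itv/= => h /andP[h1 h2].
    by exfalso; apply: h; apply/andP; split; lra.
  - by rewrite !mul0r.
rewrite (_ : (fun n => \int[mu]_y _) = (fun n => \int[mu]_w (gam w * smoothed g n (x0 + Num.sqrt t * w)))) in L1'.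
  exact: (cvg_unique _ L1' L2').
apply/funext => n; rewrite -Rintegral_indic.
by rewrite heat_kernel_gauss//; exact: smoothed_continuous.
Qed.

End CutOff.

(** * Taylor expansions with uniform remainders *)
Section Taylor.
Context {R : realType}.
Local Notation mu := (@lebesgue_measure R).
Implicit Types f g h : R -> R.

Definition taylor (D : nat -> R -> R) (m : nat) (a z : R) : R :=
  \sum_(k < m) D k a / k`!%:R * z ^+ k.

(** All the derivatives are carried together: shifting the sequence is
    differentiation, which is what inductions on the order use. *)
Definition derivatives (D : nat -> R -> R) : Prop :=
  forall n (x : R), is_derive x 1 (D n) (D n.+1 x).

Lemma derivatives_continuous D n : derivatives D -> continuous (D n).
Proof.
by move=> hD x; apply/differentiable_continuous/derivable1_diffP; have [] := hD n x.
Qed.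

Lemma continuous_bounded_itv f (A B : R) : continuous f ->
  exists2 C : R, 0 <= C & forall x, A <= x <= B -> `|f x| <= C.
Proof.
move=> cf; have [AB|AB] := leP A B; last first.
  by exists 0 => // x /andP[? ?]; lra.
have cNf : {within `[A, B], continuous (fun y => `|f y|)}.
  by apply: continuous_subspaceT => y; apply: continuous_comp; [exact: cf|exact: norm_continuous].
have [c _ Hc] := EVT_max AB cNf.
by exists `|f c| => // x xAB; apply: Hc; rewrite in_itv.
Qed.

(** By induction on the order: the mean value theorem bounds the remainder of
    order m+1 of D 0 by (y - a) times the remainder of order m of D 1.  The
    constant does not depend on the base point a. *)
Lemma taylor_bound (D : nat -> R -> R) (A B : R) (m : nat) : derivatives D ->
  exists2 M : R, 0 <= M & forall a x, A <= a <= B -> A <= x <= B ->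
    `|D 0%N x - taylor D m a (x - a)| <= M * `|x - a| ^+ m.
Proof.
elim: m D => [|m IH] D hD.
  have [C C0 HC] := @continuous_bounded_itv (D 0%N) A B (@derivatives_continuous D 0%N hD).
  exists C => // a x _ xAB; rewrite /taylor big_ord0 subr0 expr0 mulr1; exact: HC.
have [M M0 HM] := IH (fun n => D n.+1) (fun n x => hD n.+1 x).
exists M => // a x aAB xAB.
pose r y := D 0%N y - taylor D m.+1 a (y - a).
pose dr y := D 1%N y - taylor (fun n => D n.+1) m a (y - a).
have dR (y : R) : is_derive y 1 r (dr y).
  have hs : is_derive y 1 (fun y : R => y - a) 1.
    by apply: (is_derive_eq (is_deriveB (is_derive_id y 1) (is_derive_cst a y 1))); rewrite subr0.
  have hsum n : is_derive y 1 (fun y => taylor D n.+1 a (y - a)) (taylor (fun n => D n.+1) n a (y - a)).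
    elim: n => [|n IHn].
      rewrite /taylor big_ord0 (_ : (fun y => _) = cst (D 0%N a)); first exact: is_derive_cst.
      by apply/funext => z; rewrite big_ord_recl big_ord0 expr0 mulr1 addr0 fact0 divr1.
    rewrite (_ : (fun y => _) = (fun y => taylor D n.+1 a (y - a)) \+ (fun y => D n.+1 a / n.+1`!%:R * (y - a) ^+ n.+1)); last first.
      by apply/funext => z /=; rewrite /taylor big_ord_recr.
    have hX := @is_deriveX _ _ _ n.+1 y 1 _ hs.
    rewrite exprfctE in hX.
    have hZ := @is_deriveZ _ _ _ _ (D n.+1 a / n.+1`!%:R) y 1 _ hX.
    apply: (is_derive_eq (is_deriveD IHn hZ)).
    rewrite /taylor big_ord_recr/= /GRing.scale/= mulr1; congr (_ + _).
    rewrite mulrA factS natrM; congr (_ * _).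
    by field; rewrite !pnatr_eq0 -lt0n fact_gt0/= addrC natr1 pnatr_eq0.
  exact: is_deriveB.
have ra : r a = 0.
  rewrite /r /taylor subrr big_ord_recl/= expr0 mulr1 fact0 divr1 big1 ?addr0 ?subrr// => i _.
  by rewrite expr0n/= mulr0.
have bound y z : y < z -> A <= y -> z <= B -> (a = y \/ a = z) -> `|r z - r y| <= M * (z - y) ^+ m.+1.
  move=> yz Ay zB yza.
  have [|c] := @MVT R r dr y z yz (fun w _ => dR w).
    by apply: derivable_within_continuous => w _; have [] := dR w.
  rewrite in_itv/= => /andP[yc cz] ->; rewrite normrM exprSr mulrA (gtr0_norm (_ : 0 < z - y)) ?subr_gt0//.
  rewrite ler_wpM2r ?subr_ge0 ?(ltW yz)//.
  have cAB : A <= c <= B by apply/andP; split; lra.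
  apply: (le_trans (HM a c aAB cAB)).
  rewrite ler_wpM2l// lerXn2r ?nnegrE ?subr_ge0 ?(ltW yz)//.
  by rewrite ler_norml; case: yza => ->; apply/andP; split; lra.
rewrite -/(r x); have [xa|ax|->] := ltgtP x a.
- have -> : `|r x| = `|r a - r x| by rewrite ra sub0r normrN.
  have -> : `|x - a| = a - x by rewrite ltr0_norm ?opprB// subr_lt0.
  by apply: bound => //; [case/andP: xAB|case/andP: aAB|right].
- have -> : `|r x| = `|r x - r a| by rewrite ra subr0.
  have -> : `|x - a| = x - a by rewrite gtr0_norm// subr_gt0.
  by apply: bound => //; [case/andP: aAB|case/andP: xAB|left].
- by rewrite ra normr0 mulr_ge0// exprn_ge0.
Qed.

Lemma taylor_growth (D : nat -> R -> R) (A B : R) (m : nat) : derivatives D ->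
  exists2 M : R, 0 <= M & forall a z y, A <= a <= B -> `|z| <= y -> 1 <= y ->
    `|taylor D m a z| <= M * y ^+ m.
Proof.
move=> hD; elim: m => [|m [M M0 HM]].
  by exists 0 => // a z y _ _ _; rewrite /taylor big_ord0 normr0 mul0r.
have [C C0 HC] := @continuous_bounded_itv (D m) A B (@derivatives_continuous D m hD).
exists (M + C) => [|a z y aAB zy y1]; first exact: addr_ge0.
have y0 : 0 <= y by lra.
rewrite /taylor big_ord_recr/= (le_trans (ler_normD _ _))// mulrDl lerD//.
  rewrite (le_trans (HM a z y aAB zy y1))// ler_wpM2l// ler_weXn2l//.
rewrite normrM ler_pM//.
  rewrite normrM normfV ler_pdivrMr ?normr_gt0 ?pnatr_eq0 -?lt0n ?fact_gt0//.
  rewrite (le_trans (HC a aAB))// ler_peMr// ger0_norm// ler1n fact_gt0//.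
rewrite normrX (@le_trans _ _ (y ^+ m))//; first by rewrite lerXn2r.
by rewrite ler_weXn2l.
Qed.

(** On ]0, pi[ the two cut-off polynomials vanish; for x <= 0 close to 0 the
    function vanishes, and the polynomials at x0 and at 0 both approximate D 0,
    with 0 between x and x0.  Likewise near pi.  Far away |x - x0| >= 1 and
    all the terms are bounded by powers of |x - x0|. *)
Lemma arc_expansion (D : nat -> R -> R) (p q : nat) : derivatives D ->
  exists2 M : R, 0 <= M & forall x0 x : R, 0 < x0 < pi ->
    `|arc (D 0%N) x - (taylor D p x0 (x - x0) - (x <= 0)%R%:R * taylor D q 0 x
        - (pi <= x)%R%:R * taylor D q pi (x - pi))|
    <= M * (`|x - x0| ^+ p + `|x - x0| ^+ q).
Proof.
move=> hD; have p0 : 0 < pi :> R := pi_gt0 R.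
have p1 : 1 <= pi :> R by have := pi_ge2 R; lra.
have [M1 M10 H1] := taylor_bound (- pi) (2 * pi) p hD.
have [M2 M20 H2] := taylor_bound (- pi) (2 * pi) q hD.
have [B1 B10 G1] := taylor_growth 0 pi p hD.
have [B2 B20 G2] := taylor_growth 0 pi q hD.
have [C C0 HC] := arc_bounded (@derivatives_continuous D 0%N hD).
exists (M1 + M2 + B1 + B2 + C); first by rewrite !addr_ge0.
move=> x0 x x0pi; have /andP[x00 x0p] := x0pi.
set P := `|x - x0| ^+ p; set Q := `|x - x0| ^+ q.
have P0 : 0 <= P by exact: exprn_ge0.
have Q0 : 0 <= Q by exact: exprn_ge0.
have [xJ|xJ] := boolP (- pi <= x <= 2 * pi); last first.
  have y1 : 1 <= `|x - x0|.
    move: xJ; rewrite negb_and -!ltNge => /orP[h|h].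
      by rewrite ler0_norm; lra.
    by rewrite ger0_norm; lra.
  have P1 : 1 <= P by exact: exprn_ege1.
  have [_ hA] := HC x.
  have t1 := G1 x0 (x - x0) _ ltac:(by rewrite !ltW) (lexx _) y1.
  have z0 : 0 <= (0 : R) <= pi by rewrite lexx ltW.
  have zp : 0 <= (pi : R) <= pi by rewrite lexx ltW.
  have hA' : `|arc (D 0%N) x| <= C * P by rewrite (le_trans hA)// ler_peMr.
  have key : `|taylor D p x0 (x - x0)| + `|(x <= 0)%R%:R * taylor D q 0 x| +
       `|(pi <= x)%R%:R * taylor D q pi (x - pi)| <= B1 * P + B2 * Q.
    rewrite -addrA; apply: lerD => //.
    have [h|h] := leP x 0; have [h'|h'] := leP pi x; rewrite ?mul1r ?mul0r ?normr0 ?add0r ?addr0.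
    - by lra.
    - by apply: G2 => //; rewrite !ler0_norm; lra.
    - by apply: G2 => //; rewrite !ger0_norm; lra.
    - exact: mulr_ge0.
  have e1 : 0 <= M1 * P by exact: mulr_ge0.
  have e2 : 0 <= M2 * P by exact: mulr_ge0.
  have e3 : 0 <= M1 * Q by exact: mulr_ge0.
  have e4 : 0 <= M2 * Q by exact: mulr_ge0.
  have e5 : 0 <= B1 * Q by exact: mulr_ge0.
  have e6 : 0 <= B2 * P by exact: mulr_ge0.
  have e7 : 0 <= C * Q by exact: mulr_ge0.
  rewrite (le_trans (ler_normB _ _))// (le_trans (lerD hA' (le_trans (ler_normB _ _) (lerD (ler_normB _ _) (lexx _)))))//.
  by lra.
have x0J : - pi <= x0 <= 2 * pi by apply/andP; split; lra.
have z0 : - pi <= (0 : R) <= 2 * pi by apply/andP; split; lra.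
have zp : - pi <= (pi : R) <= 2 * pi by apply/andP; split; lra.
have t1 := H1 x0 x x0J xJ; rewrite -/P in t1.
have e1 : 0 <= M1 * Q by exact: mulr_ge0.
have e2 : 0 <= M2 * P by exact: mulr_ge0.
have e3 : 0 <= M2 * Q by exact: mulr_ge0.
have e4 : 0 <= (B1 + B2 + C) * (P + Q) by rewrite mulr_ge0 ?addr_ge0.
apply: (@le_trans _ _ (M1 * P + M2 * Q)); last by lra.
have mQ z : `|z| <= `|x - x0| -> M2 * `|z| ^+ q <= M2 * Q.
  by move=> h; rewrite ler_wpM2l// lerXn2r// nnegrE.
have /andP[xJ1 xJ2] := xJ.
have [h|h] := leP x 0; have [h'|h'] := leP pi x; rewrite ?mul1r ?mul0r ?subr0.
- by lra.
- rewrite arc_outl ?xJ1// sub0r.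
  have := H2 0 x z0 xJ; rewrite subr0 => t2.
  rewrite opprB (_ : taylor D q 0 x - _ = (D 0%N x - taylor D p x0 (x - x0)) - (D 0%N x - taylor D q 0 x)); last by ring.
  rewrite (le_trans (ler_normB _ _))// lerD// (le_trans t2)// mQ//.
  by rewrite !ler0_norm; lra.
- rewrite arc_outr ?h'// sub0r.
  have t2 := H2 pi x zp xJ.
  rewrite opprB (_ : taylor D q pi (x - pi) - _ = (D 0%N x - taylor D p x0 (x - x0)) - (D 0%N x - taylor D q pi (x - pi))); last by ring.
  rewrite (le_trans (ler_normB _ _))// lerD// (le_trans t2)// mQ//.
  by rewrite !ger0_norm; lra.
- rewrite arc_in ?h ?h'//; lra.
Qed.

End Taylor.

(** * Boundary layer profiles *)
Section HalfLine.
Context {R : realType}.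
Local Notation mu := (@lebesgue_measure R).
Implicit Types f g h : R -> R.

(** The boundary layer profile.  Up to a constant factor it is the l-fold
    iterated integral of erfc, at y/2. *)
Definition ptail (l : nat) (y : R) : R := \int[mu]_w (gam w * ((y <= w)%R%:R * (w - y) ^+ l)).

Lemma measurable_ge (y : R) : measurable_fun setT (fun w : R => (y <= w)%R%:R : R).
Proof.
rewrite (_ : (fun w => _) = \1_(`[y, +oo[ : set R)); first exact: measurable_indic.
by apply/funext => w; rewrite indicE mem_setE in_itv/= andbT.
Qed.

Lemma truncated_pow_bound (l : nat) (y w : R) : 0 <= y ->
  `|(y <= w)%R%:R * (w - y) ^+ l| <= `|w| ^+ l.
Proof.
move=> y0; have [yw|_] := leP y w; last by rewrite mul0r normr0 exprn_ge0.
by rewrite mul1r normrX lerXn2r ?nnegrE// !ger0_norm; lra.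
Qed.

Lemma truncated_pow_measurable (l : nat) (y : R) :
  measurable_fun setT (fun w : R => (y <= w)%R%:R * (w - y) ^+ l).
Proof.
apply: measurable_funM; first exact: measurable_ge.
apply: continuous_measurable_fun => w.
apply: (@continuous_comp _ _ _ (fun w : R => w - y) (fun w => w ^+ l)); last exact: exprn_continuous.
by apply: cvgB; [exact: cvg_id|exact: cvg_cst].
Qed.

Lemma gam_dom_L1 (f : R -> R) (C : R) (l : nat) : measurable_fun setT f ->
  (forall w, `|f w| <= C * `|w| ^+ l) -> L1 (fun w => gam w * f w).
Proof.
move=> mf Hf; apply: (L1_dom _ (L1Z C (gam_pow_L1 l))).
  by apply: measurable_funM => //; apply: continuous_measurable_fun; exact: continuous_gam.
move=> w; rewrite normrM gtr0_norm ?gam_gt0// mulrA mulrC ler_wpM2r ?(ltW (gam_gt0 _))//.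
Qed.

Lemma truncated_pow_L1 (l : nat) (y : R) : 0 <= y ->
  L1 (fun w => gam w * ((y <= w)%R%:R * (w - y) ^+ l)).
Proof.
move=> y0; apply: (@gam_dom_L1 _ 1 l); first exact: truncated_pow_measurable.
by move=> w; rewrite mul1r; exact: truncated_pow_bound.
Qed.

Lemma ptail_integrand_scaled (l : nat) (x s : R) : 0 < s ->
  (fun w => gam w * ((x <= s * w)%R%:R * (s * w - x) ^+ l)) =
  (fun w => s ^+ l * (gam w * ((x / s <= w)%R%:R * (w - x / s) ^+ l))).
Proof.
move=> s0; apply/funext => w; rewrite ler_pdivrMr// (mulrC w).
by rewrite (_ : s * w - x = s * (w - x / s)) ?exprMn; [ring|field; rewrite gt_eqF].
Qed.

Lemma Rintegral_ptail (l : nat) (x s : R) : 0 < s -> 0 <= x ->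
  L1 (fun w => gam w * ((x <= s * w)%R%:R * (s * w - x) ^+ l)) /\
  \int[mu]_w (gam w * ((x <= s * w)%R%:R * (s * w - x) ^+ l)) = s ^+ l * ptail l (x / s).
Proof.
move=> s0 x0; rewrite ptail_integrand_scaled//.
have i1 : L1 (fun w => gam w * ((x / s <= w)%R%:R * (w - x / s) ^+ l)).
  by apply: truncated_pow_L1; rewrite divr_ge0// ltW.
by split; [exact: L1Z|rewrite RintegralZl].
Qed.

(** The end point on the left is reduced to the one on the right by the
    reflection w |-> -w, whence the sign in (-s)^l. *)
Lemma Rintegral_ptailN (l : nat) (x s : R) : 0 < s -> 0 <= x ->
  L1 (fun w => gam w * ((x + s * w <= 0)%R%:R * (x + s * w) ^+ l)) /\
  \int[mu]_w (gam w * ((x + s * w <= 0)%R%:R * (x + s * w) ^+ l)) = (- s) ^+ l * ptail l (x / s).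
Proof.
move=> s0 x0; have [i1 E] := Rintegral_ptail l s0 x0.
have n1 : -1 != 0 :> R by rewrite oppr_eq0 oner_neq0.
have F : (fun w => gam w * ((x + s * w <= 0)%R%:R * (x + s * w) ^+ l)) =
    (fun w => (-1) ^+ l * (gam (0 + -1 * w) * ((x <= s * (0 + -1 * w))%R%:R * (s * (0 + -1 * w) - x) ^+ l))).
  apply/funext => w; rewrite add0r mulN1r gamN mulrN.
  rewrite -(lerD2r (s * w) x) addNr -opprD (addrC (s * w)) [(- (x + s * w)) ^+ l]exprNn.
  by rewrite (_ : _ * (gam w * _) = (-1) ^+ l * (-1) ^+ l * (gam w * ((x + s * w <= 0)%R%:R * (x + s * w) ^+ l))); [rewrite -expr2 -exprM mulnC exprM sqrrN expr1n expr1n mul1r|ring].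
have i2 := L1_affine 0 n1 i1.
split; first by rewrite F; exact: L1Z.
have := Rintegral_affine 0 n1 i1; rewrite normrN1 mul1r E => E2.
by rewrite F RintegralZl// -E2 [(- s) ^+ l]exprNn mulrA.
Qed.

(** Integrate [arc_expansion] against gam, at distance s w from x0. *)
Lemma gauss_arc_expansion (D : nat -> R -> R) (p q : nat) : derivatives D ->
  exists2 M : R, 0 <= M & forall x0 s : R, 0 < x0 < pi -> 0 < s ->
    `|\int[mu]_w (gam w * arc (D 0%N) (x0 + s * w))
      - (\sum_(k < p) D k x0 / k`!%:R * (s ^+ k * moment k)
         - \sum_(l < q) D l 0 / l`!%:R * ((- s) ^+ l * ptail l (x0 / s))
         - \sum_(l < q) D l pi / l`!%:R * (s ^+ l * ptail l ((pi - x0) / s)))|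
    <= M * (s ^+ p + s ^+ q).
Proof.
move=> hD; have [M M0 HM] := arc_expansion p q hD.
pose m k := \int[mu]_w (`|w| ^+ k * gam w).
have m0 k : 0 <= m k by apply: Rintegral_ge0 => w _; rewrite mulr_ge0 ?exprn_ge0 ?(ltW (gam_gt0 _)).
exists (M * (m p + m q)); first by rewrite mulr_ge0 ?addr_ge0.
move=> x0 s x0pi s0; have /andP[x00 x0p] := x0pi.
have [C C0 HC] := arc_bounded (@derivatives_continuous R D 0%N hD).
have iarc : L1 (fun w => gam w * arc (D 0%N) (x0 + s * w)).
  apply: (@gam_dom_L1 _ C 0).
    apply: (measurableT_comp (f := arc (D 0%N))); last exact: affine_measurable.
    exact: arc_measurable (@derivatives_continuous R D 0%N hD).
  by move=> w; rewrite expr0 mulr1; have [] := HC (x0 + s * w).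
pose tA k w := D k x0 / k`!%:R * (s ^+ k * (w ^+ k * gam w)).
have iA k : L1 (tA k) by apply: L1Z; apply: L1Z; exact: gam_powX_L1.
pose tB l w := D l 0 / l`!%:R * (gam w * ((x0 + s * w <= 0)%R%:R * (x0 + s * w) ^+ l)).
have iB l : L1 (tB l) by apply: L1Z; have [] := Rintegral_ptailN l s0 (ltW x00).
pose tC l w := D l pi / l`!%:R * (gam w * ((pi - x0 <= s * w)%R%:R * (s * w - (pi - x0)) ^+ l)).
have px0 : 0 <= pi - x0 by lra.
have iC l : L1 (tC l) by apply: L1Z; have [] := Rintegral_ptail l s0 px0.
have eA : \sum_(k < p) D k x0 / k`!%:R * (s ^+ k * moment k) = \int[mu]_w (\sum_(k < p) tA k w).
  rewrite Rintegral_sum; last by move=> i _; exact: iA.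
  apply: eq_bigr => k _; rewrite /tA RintegralZl//; last by apply: L1Z; exact: gam_powX_L1.
  by rewrite RintegralZl//; exact: gam_powX_L1.
have eB : \sum_(l < q) D l 0 / l`!%:R * ((- s) ^+ l * ptail l (x0 / s)) = \int[mu]_w (\sum_(l < q) tB l w).
  rewrite Rintegral_sum; last by move=> i _; exact: iB.
  apply: eq_bigr => l _; have [i1 <-] := Rintegral_ptailN l s0 (ltW x00).
  by rewrite -RintegralZl.
have eC : \sum_(l < q) D l pi / l`!%:R * (s ^+ l * ptail l ((pi - x0) / s)) = \int[mu]_w (\sum_(l < q) tC l w).
  rewrite Rintegral_sum; last by move=> i _; exact: iC.
  apply: eq_bigr => l _; have [i1 <-] := Rintegral_ptail l s0 px0.
  by rewrite -RintegralZl.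
have sA : L1 (fun w => \sum_(k < p) tA k w) by apply: L1_sum => i _; exact: iA.
have sB : L1 (fun w => \sum_(l < q) tB l w) by apply: L1_sum => i _; exact: iB.
have sC : L1 (fun w => \sum_(l < q) tC l w) by apply: L1_sum => i _; exact: iC.
rewrite eA eB eC -RintegralB// -(RintegralB _ (L1B sA sB) sC)// -(RintegralB _ iarc (L1B (L1B sA sB) sC))//.
pose G w := M * s ^+ p * (`|w| ^+ p * gam w) + M * s ^+ q * (`|w| ^+ q * gam w).
have iG : L1 G by apply: L1D; apply: L1Z; exact: gam_pow_L1.
apply: (@le_trans _ _ (\int[mu]_w G w)).
  apply: Rintegral_le_dom => //; first by apply: L1B => //; exact: L1B (L1B sA sB) sC.
  move=> w; have := HM x0 (x0 + s * w) x0pi.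
  rewrite (addrC x0) addrK (addrC _ x0) => H.
  rewrite (_ : _ - _ = gam w * (arc (D 0%N) (x0 + s * w) - (taylor D p x0 (s * w) - (x0 + s * w <= 0)%R%:R * taylor D q 0 (x0 + s * w) - (pi <= x0 + s * w)%R%:R * taylor D q pi (x0 + s * w - pi)))).
    rewrite normrM gtr0_norm ?gam_gt0//.
    apply: (le_trans (ler_wpM2l (ltW (gam_gt0 w)) H)).
    rewrite /G !normrM !exprMn (gtr0_norm s0) le_eqVlt; apply/orP; left; apply/eqP; ring.
  rewrite !mulrBr; congr (_ - (_ - _ - _)).
  - rewrite /taylor mulr_sumr; apply: eq_bigr => k _; rewrite /tA exprMn; ring.
  - rewrite /taylor mulr_sumr mulr_sumr; apply: eq_bigr => k _; rewrite /tB; ring.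
  - rewrite /taylor mulr_sumr mulr_sumr; apply: eq_bigr => k _; rewrite /tC.
    rewrite lerBlDl (_ : s * w - (pi - x0) = x0 + s * w - pi); ring.
rewrite /G RintegralD//; try (by apply: L1Z; exact: gam_pow_L1).
rewrite !RintegralZl//; try exact: gam_pow_L1.
rewrite -/(m p) -/(m q) -!mulrA -mulrDr ler_wpM2l//.
have : 0 <= s ^+ p * m q by rewrite mulr_ge0// exprn_ge0// ltW.
have : 0 <= s ^+ q * m p by rewrite mulr_ge0// exprn_ge0// ltW.
by lra.
Qed.

End HalfLine.

(** * Complex-valued integrals *)
Section ComplexIntegral.
Context {R : realType}.
Local Notation mu := (@lebesgue_measure R).
Local Notation C := R[i].
Local Notation Re := complex.Re.
Local Notation Im := complex.Im.

(** The modulus as a real number: the norm of R[i] takes its values in R[i]. *)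
Definition cabs (z : C) : R := Num.sqrt (Re z ^+ 2 + Im z ^+ 2).

Lemma normcabs (z : C) : `|z| = (cabs z)%:C%C.
Proof. exact: normc_def. Qed.

Lemma cabs_ge0 z : 0 <= cabs z. Proof. exact: sqrtr_ge0. Qed.

Lemma cabsM z w : cabs (z * w) = cabs z * cabs w.
Proof. by apply: complexI; rewrite rmorphM/= -!normcabs normrM. Qed.

Lemma cabsD z w : cabs (z + w) <= cabs z + cabs w.
Proof. by rewrite -lecR rmorphD/= -!normcabs ler_normD. Qed.

Lemma cabsN z : cabs (- z) = cabs z.
Proof. by apply: complexI; rewrite -!normcabs normrN. Qed.

Lemma cabsB z w : cabs (z - w) <= cabs z + cabs w.
Proof. by rewrite (le_trans (cabsD _ _))// cabsN. Qed.

Lemma cabs0 : cabs 0 = 0.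
Proof. by apply: complexI; rewrite -normcabs normr0. Qed.

Lemma cabs_real (x : R) : cabs x%:C%C = `|x|.
Proof. by rewrite /cabs/= expr0n addr0 sqrtr_sqr. Qed.

Lemma cabsX z n : cabs (z ^+ n) = cabs z ^+ n.
Proof. by apply: complexI; rewrite rmorphXn/= -!normcabs normrX. Qed.

Lemma cabs_sum (I : Type) (r : seq I) (P : pred I) (F : I -> C) :
  cabs (\sum_(i <- r | P i) F i) <= \sum_(i <- r | P i) cabs (F i).
Proof.
rewrite -lecR rmorph_sum/= -normcabs (le_trans (ler_norm_sum _ _ _))//.
by apply: ler_sum => i _; rewrite normcabs.
Qed.

Lemma Re_le_cabs z : `|Re z| <= cabs z.
Proof. by rewrite -lecR -normcabs normc_ge_Re. Qed.

Lemma Im_le_cabs z : `|Im z| <= cabs z.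
Proof.
rewrite /cabs -(sqrtr_sqr (Im z)) ler_wsqrtr// lerDr sqr_ge0//.
Qed.

Lemma cabs_le z : cabs z <= `|Re z| + `|Im z|.
Proof.
rewrite /cabs -(ger0_norm (addr_ge0 (normr_ge0 (Re z)) (normr_ge0 (Im z)))) -sqrtr_sqr ler_wsqrtr//.
rewrite sqrrD !real_normK ?num_real// lerD2r lerDl mulrn_wge0// mulr_ge0//.
Qed.

Lemma cReD (z w : C) : Re (z + w) = Re z + Re w. Proof. by case: z w => ? ? []. Qed.
Lemma cImD (z w : C) : Im (z + w) = Im z + Im w. Proof. by case: z w => ? ? []. Qed.
Lemma cReM (z w : C) : Re (z * w) = Re z * Re w - Im z * Im w. Proof. by case: z w => ? ? []. Qed.
Lemma cImM (z w : C) : Im (z * w) = Re z * Im w + Im z * Re w. Proof. by case: z w => ? ? []. Qed.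

Definition cmeas d (T : measurableType d) (f : T -> C) : Prop :=
  measurable_fun setT (fun x => Re (f x)) /\ measurable_fun setT (fun x => Im (f x)).

Lemma cmeasM d (T : measurableType d) (f g : T -> C) : cmeas f -> cmeas g -> cmeas (fun x => f x * g x).
Proof.
move=> [f1 f2] [g1 g2]; split.
  rewrite (_ : (fun x => _) = (fun x => Re (f x) * Re (g x) - Im (f x) * Im (g x))); last by apply/funext => x; rewrite cReM.
  by apply: measurable_funB; exact: measurable_funM.
rewrite (_ : (fun x => _) = (fun x => Re (f x) * Im (g x) + Im (f x) * Re (g x))); last by apply/funext => x; rewrite cImM.
by apply: measurable_funD; exact: measurable_funM.
Qed.

Lemma cmeas_real d (T : measurableType d) (f : T -> R) : measurable_fun setT f -> cmeas (fun x => (f x)%:C%C).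
Proof. by move=> mf; split => //=; exact: measurable_cst. Qed.

Lemma cmeas_comp d d' (T : measurableType d) (T' : measurableType d') (f : T -> C) (h : T' -> T) :
  measurable_fun setT h -> cmeas f -> cmeas (fun x => f (h x)).
Proof. by move=> mh [f1 f2]; split; [exact: (measurableT_comp f1 mh)|exact: (measurableT_comp f2 mh)]. Qed.

Definition CL1 (f : R -> C) : Prop := L1 (fun x => Re (f x)) /\ L1 (fun x => Im (f x)).

Lemma CL1_meas f : CL1 f -> cmeas f.
Proof. by move=> [i1 i2]; split; exact: L1_measurable. Qed.

Lemma CL1_dom (f : R -> C) (h : R -> R) : cmeas f -> L1 h -> (forall x, cabs (f x) <= h x) -> CL1 f.
Proof.
move=> [f1 f2] ih H; split; apply: (L1_dom _ ih) => // x.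
  exact: le_trans (Re_le_cabs _) (H x).
exact: le_trans (Im_le_cabs _) (H x).
Qed.

Lemma CL1D (f g : R -> C) : CL1 f -> CL1 g -> CL1 (fun x => f x + g x).
Proof.
move=> [f1 f2] [g1 g2]; split.
  by rewrite (_ : (fun x => _) = (fun x => Re (f x) + Re (g x))); [exact: L1D|apply/funext => x; rewrite cReD].
by rewrite (_ : (fun x => _) = (fun x => Im (f x) + Im (g x))); [exact: L1D|apply/funext => x; rewrite cImD].
Qed.

Lemma CL1Z (c : C) (f : R -> C) : CL1 f -> CL1 (fun x => c * f x).
Proof.
move=> [f1 f2]; split.
  rewrite (_ : (fun x => _) = (fun x => Re c * Re (f x) - Im c * Im (f x))); last by apply/funext => x; rewrite cReM.
  by apply: L1B; exact: L1Z.
rewrite (_ : (fun x => _) = (fun x => Re c * Im (f x) + Im c * Re (f x))); last by apply/funext => x; rewrite cImM.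
by apply: L1D; exact: L1Z.
Qed.

Lemma CL1N (f : R -> C) : CL1 f -> CL1 (fun x => - f x).
Proof. by move=> /(CL1Z (-1)); congr CL1; apply/funext => x; rewrite mulN1r. Qed.

Lemma CL1B (f g : R -> C) : CL1 f -> CL1 g -> CL1 (fun x => f x - g x).
Proof. by move=> ? ?; apply: CL1D => //; exact: CL1N. Qed.

Lemma CL1_0 : CL1 (fun=> 0).
Proof. by split; exact: L1_0. Qed.

Lemma CL1_sum n (F : nat -> R -> C) : (forall i, (i < n)%N -> CL1 (F i)) ->
  CL1 (fun x => \sum_(i < n) F i x).
Proof.
elim: n => [|n IH] H.
  by rewrite (_ : (fun x => _) = (fun=> 0)); [exact: CL1_0|apply/funext => x; rewrite big_ord0].
rewrite (_ : (fun x => _) = (fun x => \sum_(i < n) F i x + F n x)); last by apply/funext => x; rewrite big_ord_recr.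
by apply: CL1D; [apply: IH => i ni; apply: H; exact: leqW|exact: H].
Qed.

Lemma CL1_cabs (f : R -> C) : CL1 f -> L1 (fun x => cabs (f x)).
Proof.
move=> [f1 f2]; apply: (L1_dom _ (L1D (L1_norm f1) (L1_norm f2))).
  apply: (measurableT_comp (f := @Num.sqrt R)); first by apply: continuous_measurable_fun; exact: sqrt_continuous.
  by apply: measurable_funD; (apply: measurable_funX; exact: L1_measurable).
by move=> x; rewrite ger0_norm ?cabs_ge0// cabs_le.
Qed.

Lemma Cint_eqT (f g : R -> C) : f =1 g -> Cint setT f = Cint setT g.
Proof. by move=> /funext ->. Qed.

Lemma CintD (f g : R -> C) : CL1 f -> CL1 g ->
  Cint setT (fun x => f x + g x) = Cint setT f + Cint setT g.
Proof.
move=> [f1 f2] [g1 g2]; rewrite /Cint.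
rewrite (_ : (fun x => Re _) = (fun x => Re (f x) + Re (g x))); last by apply/funext => x; rewrite cReD.
rewrite (_ : (fun x => Im (_ + _)) = (fun x => Im (f x) + Im (g x))); last by apply/funext => x; rewrite cImD.
by rewrite !RintegralD.
Qed.

Lemma CintZ (c : C) (f : R -> C) : CL1 f ->
  Cint setT (fun x => c * f x) = c * Cint setT f.
Proof.
move=> [f1 f2]; rewrite /Cint.
rewrite (_ : (fun x => Re _) = (fun x => Re c * Re (f x) - Im c * Im (f x))); last by apply/funext => x; rewrite cReM.
rewrite (_ : (fun x => Im (_ * _)) = (fun x => Re c * Im (f x) + Im c * Re (f x))); last by apply/funext => x; rewrite cImM.
rewrite RintegralB//; try exact: L1Z.
rewrite RintegralD//; try exact: L1Z.
by rewrite !RintegralZl//; case: c.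
Qed.

Lemma CintB (f g : R -> C) : CL1 f -> CL1 g ->
  Cint setT (fun x => f x - g x) = Cint setT f - Cint setT g.
Proof.
move=> i1 i2; rewrite CintD//; last exact: CL1N.
rewrite -[- Cint _ g]mulN1r -CintZ//; congr (_ + _).
by apply: Cint_eqT => x; rewrite mulN1r.
Qed.

Lemma Cint_sum n (F : nat -> R -> C) : (forall i, (i < n)%N -> CL1 (F i)) ->
  Cint setT (fun x => \sum_(i < n) F i x) = \sum_(i < n) Cint setT (F i).
Proof.
elim: n => [|n IH] H.
  rewrite big_ord0 (_ : (fun x => _) = (fun=> 0)); last by apply/funext => x; rewrite big_ord0.
  by rewrite /Cint !Rintegral_cst// !mul0r.
rewrite big_ord_recr/= -IH; last by move=> i ni; apply: H; exact: leqW.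
rewrite (_ : (fun x => _) = (fun x => \sum_(i < n) F i x + F n x)); last by apply/funext => x; rewrite big_ord_recr.
rewrite CintD//; last exact: H.
by apply: CL1_sum => i ni; apply: H; exact: leqW.
Qed.

Lemma cabs_Cint (f : R -> C) (h : R -> R) : cmeas f -> L1 h ->
  (forall x, cabs (f x) <= h x) -> cabs (Cint setT f) <= 2 * \int[mu]_x h x.
Proof.
move=> mf ih H; have [i1 i2] := CL1_dom mf ih H.
rewrite (le_trans (cabs_le _))//= mulr_natl mulr2n.
by apply: lerD; apply: Rintegral_le_dom => // x;
  [apply: le_trans (Re_le_cabs _) _|apply: le_trans (Im_le_cabs _) _].
Qed.

Lemma Cint_affine (a b : R) (f : R -> C) : b != 0 -> CL1 f ->
  CL1 (fun x => f (a + b * x)) /\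
  Cint setT f = `|b|%:C%C * Cint setT (fun x => f (a + b * x)).
Proof.
move=> b0 [i1 i2]; split; first by split; [exact: (L1_affine a b0 i1)|exact: (L1_affine a b0 i2)].
rewrite /Cint (Rintegral_affine a b0 i1) (Rintegral_affine a b0 i2).
by apply/eqP; rewrite eq_complex/= !mul0r subr0 addr0 !eqxx.
Qed.

Lemma Cfubini (F : R -> R -> C) (a b : R -> R) :
  cmeas (fun p : R * R => F p.1 p.2) ->
  L1 a -> L1 b -> (forall x y, cabs (F x y) <= a x * b y) ->
  [/\ forall x, CL1 (F x), forall y, CL1 (F^~ y),
      CL1 (fun x => Cint setT (F x)), CL1 (fun y => Cint setT (F^~ y)) &
      Cint setT (fun x => Cint setT (F x)) = Cint setT (fun y => Cint setT (F^~ y))].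
Proof.
move=> [m1 m2] ia ib H.
have H1 x y : `|Re (F x y)| <= a x * b y := le_trans (Re_le_cabs _) (H x y).
have H2 x y : `|Im (F x y)| <= a x * b y := le_trans (Im_le_cabs _) (H x y).
have H1' y x : `|Re (F x y)| <= b y * a x by rewrite mulrC.
have H2' y x : `|Im (F x y)| <= b y * a x by rewrite mulrC.
have m1' : measurable_fun setT (fun p : R * R => Re (F p.2 p.1)).
  exact: (measurableT_comp m1 (@measurable_swap _ _ _ _)).
have m2' : measurable_fun setT (fun p : R * R => Im (F p.2 p.1)).
  exact: (measurableT_comp m2 (@measurable_swap _ _ _ _)).
have [a1 a2 a3 a4] := Rfubini (F := fun x y => Re (F x y)) m1 ia ib H1.
have [b1 b2 b3 b4] := Rfubini (F := fun x y => Im (F x y)) m2 ia ib H2.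
have [_ _ c3 _] := Rfubini (F := fun y x => Re (F x y)) m1' ib ia H1'.
have [_ _ d3 _] := Rfubini (F := fun y x => Im (F x y)) m2' ib ia H2'.
split.
- by move=> x; split; [exact: a1|exact: b1].
- by move=> y; split; [exact: a2|exact: b2].
- by split.
- by split.
- by rewrite /Cint/= a4 b4.
Qed.

Lemma Cint_indic (A : set R) (f : R -> C) :
  Cint A f = Cint setT (fun x => (\1_A x)%:C%C * f x).
Proof.
rewrite /Cint !(Rintegral_indic _ A); congr (_ +i* _)%C; apply: eq_Rintegral => x _.
  by rewrite cReM/= mul0r subr0.
by rewrite cImM/= mul0r addr0.
Qed.

End ComplexIntegral.

(** * Complex powers *)
Section Powers.
Context {R : realType}.
Local Notation mu := (@lebesgue_measure R).
Local Notation C := R[i].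
Local Notation Re := complex.Re.
Local Notation Im := complex.Im.

(** Monotone convergence on [1/(n+2), 1], where the primitive
    u^(a+1)/(a+1) bounds the integral by 1/(a+1). *)
Lemma powR_unit_L1 (a : R) : -1 < a ->
  L1 (fun u => \1_(`]0, 1]%classic : set R) u * u `^ a).
Proof.
move=> a1; have b0 : 0 < a + 1 by lra.
have mp : measurable_fun setT (fun u : R => u `^ a) by exact: measurable_powR.
apply/integrableP; split.
  by apply/measurable_EFinP; apply: measurable_funM.
pose F (n : nat) : set R := `[n.+2%:R^-1, 1]%classic.
have Fn n x : F n x -> 0 < x.
  by rewrite /F/= in_itv/= => /andP[h _]; apply: lt_le_trans h; rewrite invr_gt0.
have UF : \bigcup_n F n = `]0, 1]%classic.
  apply/seteqP; split => [x [n _] Fx|x /=]; first by have x0 := Fn _ _ Fx; move: Fx; rewrite /F/= !in_itv/= x0 => /andP[].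
  rewrite in_itv/= => /andP[x0 x1].
  have [k _ /(_ k (leqnn k)) /= Hk] := near_infty_natSinv_lt (PosNum x0).
  exists k => //; rewrite /F/= in_itv/= x1 andbT (le_trans _ (ltW Hk))//.
  by rewrite lef_pV2 ?posrE// ler_nat.
pose h01 (u : R) := \1_(`]0, 1]%classic : set R) u * u `^ a.
have E : (\int[mu]_x `|(EFin \o h01) x| = \int[mu]_(x in `]0%R, 1%R]) (x `^ a)%R%:E)%E.
  rewrite [RHS]integral_mkcond; apply: eq_integral => x _ /=.
  by rewrite /h01 patchE indicE; case: ifP => _; rewrite ?mul0r ?normr0// mul1r ger0_norm// powR_ge0.
rewrite -/h01 E -UF.
have nd : nondecreasing_seq F.
  move=> n m nm; apply/subsetPset => x; rewrite /F/= !in_itv/= => /andP[h ->]; rewrite andbT.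
  by apply: le_trans h; rewrite lef_pV2 ?posrE// ler_nat.
have cv : (\int[mu]_(x in F i) (x `^ a)%R%:E @[i --> \oo] --> \int[mu]_(x in \bigcup_i F i) (x `^ a)%R%:E)%E.
  apply: ge0_nondecreasing_set_cvg_integral => //.
  - by move=> i; exact: measurable_itv.
  - by move=> i; apply: measurable_funTS; exact/measurable_EFinP.
  - by move=> i x _; rewrite lee_fin powR_ge0.
have le n : (\int[mu]_(x in F n) (x `^ a)%R%:E <= ((a + 1)^-1)%R%:E)%E.
  pose G (x : R) := (a + 1)^-1 * x `^ (a + 1).
  have dG (x : R) : 0 < x -> is_derive x 1 G (x `^ a).
    move=> x0; have h := is_derive1_powR (a + 1) x0.
    apply: (is_derive_eq (@is_deriveZ _ _ _ _ (a + 1)^-1 x 1 _ h)).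
    by rewrite /GRing.scale/= addrK mulrA mulVf ?mul1r// gt_eqF.
  have cG (x : R) : 0 < x -> {for x, continuous G}.
    by move=> x0; apply/differentiable_continuous/derivable1_diffP; have [] := dG x x0.
  have e0 : 0 < n.+2%:R^-1 :> R by rewrite invr_gt0.
  have e1 : n.+2%:R^-1 < 1 :> R by rewrite invf_lt1// ltr1n.
  rewrite (@continuous_FTC2 _ (fun x => x `^ a) G)//.
  - rewrite -EFinB lee_fin /G powR1 mulr1 lerBlDr lerDl mulr_ge0 ?powR_ge0// invr_ge0 ltW//.
  - apply: continuous_in_subspaceT => x /set_mem/=; rewrite in_itv/= => /andP[h _].
    have x0 : 0 < x by exact: lt_le_trans h.
    by apply/differentiable_continuous/derivable1_diffP; have [] := is_derive1_powR a x0.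
  - split.
    + move=> x; rewrite in_itv/= => /andP[h _].
      by have [] := dG x (lt_trans e0 h).
    + by apply: cvg_at_right_filter; exact: cG.
    + by apply: cvg_at_left_filter; exact: cG.
  - move=> x; rewrite in_itv/= => /andP[h _]; rewrite derive1E.
    by have h2 := dG x (lt_trans e0 h); rewrite derive_val.
rewrite -(cvg_lim _ cv)//; apply: (@le_lt_trans _ _ ((a + 1)^-1)%:E); last by rewrite ltry.
by apply: lime_le; [apply/cvg_ex; eexists; exact: cv|apply: nearW].
Qed.

Lemma powR_gauss_L1 (a : R) : -1 < a ->
  L1 (fun u => \1_(`]0, +oo[%classic : set R) u * (u `^ a * expR (- (4^-1 * u ^+ 2)))).
Proof.
move=> a1; have [k ka] : exists k : nat, a <= k%:R.
  by exists (Num.bound `|a|); apply: ltW; apply: (le_lt_trans (ler_norm a)); exact: archi_boundP.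
have i1 := powR_unit_L1 a1.
have i2 := @gauss_pow_L1 R k 4^-1 ltac:(by []).
apply: (L1_dom _ (L1D i1 i2)).
  apply: measurable_funM => //; apply: measurable_funM; first exact: measurable_powR.
  by apply: continuous_measurable_fun; exact: continuous_gauss.
move=> u; have E0 : 0 < expR (- (4^-1 * u ^+ 2)) by exact: expR_gt0.
have p0 := powR_ge0 u a.
have q0 : 0 <= `|u| ^+ k * expR (- (4^-1 * u ^+ 2)) by rewrite mulr_ge0 ?exprn_ge0// ltW.
rewrite ger0_norm; last by rewrite mulr_ge0// mulr_ge0// ltW.
rewrite !indicE !mem_setE !in_itv/= andbT.
have [u0|u0] := ltP 0 u; last by rewrite mul0r addr_ge0// mulr_ge0.
have [u1|u1] := leP u 1; rewrite /= ?mul1r ?mul0r ?add0r.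
  by rewrite (@le_trans _ _ (u `^ a))// ?lerDl// ler_piMr// -expR0 ler_expR oppr_le0 mulr_ge0// sqr_ge0.
by rewrite ler_wpM2r ?(ltW E0)// gtr0_norm// -powR_mulrn ?(ltW u0)// ler_powR// ltW.
Qed.

Lemma cpowD (x : R) (z w : C) : cpow x (z + w) = cpow x z * cpow x w.
Proof.
rewrite /cpow cReD cImD !mulrDl expRD cosD sinD.
case: z w => [z1 z2] [w1 w2] /=.
by apply/eqP; rewrite eq_complex/=; apply/andP; split; apply/eqP; ring.
Qed.

Lemma cpowM (x y : R) (z : C) : 0 < x -> 0 < y -> cpow (x * y) z = cpow x z * cpow y z.
Proof.
move=> x0 y0; rewrite /cpow lnM ?posrE// !mulrDr expRD cosD sinD.
by apply/eqP; rewrite eq_complex/=; apply/andP; split; apply/eqP; ring.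
Qed.

Lemma cpow_nat (x : R) (n : nat) : 0 < x -> cpow x n%:R = (x ^+ n)%:C%C.
Proof.
move=> x0; have -> : (n%:R : C) = (n%:R : R)%:C%C by rewrite rmorph_nat.
by rewrite /cpow/= !mul0r cos0 sin0 expRM_natl lnK ?posrE// complexr0 mulr1.
Qed.

Lemma cabs_cpow (x : R) (z : C) : 0 < x -> cabs (cpow x z) = x `^ (Re z).
Proof.
move=> x0; rewrite /cpow cabsM cabs_real gtr0_norm ?expR_gt0// /powR gt_eqF//.
by rewrite /cabs/= cos2Dsin2 sqrtr1 mulr1.
Qed.

Lemma cpow_half (t : R) (z : C) : 0 < t -> cpow t (z / 2) = cpow (Num.sqrt t) z.
Proof.
move=> t0.
have lns : ln (Num.sqrt t) = 2^-1 * ln t by rewrite -powR12_sqrt ?ltW// ln_powR.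
have -> : z / 2 = (Re z / 2 +i* (Im z / 2))%C.
  by case: z => z1 z2; rewrite -[2](rmorph_nat (real_complex R) 2) -fmorphV/=; simpc.
by rewrite /cpow/= lns !mulrA.
Qed.

Lemma cmeas_cpow (z : C) : cmeas (fun x : R => cpow x z).
Proof.
have ml (c : R) : measurable_fun setT (fun x : R => c * ln x).
  by apply: measurable_funM => //; exact: measurable_ln.
apply: cmeasM; first by apply: cmeas_real; apply: measurableT_comp => //.
split => /=.
  apply: (measurableT_comp (f := @cos R)); last exact: ml.
  by apply: continuous_measurable_fun; exact: continuous_cos.
apply: (measurableT_comp (f := @sin R)); last exact: ml.
by apply: continuous_measurable_fun; exact: continuous_sin.
Qed.

End Powers.

(** * The boundary coefficients as Mellin transforms *)
Section Coefficients.
Context {R : realType}.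
Local Notation mu := (@lebesgue_measure R).
Local Notation C := R[i].
Local Notation Re := complex.Re.
Local Notation Im := complex.Im.
Local Notation P := (`]0, +oo[%classic : set R).

Lemma ptail_ge0 (l : nat) (y : R) : 0 <= ptail l y.
Proof.
apply: Rintegral_ge0 => w _; rewrite mulr_ge0 ?(ltW (gam_gt0 _))//.
by have [yw|_] := leP y w; rewrite ?mul0r// mul1r exprn_ge0// subr_ge0.
Qed.

Lemma Cint0 : Cint setT (fun=> 0) = 0 :> C.
Proof. by rewrite /Cint !Rintegral_cst// !mul0r. Qed.

Lemma indic_posE (u : R) : \1_P u = (0 < u)%R%:R :> R.
Proof. by rewrite indicE mem_setE in_itv/= andbT. Qed.

(** Since u v >= 0.  This dominates the double integral of the coefficients by
    a product. *)
Lemma gamD_le (u v : R) : 0 <= u -> 0 <= v -> gam (u + v) <= expR (- (4^-1 * u ^+ 2)) * gam v.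
Proof.
move=> u0 v0; rewrite !gamE [leRHS]mulrCA -expRD ler_wpM2l ?invr_ge0 ?(ltW sqrt4pi_gt0)// ler_expR.
have : 0 <= u * v by exact: mulr_ge0.
by rewrite sqrrD; lra.
Qed.

Lemma ptailE (l : nat) (u : R) : 0 <= u ->
  ptail l u = \int[mu]_v (\1_P v * (v ^+ l * gam (u + v))).
Proof.
move=> u0; rewrite /ptail (@Rintegral_affine R u 1 _ (oner_neq0 _) (truncated_pow_L1 l u0)) normr1 mul1r.
have i1 := @L1_affine R u 1 _ (oner_neq0 _) (truncated_pow_L1 l u0).
have E : (fun x => gam (u + 1 * x) * ((u <= u + 1 * x)%R%:R * (u + 1 * x - u) ^+ l)) =
    (fun x => \1_(`[0, +oo[%classic : set R) x * (x ^+ l * gam (u + x))).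
  apply/funext => x; rewrite mul1r indicE mem_setE in_itv/= andbT lerDl.
  by rewrite (_ : u + x - u = x); ring.
rewrite E in i1 *.
have i2 : L1 (fun x => \1_P x * (x ^+ l * gam (u + x))).
  apply: (L1_dom _ (L1_norm i1)).
    apply: measurable_funM => //; apply: continuous_measurable_fun => x.
    apply: cvgM; first exact: exprn_continuous.
    apply: (@continuous_comp _ _ _ (fun x : R => u + x) gam); last exact: continuous_gam.
    by apply: cvgD; [exact: cvg_cst|exact: cvg_id].
  move=> x; rewrite !indicE !mem_setE !in_itv/= !andbT.
  by case: ltgtP => _; rewrite ?mul1r ?mul0r ?normr0.
rewrite -!Rintegral_indic -Rintegral_itv_obnd_cbnd//.
move: (i2); rewrite /L1 (_ : EFin \o _ = (EFin \o (fun x => x ^+ l * gam (u + x))) \_ P); last first.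
  apply/funext => x /=; rewrite patchE indicE; case: ifP => _; by rewrite ?mul1r ?mul0r.
by move=> i3; apply/integrable_mkcond => //; exact: measurable_itv.
Qed.

Lemma ptail_gauss (l : nat) : exists2 c : R, 0 <= c &
  forall u, 0 <= u -> ptail l u <= c * expR (- (4^-1 * u ^+ 2)).
Proof.
exists (\int[mu]_v (`|v| ^+ l * gam v)).
  by apply: Rintegral_ge0 => v _; rewrite mulr_ge0 ?exprn_ge0 ?(ltW (gam_gt0 _)).
move=> u u0; rewrite ptailE// mulrC -RintegralZl//; last exact: gam_pow_L1.
have Fb x : `|\1_P x * (x ^+ l * gam (u + x))| <= expR (- (4^-1 * u ^+ 2)) * (`|x| ^+ l * gam x).
  rewrite indic_posE; have [x0|x0] := ltP 0 x; last by rewrite mul0r normr0 !mulr_ge0 ?expR_ge0 ?exprn_ge0 ?(ltW (gam_gt0 _)).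
  rewrite mul1r normrM normrX (gtr0_norm (gam_gt0 _)) [leRHS]mulrCA ler_wpM2l ?exprn_ge0//.
  by apply: gamD_le => //; exact: ltW.
have iG := L1Z (expR (- (4^-1 * u ^+ 2))) (gam_pow_L1 l).
apply: (le_trans (ler_norm _)); apply: Rintegral_le_dom => //.
apply: (L1_dom _ iG Fb).
apply: measurable_funM => //; apply: continuous_measurable_fun => x.
apply: cvgM; first exact: exprn_continuous.
apply: (@continuous_comp _ _ _ (fun x : R => u + x) gam); last exact: continuous_gam.
by apply: cvgD; [exact: cvg_cst|exact: cvg_id].
Qed.

(** The Mellin transform of [ptail l], at z + 1. *)
Definition mellin (z : C) (l : nat) : C :=
  Cint setT (fun u => (\1_P u)%:C%C * (cpow u z * (ptail l u)%:C%C)).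

Let F (z : C) (l : nat) (u v : R) : C :=
  (\1_P u)%:C%C * (cpow u z * (\1_P v * (v ^+ l * gam (u + v)))%:C%C).

Let F_fubini (z : C) (l : nat) : -1 < Re z ->
  [/\ forall x, CL1 (F z l x), forall y, CL1 ((F z l)^~ y),
      CL1 (fun x => Cint setT (F z l x)), CL1 (fun y => Cint setT ((F z l)^~ y)) &
      Cint setT (fun x => Cint setT (F z l x)) = Cint setT (fun y => Cint setT ((F z l)^~ y))].
Proof.
move=> z1; apply: (Cfubini (a := fun u => \1_P u * (u `^ Re z * expR (- (4^-1 * u ^+ 2))))
   (b := fun v => `|v| ^+ l * gam v)).
- have mP : measurable_fun setT (\1_P : R -> R) by [].
  apply: cmeasM.
    by apply: cmeas_real; exact: (measurableT_comp mP).
  apply: cmeasM; first by apply: (@cmeas_comp _ _ _ _ _ (fun u => cpow u z)) => //; exact: cmeas_cpow.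
  apply: cmeas_real; apply: measurable_funM; first exact: (measurableT_comp mP).
  apply: measurable_funM; first by apply: measurable_funX.
  apply: (measurableT_comp (f := gam)); first by apply: continuous_measurable_fun; exact: continuous_gam.
  exact: measurable_funD.
- exact: powR_gauss_L1.
- exact: gam_pow_L1.
- move=> u v; rewrite /F !indic_posE.
  have rhs0 : 0 <= u `^ Re z * expR (- (4^-1 * u ^+ 2)) * (`|v| ^+ l * gam v).
    by rewrite !mulr_ge0 ?powR_ge0 ?expR_ge0 ?exprn_ge0 ?(ltW (gam_gt0 _)).
  have [u0|u0] := ltP 0 u; last by rewrite !mul0r cabs0.
  rewrite !mul1r cabsM cabs_cpow// cabs_real.
  have [v0|v0] := ltP 0 v; last by rewrite mul0r normr0 mulr0.
  rewrite mul1r -mulrA ler_wpM2l ?powR_ge0// normrM normrX (gtr0_norm (gam_gt0 _)).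
  rewrite [leRHS]mulrCA ler_wpM2l ?exprn_ge0//.
  by apply: gamD_le; exact: ltW.
Qed.

Let F_inner (z : C) (l : nat) : -1 < Re z -> (fun u => Cint setT (F z l u)) =
  (fun u => (\1_P u)%:C%C * (cpow u z * (ptail l u)%:C%C)).
Proof.
move=> z1; have [i1 _ _ _ _] := F_fubini l z1.
apply/funext => u; rewrite /F indic_posE; have [u0|u0] := ltP 0 u; last first.
  by rewrite mul0r (_ : (fun v => _) = (fun=> 0)); [exact: Cint0|apply/funext => v; rewrite mul0r].
have := i1 u; rewrite /F indic_posE u0.
have gI : CL1 (fun v => (\1_P v * (v ^+ l * gam (u + v)))%:C%C).
  apply: (CL1_dom (h := fun v => expR (- (4^-1 * u ^+ 2)) * (`|v| ^+ l * gam v))).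
  - apply: cmeas_real; apply: measurable_funM => //; apply: continuous_measurable_fun => x.
    apply: cvgM; first exact: exprn_continuous.
    apply: (@continuous_comp _ _ _ (fun x : R => u + x) gam); last exact: continuous_gam.
    by apply: cvgD; [exact: cvg_cst|exact: cvg_id].
  - by apply: L1Z; exact: gam_pow_L1.
  - move=> x; rewrite cabs_real indic_posE; have [x0|x0] := ltP 0 x; last by rewrite mul0r normr0 !mulr_ge0 ?expR_ge0 ?exprn_ge0 ?(ltW (gam_gt0 _)).
    rewrite mul1r normrM normrX (gtr0_norm (gam_gt0 _)) [leRHS]mulrCA ler_wpM2l ?exprn_ge0//.
    by apply: gamD_le => //; exact: ltW.
move=> _; rewrite CintZ; last exact: CL1Z.
rewrite CintZ//; congr (_ * (_ * _)).
rewrite {1}/Cint /= ptailE ?(ltW u0)//.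
by rewrite Rintegral_cst// mul0r.
Qed.

Lemma mellin_CL1 (z : C) (l : nat) : -1 < Re z ->
  CL1 (fun u => (\1_P u)%:C%C * (cpow u z * (ptail l u)%:C%C)).
Proof. by move=> z1; rewrite -F_inner//; have [] := F_fubini l z1. Qed.

Definition inv4pi : C := ((Num.sqrt (4 * pi))^-1)%:C%C.

Lemma inv4pi_neq0 : inv4pi != 0.
Proof. by rewrite eq_complex/= negb_and invr_eq0 gt_eqF ?sqrt4pi_gt0. Qed.

(** The inner integral of [c_coef] is over u; exchanging the integrals produces
    the integral of v^l gam(u + v) over v > 0, which is [ptail l u]. *)
Lemma c_coef_mellin (k l : nat) (alpha : C) : Re alpha < 1 ->
  c_coef k l alpha = (-1) ^+ l.+1 * mellin (k%:R - alpha) l.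
Proof.
move=> a1; set z := k%:R - alpha.
have z1 : -1 < Re z.
  have -> : Re z = k%:R - Re alpha.
    by rewrite /z -[k%:R in LHS](rmorph_nat (real_complex R) k) cReD/=; case: (alpha).
  by have : 0 <= k%:R :> R by []; lra.
have [i1 i2 i3 i4 E] := F_fubini l z1.
have -> : mellin z l = Cint setT (fun v => Cint setT ((F z l)^~ v)).
  by rewrite -E (F_inner l z1).
rewrite /c_coef -/z -mulrA; congr (_ * _).
have := inv4pi_neq0; rewrite /inv4pi; set c := (real_complex R _) => c0.
pose G v u : C := (expR (- (u + v) ^+ 2 / 4))%:C%C * cpow u z * (v ^+ l)%:C%C.
have FG u v : F z l u v = c * ((\1_P v)%:C%C * ((\1_P u)%:C%C * G v u)).
  rewrite /F /G /c /gam !rmorphM/=; ring.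
clearbody c.
have j2 v : CL1 (fun u => (\1_P v)%:C%C * ((\1_P u)%:C%C * G v u)).
  have := CL1Z c^-1 (i2 v); congr CL1; apply/funext => u.
  by rewrite FG (mulrA c^-1) (mulVf c0) mul1r.
have e2 v : Cint setT ((F z l)^~ v) = c * ((\1_P v)%:C%C * Cint P (G v)).
  have -> : (F z l)^~ v = (fun u => c * ((\1_P v)%:C%C * ((\1_P u)%:C%C * G v u))).
    by apply/funext => u; exact: FG.
  rewrite (CintZ c (j2 v)); congr (_ * _).
  rewrite indic_posE; have [v0|v0] := ltP 0 v.
    by rewrite mul1r (Cint_indic P); apply: Cint_eqT => u; rewrite mul1r.
  rewrite mul0r -[RHS]Cint0; apply: Cint_eqT => u; exact: mul0r.
have E2 : (fun v => Cint setT ((F z l)^~ v)) = (fun v => c * ((\1_P v)%:C%C * Cint P (G v))).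
  exact: funext e2.
have i5 : CL1 (fun v => (\1_P v)%:C%C * Cint P (G v)).
  have := CL1Z c^-1 i4; congr CL1; apply/funext => v.
  by rewrite e2 (mulrA c^-1) (mulVf c0) mul1r.
rewrite E2 (CintZ c i5); congr (_ * _).
exact: (Cint_indic P (fun v => Cint P (G v))).
Qed.

End Coefficients.

(** * Boundary layers integrated against a singular function *)
Section BoundaryTerm.
Context {R : realType}.
Local Notation mu := (@lebesgue_measure R).
Local Notation C := R[i].
Local Notation Re := complex.Re.
Local Notation Im := complex.Im.
Local Notation P := (`]0, +oo[%classic : set R).

Lemma cpow0 (x : R) : cpow x 0 = 1 :> C.
Proof. by rewrite /cpow/= !mul0r expR0 cos0 sin0 complexr0 mulr1. Qed.

(** The integrand of [mellin 0 l], whose measurability comes with Fubini's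
    theorem. *)
Lemma ptail_measurable (l : nat) : measurable_fun setT (fun u : R => \1_P u * ptail l u).
Proof.
have z1 : -1 < Re (0 : C) by rewrite /= ltrN10.
have [/L1_measurable + _] := mellin_CL1 l z1; apply: eq_measurable_fun => u _.
by rewrite cpow0 mul1r cReM/= mul0r subr0.
Qed.

Lemma powR_ptail_L1 (b : R) (l : nat) : -1 < b -> L1 (fun u => \1_P u * (u `^ b * ptail l u)).
Proof.
move=> b1; have z1 : -1 < Re (b%:C%C : C) by [].
have := CL1_cabs (mellin_CL1 l z1); congr L1; apply/funext => u.
rewrite indic_posE; have [u0|u0] := ltP 0 u; last by rewrite !mul0r cabs0.
by rewrite !mul1r cabsM cabs_cpow// cabs_real ger0_norm ?ptail_ge0.
Qed.

Lemma ptail_le (l N : nat) : exists2 c : R, 0 <= c &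
  forall u, 0 <= u -> ptail l u <= c /\ u ^+ N * ptail l u <= c.
Proof.
have [c c0 Hc] := @ptail_gauss R l; have [B B0 HB] := @gauss_pow_bound R N 4^-1 ltac:(by []).
exists (c + c * B) => [|u u0]; first by rewrite addr_ge0// mulr_ge0.
have h := Hc u u0; have cB : 0 <= c * B by exact: mulr_ge0.
split.
  rewrite (le_trans h)// (@le_trans _ _ c)// ?lerDl// ler_piMr// -expR0 ler_expR oppr_le0 mulr_ge0// sqr_ge0//.
rewrite (@le_trans _ _ (c * (u ^+ N * expR (- (4^-1 * u ^+ 2)))))//.
  by rewrite mulrCA ler_wpM2l// exprn_ge0.
have := HB u; rewrite ger0_norm// => hB.
by rewrite (@le_trans _ _ (c * B))// ?lerDr// ler_wpM2l.
Qed.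

(** The substitution x = s u. *)
Lemma mellin_scaled (z : C) (l : nat) (s : R) : -1 < Re z -> 0 < s ->
  CL1 (fun x => (\1_P x)%:C%C * (cpow x z * (ptail l (x / s))%:C%C)) /\
  Cint setT (fun x => (\1_P x)%:C%C * (cpow x z * (ptail l (x / s))%:C%C))
    = s%:C%C * cpow s z * mellin z l.
Proof.
move=> z1 s0; have b0 : s^-1 != 0 by rewrite invr_eq0 gt_eqF.
have sC : (s%:C%C : C) != 0 by rewrite eq_complex/= negb_and gt_eqF.
have [i1 E] := Cint_affine 0 b0 (mellin_CL1 l z1).
have F : (fun x => (\1_P x)%:C%C * (cpow x z * (ptail l (x / s))%:C%C)) =
   (fun x => cpow s z * ((\1_P (0 + s^-1 * x))%:C%C * (cpow (0 + s^-1 * x) z * (ptail l (0 + s^-1 * x))%:C%C))).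
  apply/funext => x; rewrite add0r (mulrC s^-1) !indic_posE pmulr_lgt0 ?invr_gt0//.
  have [x0|x0] := ltP 0 x; last by rewrite !mul0r mulr0.
  have -> : cpow x z = cpow s z * cpow (x / s) z.
    by rewrite -cpowM ?divr_gt0// mulrCA divff ?gt_eqF// mulr1.
  by rewrite !mul1r mulrA.
rewrite F; split; first exact: CL1Z.
rewrite (CintZ _ i1) /mellin E (gtr0_norm (_ : 0 < s^-1)) ?invr_gt0//.
have -> : (s^-1)%:C%C = (s%:C%C)^-1 :> C by rewrite fmorphV.
by rewrite !mulrA -(mulrA s%:C%C) (mulrC s%:C%C) mulfK.
Qed.

Lemma powR_ptail_scaled (b : R) (l : nat) (s : R) : -1 < b -> 0 < s ->
  L1 (fun x => \1_P x * (x `^ b * ptail l (x / s))) /\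
  \int[mu]_x (\1_P x * (x `^ b * ptail l (x / s)))
    = s `^ (1 + b) * \int[mu]_u (\1_P u * (u `^ b * ptail l u)).
Proof.
move=> b1 s0; have b0 : s^-1 != 0 by rewrite invr_eq0 gt_eqF.
have i0 := powR_ptail_L1 l b1.
have i1 := L1_affine 0 b0 i0; have E := Rintegral_affine 0 b0 i0.
have F : (fun x => \1_P x * (x `^ b * ptail l (x / s))) =
   (fun x => s `^ b * (\1_P (0 + s^-1 * x) * ((0 + s^-1 * x) `^ b * ptail l (0 + s^-1 * x)))).
  apply/funext => x; rewrite add0r (mulrC s^-1) !indic_posE pmulr_lgt0 ?invr_gt0//.
  have [x0|x0] := ltP 0 x; last by rewrite !mul0r mulr0.
  have -> : x `^ b = s `^ b * (x / s) `^ b.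
    by rewrite -powRM ?divr_ge0 ?(ltW x0) ?(ltW s0)// mulrCA divff ?gt_eqF// mulr1.
  by rewrite !mul1r mulrA.
rewrite F; split; first exact: L1Z.
rewrite (@RintegralZl _ _ _ _ _ _ (s `^ b) measurableT i1) E (gtr0_norm (_ : 0 < s^-1)) ?invr_gt0// powRD ?(gt_eqF s0) ?implybT// powRr1 ?(ltW s0)//.
by rewrite mulrA (mulrC s) -(mulrA (s `^ b)) divff ?gt_eqF// mulr1.
Qed.

(** Subtract the n first terms of the expansion of psi, multiplied by the
    profile; their integrals over ]0, +oo[ are exact by [mellin_scaled].  Near
    0 the difference is O(x^(n - Re alpha)) and scaling gives the power of s;
    away from 0 the profile is O(s^N). *)
Lemma boundary_term (psi : R -> C) (alpha : C) (a : nat -> C) (l n N : nat) :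
  Re alpha < 1 -> CL1 psi -> (forall x, x <= 0 -> psi x = 0) -> expansion alpha psi a ->
  exists2 M : R, 0 <= M & forall s, 0 < s ->
    CL1 (fun x => psi x * (ptail l (x / s))%:C%C) /\
    cabs (Cint setT (fun x => psi x * (ptail l (x / s))%:C%C) -
      \sum_(k < n) a k * (s%:C%C * cpow s (k%:R - alpha) * mellin (k%:R - alpha) l))
    <= M * (s `^ (1 + (n%:R - Re alpha)) + s ^+ N).
Proof.
move=> a1 ipsi psi0 exps.
have [M0 [d /= d0 Hd]] := exps n.
pose b := n%:R - Re alpha.
have Rez k : Re (k%:R - alpha) = k%:R - Re alpha.
  by rewrite -[k%:R in LHS](rmorph_nat (real_complex R) k) cReD/=; case: (alpha).
have rez k : -1 < Re (k%:R - alpha).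
  by rewrite Rez; have : 0 <= k%:R :> R by []; lra.
have b1 : -1 < b by rewrite /b -Rez rez.
(* The expansion is used on ]0, d/2[ only, where it holds. *)
pose dd := d / 2; have dd0 : 0 < dd by rewrite divr_gt0.
pose A := \sum_(k < n) cabs (a k) * (dd ^+ (n - k))^-1.
have A0 : 0 <= A by apply: sumr_ge0 => k _; rewrite mulr_ge0 ?cabs_ge0// invr_ge0 exprn_ge0// ltW.
(* The first terms of the expansion, extended to the half line. *)
pose p x := \sum_(k < n) a k * ((\1_P x)%:C%C * cpow x (k%:R - alpha)).
have err x : cabs (psi x - p x) <= (`|M0| + A) * (\1_P x * x `^ b) + (dd <= x)%R%:R * cabs (psi x).
  rewrite /p indic_posE; have [x0|x0] := ltP 0 x; last first.
    rewrite psi0// sub0r cabsN big1 ?cabs0 ?mul0r ?mulr0 ?addr0// => k _.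
    by rewrite !mul0r mulr0.
  rewrite mul1r.
  have pE : \sum_(k < n) a k * (true%:R%:C%C * cpow x (k%:R - alpha)) =
     cpow x (- alpha) * \sum_(k < n) a k * (x ^+ k)%:C%C.
    rewrite mulr_sumr; apply: eq_bigr => k _.
    by rewrite mul1r cpowD cpow_nat//; ring.
  have [ddx|xdd] := leP dd x; rewrite ?mul1r ?mul0r ?addr0.
    rewrite (le_trans (cabsB _ _))// addrC lerD2r.
    rewrite (@le_trans _ _ (A * x `^ b))//; last by rewrite ler_wpM2r ?powR_ge0// lerDr.
    rewrite (le_trans (cabs_sum _ _ _))// /A mulr_suml; apply: ler_sum => k _.
    rewrite cabsM -mulrA ler_wpM2l ?cabs_ge0// mul1r cabs_cpow// Rez.
    have -> : k%:R - Re alpha = - (n - k)%:R + b.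
      by rewrite natrB ?(ltnW (ltn_ord k))// /b opprB addrA subrK.
    rewrite powRD ?(gt_eqF x0) ?implybT// ler_wpM2r ?powR_ge0// powR_invn ?(ltW x0)//.
    by rewrite lef_pV2 ?posrE ?exprn_gt0// lerXn2r ?nnegrE ?(ltW dd0) ?(ltW x0).
  have xd : ball 0 d x by rewrite -ball_normE/= sub0r normrN gtr0_norm// (lt_trans xdd)// /dd ltr_pdivrMr// ltr_pMr// ltr1n.
  have := Hd x xd x0; rewrite -pE normcabs lecR => h.
  rewrite (le_trans h)// -/b ler_wpM2r ?powR_ge0// (le_trans (ler_norm _))// lerDl//.
have [c c0 Hc] := ptail_le l N.
pose W := \int[mu]_u (\1_P u * (u `^ b * ptail l u)).
have W0 : 0 <= W.
  by apply: Rintegral_ge0 => u _; rewrite mulr_ge0// mulr_ge0 ?powR_ge0 ?ptail_ge0.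
pose V := \int[mu]_x cabs (psi x).
have V0 : 0 <= V by apply: Rintegral_ge0 => u _; exact: cabs_ge0.
exists (2 * ((`|M0| + A) * W + c / dd ^+ N * V)).
  by rewrite !mulr_ge0// addr_ge0// !mulr_ge0 ?addr_ge0// invr_ge0 exprn_ge0// ltW.
move=> s s0.
have pm : measurable_fun setT (fun x : R => \1_P x * ptail l (x / s)).
  have := measurableT_comp (@ptail_measurable l) (@affine_measurable R 0 s^-1).
  apply: eq_measurable_fun => x _ /=.
  by rewrite add0r (mulrC s^-1) !indic_posE pmulr_lgt0 ?invr_gt0.
have psiE : (fun x => psi x * (ptail l (x / s))%:C%C) = (fun x => psi x * (\1_P x * ptail l (x / s))%:C%C).
  apply/funext => x; rewrite indic_posE; have [x0|x0] := ltP 0 x; first by rewrite mul1r.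
  by rewrite psi0// !mul0r.
have i1 : CL1 (fun x => psi x * (ptail l (x / s))%:C%C).
  rewrite psiE; apply: (CL1_dom (h := fun x => c * cabs (psi x))).
  - by apply: cmeasM; [exact: CL1_meas|exact: cmeas_real].
  - by apply: L1Z; exact: CL1_cabs.
  - move=> x; rewrite cabsM cabs_real mulrC ler_wpM2r ?cabs_ge0//.
    rewrite indic_posE; have [x0|x0] := ltP 0 x; last by rewrite mul0r normr0.
    rewrite mul1r ger0_norm ?ptail_ge0//.
    by have [] := Hc (x / s) ltac:(by rewrite divr_ge0// ltW).
split => //.
have tk k : CL1 (fun x => a k * ((\1_P x)%:C%C * (cpow x (k%:R - alpha) * (ptail l (x / s))%:C%C))).
  by apply: CL1Z; have [] := mellin_scaled l (rez k) s0.
have -> : \sum_(k < n) a k * (s%:C%C * cpow s (k%:R - alpha) * mellin (k%:R - alpha) l) =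
   Cint setT (fun x => \sum_(k < n) a k * ((\1_P x)%:C%C * (cpow x (k%:R - alpha) * (ptail l (x / s))%:C%C))).
  rewrite (Cint_sum (F := fun k x => a k * ((\1_P x)%:C%C * (cpow x (k%:R - alpha) * (ptail l (x / s))%:C%C)))) => [|k _]; last exact: tk.
  apply: eq_bigr => k _; have [i2 <-] := mellin_scaled l (rez k) s0.
  by rewrite CintZ.
have isum := @CL1_sum R n _ (fun k _ => tk k).
rewrite -CintB//.
have i3 := CL1B i1 isum.
have [i4 E4] := powR_ptail_scaled l b1 s0.
pose h x := (`|M0| + A) * (\1_P x * (x `^ b * ptail l (x / s))) + (c / dd ^+ N * s ^+ N) * cabs (psi x).
have ih : L1 h by apply: L1D; apply: L1Z => //; exact: CL1_cabs.
have bh x : cabs (psi x * (ptail l (x / s))%:C%C - \sum_(k < n) a k * ((\1_P x)%:C%C * (cpow x (k%:R - alpha) * (ptail l (x / s))%:C%C))) <= h x.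
  have -> : psi x * (ptail l (x / s))%:C%C - \sum_(k < n) a k * ((\1_P x)%:C%C * (cpow x (k%:R - alpha) * (ptail l (x / s))%:C%C)) = (psi x - p x) * (ptail l (x / s))%:C%C.
    rewrite mulrBl /p mulr_suml; congr (_ - _); apply: eq_bigr => k _.
    by rewrite !mulrA.
  rewrite cabsM cabs_real (ger0_norm (ptail_ge0 _ _)).
  apply: (le_trans (ler_wpM2r (ptail_ge0 _ _) (err x))).
  rewrite mulrDl /h -!mulrA lerD2l.
  have [ddx|_] := leP dd x; last by rewrite !mul0r !mulr_ge0 ?cabs_ge0 ?invr_ge0 ?exprn_ge0 ?(ltW dd0) ?(ltW s0).
  rewrite mul1r mulrC !mulrA ler_wpM2r ?cabs_ge0//.
  have x0 : 0 < x by exact: lt_le_trans ddx.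
  have [_ hN] := Hc (x / s) ltac:(by rewrite divr_ge0// ltW).
  rewrite mulrAC ler_pdivlMr ?exprn_gt0//.
  apply: (@le_trans _ _ (ptail l (x / s) * x ^+ N)).
    by rewrite ler_wpM2l ?ptail_ge0// lerXn2r ?nnegrE ?(ltW dd0) ?(ltW x0).
  have -> : ptail l (x / s) * x ^+ N = ((x / s) ^+ N * ptail l (x / s)) * s ^+ N.
    rewrite mulrAC -exprMn divfK ?gt_eqF// mulrC//.
  by rewrite ler_wpM2r// exprn_ge0// ltW.
apply: (le_trans (cabs_Cint (CL1_meas i3) ih bh)).
rewrite /h RintegralD//; last 2 first.
- exact: L1Z.
- by apply: L1Z; exact: CL1_cabs.
rewrite !RintegralZl//; last exact: CL1_cabs.
rewrite E4 -/W -/V -[leRHS]mulrA ler_wpM2l// -/b.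
set S1 := s `^ _; set S2 := s ^+ N.
have S10 : 0 <= S1 by exact: powR_ge0.
have S20 : 0 <= S2 by rewrite exprn_ge0// ltW.
set X := (`|M0| + A) * W; set Y := c / dd ^+ N * V.
have X0 : 0 <= X by rewrite mulr_ge0// addr_ge0.
have Y0 : 0 <= Y by rewrite !mulr_ge0// invr_ge0 exprn_ge0// ltW.
have -> : (`|M0| + A) * (S1 * W) + c / dd ^+ N * S2 * V = X * S1 + Y * S2 by rewrite /X /Y; ring.
have -> : (X + Y) * (S1 + S2) = X * S1 + Y * S2 + (X * S2 + Y * S1) by ring.
by rewrite lerDl addr_ge0// mulr_ge0.
Qed.

End BoundaryTerm.

(** * Taylor coefficients of the smooth datum *)
Section Expansions.
Context {R : realType}.
Local Notation mu := (@lebesgue_measure R).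
Local Notation C := R[i].
Local Notation Re := complex.Re.
Local Notation Im := complex.Im.

(** The first coefficients that differ, at order m, would make
    (a_m - b_m) x^m of order x^(m+1). *)
Lemma expansion_unique (f : R -> C) (a b : nat -> C) :
  expansion 0 f a -> expansion 0 f b -> a =1 b.
Proof.
move=> ea eb m; elim/ltn_ind: m => m IH.
have [Ma [da /= da0 Ha]] := ea m.+1; have [Mb [db /= db0 Hb]] := eb m.+1.
apply/eqP; rewrite -subr_eq0; apply/eqP; apply/normr0_eq0; rewrite normcabs.
have [//|dm] := eqVneq (cabs (a m - b m)) 0; first by move=> ->.
have {}dm : 0 < cabs (a m - b m) by rewrite lt_neqAle eq_sym dm cabs_ge0.
pose M := `|Ma| + `|Mb| + 1.
have M0 : 0 < M by rewrite ltr_wpDl// addr_ge0.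
(* Small enough for both expansions, and for the contradiction
   M x <= |a_m - b_m| / 2. *)
pose x := Num.min (Num.min (da / 2) (db / 2)) (cabs (a m - b m) / (2 * M)).
have x0 : 0 < x by rewrite !lt_min !divr_gt0// mulr_gt0.
have xa : x < da by rewrite !gt_min (_ : da / 2 < da)//; lra.
have xb : x < db by rewrite !gt_min (_ : db / 2 < db) ?orbT//; lra.
have xM : x <= cabs (a m - b m) / (2 * M) by rewrite !ge_min lexx orbT.
have ba : ball 0 da x by rewrite -ball_normE/= sub0r normrN gtr0_norm.
have bb : ball 0 db x by rewrite -ball_normE/= sub0r normrN gtr0_norm.
have h1 := Ha x ba x0; have h2 := Hb x bb x0.
have pw : x `^ (m.+1%:R - Re (0 : C)) = x ^+ m.+1 by rewrite subr0 powR_mulrn// ltW.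
rewrite pw normcabs lecR oppr0 cpow0 mul1r in h1.
rewrite pw normcabs lecR oppr0 cpow0 mul1r in h2.
have E : (a m - b m) * (x ^+ m)%:C%C = (f x - \sum_(k < m.+1) b k * (x ^+ k)%:C%C) - (f x - \sum_(k < m.+1) a k * (x ^+ k)%:C%C).
  rewrite !big_ord_recr/=.
  have -> : \sum_(i < m) b i * (x ^+ i)%:C%C = \sum_(i < m) a i * (x ^+ i)%:C%C.
    by apply: eq_bigr => i _; rewrite IH.
  ring.
have : cabs ((a m - b m) * (x ^+ m)%:C%C) <= M * x ^+ m.+1.
  rewrite E (le_trans (cabsB _ _))// (le_trans (lerD h2 h1))// -mulrDl.
  rewrite ler_wpM2r ?exprn_ge0 ?(ltW x0)// /M.
  by have := ler_norm Ma; have := ler_norm Mb; lra.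
rewrite cabsM cabs_real gtr0_norm ?exprn_gt0// exprS mulrA ler_pM2r ?exprn_gt0// => h3.
have h4 : M * x <= cabs (a m - b m) / 2.
  rewrite (le_trans (ler_wpM2l (ltW M0) xM))// le_eqVlt; apply/orP; left; apply/eqP.
  by field; rewrite gt_eqF.
by exfalso; lra.
Qed.

Variable g : R -> C.
Hypothesis sg : smooth_on setT g.

Definition dRe (n : nat) (x : R) : R := derive1n n (fun y => Re (g y)) x.
Definition dIm (n : nat) (x : R) : R := derive1n n (fun y => Im (g y)) x.
Definition dC (n : nat) (x : R) : C := (dRe n x +i* dIm n x)%C.

Lemma dRe_derivatives : derivatives dRe.
Proof. by move=> n x; rewrite /dRe derive1nS; apply: is_derive_derive1; have [] := sg n (x := x) I. Qed.

Lemma dIm_derivatives : derivatives dIm.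
Proof. by move=> n x; rewrite /dIm derive1nS; apply: is_derive_derive1; have [] := sg n (x := x) I. Qed.

Lemma dC0 x : dC 0 x = g x.
Proof. by rewrite /dC /dRe /dIm /=; case: (g x). Qed.

(** D is a local operator: what rho does outside the open interval, where it
    need not be smooth, has no effect inside. *)
Lemma Dop_local (f h : R -> C) (A : set R) : open A -> (forall x, A x -> f x = h x) ->
  forall x, A x -> Dop f x = Dop h x.
Proof.
move=> oA fh.
have D1 (u v : R -> R) : (forall x, A x -> u x = v x) -> forall x, A x -> derive1 u x = derive1 v x.
  move=> uv x Ax; rewrite !derive1E; apply: near_eq_derive.
  have : \forall z \near x, A z by exact: open_nbhs_nbhs.
  by apply: filterS => z Az; exact: uv.
have D2 (u v : R -> R) : (forall x, A x -> u x = v x) -> forall x, A x -> derive1n 2 u x = derive1n 2 v x.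
  by move=> uv; rewrite !derive1nS !derive1n0; apply: (D1 _ _ (D1 _ _ uv)).
move=> x Ax; rewrite /Dop /DopR (D2 _ (fun y => Re (h y)) _ _ Ax); last by move=> y Ay; rewrite fh.
by rewrite (D2 (fun y => Im (f y)) (fun y => Im (h y)) _ _ Ax)// => y Ay; rewrite fh.
Qed.

Lemma Dop_dC (n m : nat) x : Dop (fun y => (-1) ^+ n * dC m y) x = (-1) ^+ n.+1 * dC m.+2 x.
Proof.
pose e : R := (-1) ^+ n.
have eE : ((-1) ^+ n : C) = e%:C%C by rewrite /e rmorphXn/= rmorphN1.
have D (F : nat -> R -> R) : derivatives F -> derive1n 2 (fun y => e * F m y) x = e * F m.+2 x.
  move=> hF; rewrite !derive1nS derive1n0.
  have D1 k : derive1 (fun y => e * F k y) = (fun y => e * F k.+1 y).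
    apply/funext => y; rewrite derive1E.
    have h := @is_deriveZ _ _ _ _ e y 1 _ (hF k y).
    by rewrite (_ : (fun y => e * F k y) = e \*: F k)// derive_val.
  by rewrite !D1.
rewrite exprS mulN1r eE /Dop /DopR.
rewrite (_ : (fun y => Re _) = (fun y => e * dRe m y)); last by apply/funext => y; rewrite /= mul0r subr0.
rewrite (_ : (fun y => Im _) = (fun y => e * dIm m y)); last by apply/funext => y; rewrite /= mul0r addr0.
rewrite (D _ dRe_derivatives) (D _ dIm_derivatives).
rewrite /dC; move: (dRe m.+2 x) (dIm m.+2 x) => p q.
by rewrite mulNr; apply/eqP; rewrite eq_complex/= !mul0r subr0 addr0 !eqxx.
Qed.

Lemma iter_Dop (rho : R -> C) : (forall x, Omega x -> rho x = g x) ->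
  forall n x, int_Omega x -> iter n Dop rho x = (-1) ^+ n * dC n.*2 x.
Proof.
move=> rg; elim => [|n IH] x Ox.
  rewrite expr0 mul1r /= dC0; apply: rg; move: Ox; rewrite /int_Omega /Omega/= !in_itv/=.
  by move=> /andP[h1 h2]; rewrite !ltW.
rewrite iterS (@Dop_local _ (fun y => (-1) ^+ n * dC n.*2 y) int_Omega)//; first exact: Dop_dC.
Qed.

Lemma sum_dC (m : nat) (a : R) (c : nat -> R) :
  \sum_(k < m) dC k a / k`!%:R * (c k)%:C%C =
  ((\sum_(k < m) dRe k a / k`!%:R * c k) +i* (\sum_(k < m) dIm k a / k`!%:R * c k))%C.
Proof.
elim: m => [|m IH]; first by rewrite !big_ord0.
rewrite !big_ord_recr/= IH /dC.
have -> : (m`!%:R : C) = (m`!%:R : R)%:C%C by rewrite rmorph_nat.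
rewrite -fmorphV/=.
by apply/eqP; rewrite eq_complex/= !mulr0 !subr0 !add0r !eqxx.
Qed.

(** Taylor's formula at the end point; at pi the inner coordinate is pi - x,
    which changes the sign of the odd coefficients. *)
Lemma rho_expansion (rho : R -> C) (b : R) : (forall x, Omega x -> rho x = g x) ->
  bdry_Omega b ->
  expansion 0 (fun s => rho (inward b s))
    (fun k => (if b == 0 then 1 else (-1) ^+ k) * (dC k b / k`!%:R)).
Proof.
move=> rg bb m.
have p0 : 0 < pi :> R := pi_gt0 R.
have [M1 M10 H1] := taylor_bound 0 pi m dRe_derivatives.
have [M2 M20 H2] := taylor_bound 0 pi m dIm_derivatives.
exists (M1 + M2); exists pi => //= x; rewrite /ball_/= sub0r normrN => xp x0.
rewrite gtr0_norm// in xp.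
rewrite subr0 powR_mulrn ?(ltW x0)// oppr0 cpow0 mul1r normcabs lecR.
pose y := inward b x.
have b01 : 0 <= b <= pi by case: bb => ->; rewrite lexx ltW.
have y01 : 0 <= y <= pi.
  rewrite /y /inward; case: ifP => _; first by rewrite !ltW.
  by apply/andP; split; lra.
have E : \sum_(k < m) (if b == 0 then 1 else (-1) ^+ k) * (dC k b / k`!%:R) * (x ^+ k)%:C%C
   = (taylor dRe m b (y - b) +i* taylor dIm m b (y - b))%C.
  rewrite /taylor -(sum_dC m b (fun k => (y - b) ^+ k)); apply: eq_bigr => k _; rewrite /y /inward.
  case: eqP => [->|/eqP nb]; first by rewrite mul1r subr0.
  have -> : b = pi by case: bb nb => ->; rewrite ?eqxx.
  have sE : ((-1) ^+ k : C) = ((-1) ^+ k : R)%:C%C by rewrite rmorphXn/= rmorphN1.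
  rewrite [pi - x]addrC addrK [(- x) ^+ k]exprNn [in RHS]rmorphM/= sE.
  by ring.
rewrite E -/y rg ?/Omega/= ?in_itv//.
rewrite -dC0 (le_trans (cabs_le _))//= mulrDl.
have xy : `|y - b| = x.
  rewrite /y /inward; case: eqP => [->|/eqP nb]; first by rewrite subr0 gtr0_norm.
  have -> : b = pi by case: bb nb => ->; rewrite ?eqxx.
  by rewrite [pi - x]addrC addrK normrN gtr0_norm.
by rewrite -xy lerD//; [exact: H1|exact: H2].
Qed.

End Expansions.

(** * Integrability of the singular datum *)
Section Datum.
Context {R : realType}.
Local Notation mu := (@lebesgue_measure R).
Local Notation C := R[i].
Local Notation Re := complex.Re.
Local Notation Im := complex.Im.

Lemma measurable_indicM (A : set R) (f : R -> R) : measurable A ->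
  measurable_fun A f -> measurable_fun setT (fun x => \1_A x * f x).
Proof.
move=> mA mf; have := (measurable_restrictT f mA).1 mf.
apply: eq_measurable_fun => x _; rewrite patchE indicE.
by case: ifP => _; rewrite ?mul1r ?mul0r.
Qed.

(** The expansion with no terms is a bound by x^(-Re alpha). *)
Lemma expansion_bound (alpha : C) (f : R -> C) (a : nat -> C) : expansion alpha f a ->
  exists2 d : R, 0 < d & exists2 M : R, 0 <= M &
    forall x, 0 < x < d -> cabs (f x) <= M * x `^ (- Re alpha).
Proof.
move=> ea; have [M [d /= d0 H]] := ea 0%N; exists d => //; exists `|M| => // x /andP[x0 xd].
have bx : ball 0 d x by rewrite -ball_normE/= sub0r normrN gtr0_norm.
have := H x bx x0; rewrite big_ord0 mulr0 subr0 sub0r normcabs lecR => h.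
by rewrite (le_trans h)// ler_wpM2r ?powR_ge0// ler_norm.
Qed.

(** Near the end points phi is dominated by powers with exponent
    - Re alpha > -1, and in between it is continuous. *)
Lemma integrable_datum (alpha : C) (phi : R -> C) (a0 a1 : nat -> C) :
  Re alpha < 1 -> smooth_on int_Omega phi ->
  expansion alpha phi a0 -> expansion alpha (fun s => phi (pi - s)) a1 ->
  CL1 (fun x => (\1_(int_Omega : set R) x)%:C%C * phi x).
Proof.
move=> a_lt1 sphi e0 e1.
have p0 : 0 < pi :> R := pi_gt0 R.
have p1 : 1 < pi :> R by have := pi_ge2 R; lra.
have [d0 d00 [M0 M00 H0]] := expansion_bound e0.
have [d1 d10 [M1 M10 H1]] := expansion_bound e1.
pose d := Num.min (Num.min d0 d1) 1.
have d_gt0 : 0 < d by rewrite !lt_min d00 d10 ltr01.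
have dd0 : d <= d0 by rewrite !ge_min lexx.
have dd1 : d <= d1 by rewrite !ge_min lexx orbT.
have dd : d <= 1 by rewrite !ge_min lexx orbT.
have contRe x : int_Omega x -> {for x, continuous (fun y => Re (phi y))}.
  by move=> Ox; have [h _] := sphi 0%N x Ox; apply/differentiable_continuous/derivable1_diffP; exact: h.
have contIm x : int_Omega x -> {for x, continuous (fun y => Im (phi y))}.
  by move=> Ox; have [_ h] := sphi 0%N x Ox; apply/differentiable_continuous/derivable1_diffP; exact: h.
have mO : measurable (int_Omega : set R) by exact: measurable_itv.
have oO : open (int_Omega : set R) by exact: interval_open.
have mphi : cmeas (fun x => (\1_(int_Omega : set R) x)%:C%C * phi x).
  split.
    rewrite (_ : (fun x => _) = (fun x => \1_(int_Omega : set R) x * Re (phi x))); last first.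
      by apply/funext => x; rewrite cReM/= mul0r subr0.
    apply: measurable_indicM => //; apply: open_continuous_measurable_fun => // x xO.
    by apply: contRe; rewrite inE in xO.
  rewrite (_ : (fun x => _) = (fun x => \1_(int_Omega : set R) x * Im (phi x))); last first.
    by apply/funext => x; rewrite cImM/= mul0r addr0.
  apply: measurable_indicM => //; apply: open_continuous_measurable_fun => // x xO.
  by apply: contIm; rewrite inE in xO.
have mid x : d <= x <= pi - d -> int_Omega x.
  by rewrite /int_Omega/= in_itv/= => /andP[h1 h2]; apply/andP; split; lra.
have bdd (f : R -> R) : (forall x, int_Omega x -> {for x, continuous f}) ->
    exists2 B, 0 <= B & forall x, d <= x <= pi - d -> `|f x| <= B.
  move=> cf; have [dp|dp] := leP d (pi - d); last by exists 0 => // x /andP[? ?]; lra.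
  have cN : {within `[d, pi - d], continuous (fun y => `|f y|)}.
    apply: continuous_in_subspaceT => x /set_mem/=; rewrite in_itv/= => xd.
    by apply: continuous_comp; [exact: cf (mid _ xd)|exact: norm_continuous].
  have [c _ Hc] := EVT_max dp cN.
  by exists `|f c| => // x xd; apply: Hc; rewrite in_itv.
have [B1 B10 HB1] := bdd _ contRe; have [B2 B20 HB2] := bdd _ contIm.
have na : -1 < - Re alpha by rewrite ltrN2.
pose u x := \1_(`]0, 1]%classic : set R) x * x `^ (- Re alpha).
have iu : L1 u by exact: powR_unit_L1.
have n1 : -1 != 0 :> R by rewrite oppr_eq0 oner_neq0.
have iu' := L1_affine pi n1 iu.
have u0 x : 0 <= u x by rewrite mulr_ge0// powR_ge0.
pose h x := M0 * u x + M1 * u (pi + -1 * x) + (B1 + B2) * \1_(`[0, pi]%classic : set R) x.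
have ih : L1 h.
  apply: L1D; first by apply: L1D; exact: L1Z.
  by apply: L1Z; exact: integrable_indic_itv.
apply: (CL1_dom mphi ih) => x.
have hx0 : 0 <= M0 * u x by exact: mulr_ge0.
have hx1 : 0 <= M1 * u (pi + -1 * x) by exact: mulr_ge0.
have hx2 : 0 <= (B1 + B2) * \1_(`[0, pi]%classic : set R) x by rewrite mulr_ge0// addr_ge0.
have [xO|xO] := boolP (0 < x < pi); last first.
  rewrite indicE mem_setE /int_Omega/= in_itv/= (negbTE xO) mul0r cabs0.
  by rewrite /h !addr_ge0.
have /andP[x0 xp] := xO.
rewrite indicE mem_setE /int_Omega/= in_itv/= xO mul1r.
have [xd|dx] := ltP x d.
  have := H0 x ltac:(by rewrite x0 (lt_le_trans xd)) => /le_trans; apply.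
  have -> : x `^ (- Re alpha) = u x.
    by rewrite /u indicE mem_setE in_itv/= x0 (le_trans (ltW xd) dd) mul1r.
  by rewrite /h -addrA lerDl addr_ge0.
have [xd|dx'] := ltP (pi - x) d.
  have := H1 (pi - x) ltac:(by rewrite subr_gt0 xp (lt_le_trans xd)).
  rewrite opprB addrCA subrr addr0 => /le_trans; apply.
  have -> : (pi - x) `^ (- Re alpha) = u (pi + -1 * x).
    by rewrite /u indicE mem_setE in_itv/= mulN1r subr_gt0 xp (le_trans (ltW xd) dd) mul1r.
  by rewrite /h; lra.
have xm : d <= x <= pi - d by rewrite dx/=; lra.
rewrite (le_trans (cabs_le _))// (le_trans (lerD (HB1 x xm) (HB2 x xm)))//.
have i1 : \1_(`[0, pi]%classic : set R) x = 1 :> R by rewrite indicE mem_setE in_itv/= (ltW x0) (ltW xp).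
rewrite /h i1 mulr1; lra.
Qed.

End Datum.

(** * The heat content as an integral of the solution *)
Section HeatContentFubini.
Context {R : realType}.
Local Notation mu := (@lebesgue_measure R).
Local Notation C := R[i].
Local Notation Re := complex.Re.
Local Notation Im := complex.Im.
Local Notation I := (\1_(int_Omega : set R)).

Lemma int_OmegaE (x : R) : I x = (0 < x < pi)%R%:R :> R.
Proof. by rewrite indicE mem_setE/= in_itv. Qed.

(** The end points are a null set.  This passes to the open interval, which is
    where phi is controlled. *)
Lemma Cint_Omega (f : R -> C) : cmeas (fun x => (I x)%:C%C * f x) ->
  Cint Omega f = Cint setT (fun x => (I x)%:C%C * f x).
Proof.
move=> [m1 m2]; rewrite -Cint_indic /Cint /Rintegral.
have E x : int_Omega x -> (I x)%:C%C * f x = f x.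
  by rewrite /int_Omega/= in_itv/= int_OmegaE => ->; rewrite mul1r.
have mO : measurable (int_Omega : set R) by exact: measurable_itv.
congr (fine _ +i* fine _)%C; apply: integral_itv_bndoo; apply/measurable_EFinP.
  apply: (@eq_measurable_fun _ _ _ _ _ (fun x => Re ((I x)%:C%C * f x))); last exact: measurable_funTS.
  by move=> x; rewrite inE => /E ->.
apply: (@eq_measurable_fun _ _ _ _ _ (fun x => Im ((I x)%:C%C * f x))); last exact: measurable_funTS.
by move=> x; rewrite inE => /E ->.
Qed.

(** The kernel is bounded at a fixed time and phi is integrable, so Fubini's
    theorem applies; the inner integral becomes the solution with initial
    datum rho at the point x. *)
Lemma heat_content_fubini (K : R -> R -> R -> R) (phi rho g : R -> C) (t : R) :
  is_heat_kernel K -> 0 < t ->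
  CL1 (fun x => (I x)%:C%C * phi x) ->
  continuous (fun y => Re (g y)) -> continuous (fun y => Im (g y)) ->
  (forall x, Omega x -> rho x = g x) ->
  CL1 (fun x => (I x)%:C%C * phi x * Cint int_Omega (fun y => (K x y t)%:C%C * g y)) /\
  heat_content K phi rho t =
  Cint setT (fun x => (I x)%:C%C * phi x * Cint int_Omega (fun y => (K x y t)%:C%C * g y)).
Proof.
move=> hK t0 iphi cRe cIm rg.
have p0 : 0 < pi :> R := pi_gt0 R.
pose ph x := (I x)%:C%C * phi x; pose gt y := (I y)%:C%C * g y.
pose F x y := (K x y t)%:C%C * (ph x * gt y).
have mI : measurable_fun setT (I : R -> R) by exact: (measurable_indic (measurable_itv _)).
have mK : measurable_fun setT (fun p : R * R => K p.1 p.2 t).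
  exact: continuous_measurable_pair (heat_kernel_continuous hK t0).
have mgt : cmeas gt.
  apply: cmeasM; first exact: cmeas_real.
  by split; exact: continuous_measurable_fun.
have mF : cmeas (fun p : R * R => F p.1 p.2).
  apply: cmeasM; first exact: cmeas_real.
  apply: cmeasM; first by apply: (cmeas_comp (f := ph)); [exact: measurable_fst|exact: CL1_meas].
  by apply: (cmeas_comp (f := gt)); first exact: measurable_snd.
have [CK bK] := heat_kernel_bounded hK t0.
have [G1 G10 H1] := continuous_bounded_itv 0 pi cRe.
have [G2 G20 H2] := continuous_bounded_itv 0 pi cIm.
have CK0 : 0 <= CK by apply: (le_trans _ (bK 0 0 _)) => //; rewrite lexx mulr_ge0// ltW.
have ib : L1 (fun y => CK * (G1 + G2) * \1_(`[0, pi]%classic : set R) y).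
  by apply: L1Z; exact: integrable_indic_itv.
have Kb x y : cabs ((K x y t)%:C%C * gt y) <= CK * (G1 + G2) * \1_(`[0, pi]%classic : set R) y.
  rewrite cabsM cabs_real /gt int_OmegaE indicE mem_setE in_itv/=.
  have [/andP[y0 yp]|_] := boolP (0 < y < pi); last first.
    by rewrite mul0r cabs0 mulr0 !mulr_ge0// addr_ge0.
  rewrite mul1r (ltW y0) (ltW yp) mulr1 ler_pM ?cabs_ge0//.
    by apply: bK; rewrite (ltW y0)/=; lra.
  rewrite (le_trans (cabs_le _))// lerD//.
    by apply: H1; rewrite !ltW.
  by apply: H2; rewrite !ltW.
have bF x y : cabs (F x y) <= cabs (ph x) * (CK * (G1 + G2) * \1_(`[0, pi]%classic : set R) y).
  by rewrite /F mulrCA cabsM ler_wpM2l ?cabs_ge0.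
have [F1 F2 F3 F4 F5] := Cfubini mF (CL1_cabs iphi) ib bF.
have FE x : Cint setT (F x) = ph x * Cint int_Omega (fun y => (K x y t)%:C%C * g y).
  rewrite (Cint_indic int_Omega) -CintZ; last first.
    apply: (@CL1_dom _ _ (fun y => CK * (G1 + G2) * \1_(`[0, pi]%classic : set R) y)).
    - apply: cmeasM; first exact: cmeas_real.
      apply: cmeasM; last by split; exact: continuous_measurable_fun.
      by apply: cmeas_real; exact: (measurableT_comp mK (pair1_measurable x)).
    - exact: ib.
    - by move=> y; rewrite (mulrCA _ (K x y t)%:C%C); exact: Kb.
  by apply: Cint_eqT => y; rewrite /F /gt; ring.
have FEE : (fun x => Cint setT (F x)) =
    (fun x => ph x * Cint int_Omega (fun y => (K x y t)%:C%C * g y)).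
  by apply/funext => x; exact: FE.
rewrite FEE in F3 F5; split; first exact: F3.
apply: etrans (esym F5); rewrite /heat_content.
have inner y : Cint Omega (fun x => (K x y t)%:C%C * phi x * rho y) =
    Cint setT (fun x => (K x y t)%:C%C * ph x * rho y).
  rewrite Cint_Omega.
    by apply: Cint_eqT => x; rewrite /ph; ring.
  rewrite (_ : (fun x => _) = (fun x => (K x y t)%:C%C * ph x * rho y)); last first.
    by apply/funext => x; rewrite /ph; ring.
  apply: cmeasM; last by split; exact: measurable_cst.
  apply: cmeasM; last exact: CL1_meas.
  by apply: cmeas_real; exact: (measurableT_comp mK (pair2_measurable y)).
have outer : (fun y => (I y)%:C%C * Cint Omega (fun x => (K x y t)%:C%C * phi x * rho y)) =
    (fun y => Cint setT (F^~ y)).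
  apply/funext => y; rewrite inner int_OmegaE.
  have [/andP[y0 yp]|yO] := boolP (0 < y < pi).
    rewrite mul1r; apply: Cint_eqT => x; rewrite /F /gt int_OmegaE y0 yp mul1r mulrA rg//.
    by rewrite /Omega/= in_itv/= !ltW.
  rewrite mul0r -[LHS]Cint0; apply: Cint_eqT => x.
  by rewrite /F /gt int_OmegaE (negbTE yO) mul0r !mulr0.
rewrite Cint_Omega; first by rewrite outer.
by rewrite outer; exact: CL1_meas.
Qed.

End HeatContentFubini.

(** * Contributions of the interior and of the end points *)
Section Assembly.
Context {R : realType}.
Local Notation mu := (@lebesgue_measure R).
Local Notation C := R[i].
Local Notation Re := complex.Re.
Local Notation Im := complex.Im.

Lemma sum_triangle (V : zmodType) (G : nat -> nat -> V) (m : nat) :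
  \sum_(j < m) \sum_(k < j.+1) G k (j - k)%N = \sum_(l < m) \sum_(k < m - l) G k l.
Proof.
elim: m => [|m IH]; first by rewrite !big_ord0.
rewrite big_ord_recr [RHS]big_ord_recr/= IH subSnn big_ord1.
have -> : \sum_(l < m) \sum_(k < m.+1 - l) G k l =
    \sum_(l < m) \sum_(k < m - l) G k l + \sum_(l < m) G (m - l)%N l.
  rewrite -big_split; apply: eq_bigr => l _; rewrite subSn ?(ltnW (ltn_ord l))//.
  by rewrite big_ord_recr.
rewrite -addrA; congr (_ + _).
rewrite (reindex_inj rev_ord_inj) big_ord_recr/= !subSS subnn subn0; congr (_ + _).
by apply: eq_bigr => l _; rewrite subSS subKn// ltnW.
Qed.

Section KernelExpansion.
Variables (g : R -> C) (sg : smooth_on setT g).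

(** The odd moments vanish and the moment of order 2n is (2n)!/n!, which
    replaces (2n)! by n!. *)
Lemma sum_moments (m : nat) (x s : R) :
  \sum_(k < m.*2) dC g k x / k`!%:R * (s ^+ k * moment k)%:C%C =
  \sum_(n < m) ((s ^+ 2) ^+ n)%:C%C / n`!%:R * dC g n.*2 x.
Proof.
elim: m => [|m IH]; first by rewrite !big_ord0.
rewrite doubleS !big_ord_recr/= IH -addrA; congr (_ + _).
rewrite [moment m.*2.+1]moment_odd/= ?odd_double//.  rewrite mulr0 rmorph0 mulr0 addr0 moment_even.
rewrite -exprM mul2n rmorphM/= fmorph_div/= !rmorph_nat.
have f1 : (m.*2`!%:R : C) != 0 by rewrite pnatr_eq0 -lt0n fact_gt0.
have f2 : (m`!%:R : C) != 0 by rewrite pnatr_eq0 -lt0n fact_gt0.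
by move: f1 f2; move: (m.*2`!%:R : C) (m`!%:R : C) => p q p0 q0; field; rewrite p0 q0.
Qed.

(** [half_circle_gauss] and [gauss_arc_expansion] for the real and the
    imaginary part of g. *)
Lemma kernel_expansion (K : R -> R -> R -> R) (m q : nat) : is_heat_kernel K ->
  exists2 M : R, 0 <= M & forall x s : R, 0 < x < pi -> 0 < s ->
    cabs (Cint int_Omega (fun y => (K x y (s ^+ 2))%:C%C * g y)
      - (\sum_(n < m) ((s ^+ 2) ^+ n)%:C%C / n`!%:R * dC g n.*2 x
         - \sum_(l < q) dC g l 0 / l`!%:R * ((- s) ^+ l * ptail l (x / s))%:C%C
         - \sum_(l < q) dC g l pi / l`!%:R * (s ^+ l * ptail l ((pi - x) / s))%:C%C))
    <= M * (s ^+ m.*2 + s ^+ q).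
Proof.
move=> hK.
have [M1 M10 H1] := gauss_arc_expansion m.*2 q (dRe_derivatives sg).
have [M2 M20 H2] := gauss_arc_expansion m.*2 q (dIm_derivatives sg).
exists (M1 + M2); first exact: addr_ge0.
move=> x s xO s0; have s20 : 0 < s ^+ 2 by exact: exprn_gt0.
rewrite -sum_moments.
rewrite (sum_dC _ _ _ (fun k => s ^+ k * moment k)).
rewrite (sum_dC _ _ _ (fun l => (- s) ^+ l * ptail l (x / s))).
rewrite (sum_dC _ _ _ (fun l => s ^+ l * ptail l ((pi - x) / s))).
have cRe : continuous (fun y => Re (g y)) by exact: (derivatives_continuous (n := 0) (dRe_derivatives sg)).
have cIm : continuous (fun y => Im (g y)) by exact: (derivatives_continuous (n := 0) (dIm_derivatives sg)).
have UE : Cint int_Omega (fun y => (K x y (s ^+ 2))%:C%C * g y) =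
   (\int[mu]_w (gam w * arc (dRe g 0%N) (x + s * w)) +i* \int[mu]_w (gam w * arc (dIm g 0%N) (x + s * w)))%C.
  have h1 := half_circle_gauss hK x s20 cRe.
  have h2 := half_circle_gauss hK x s20 cIm.
  rewrite sqrtr_sqr gtr0_norm// in h1 h2.
  rewrite /dRe /dIm !derive1n0 -h1 -h2 /Cint; congr (_ +i* _)%C.
    by apply: eq_Rintegral => y _; rewrite cReM/= mul0r subr0.
  by apply: eq_Rintegral => y _; rewrite cImM/= mul0r addr0.
rewrite UE [leRHS]mulrDl.
have {}H1 := H1 x s xO s0; have {}H2 := H2 x s xO s0.
apply: (le_trans (cabs_le _)); apply: lerD.
  exact: H1.
exact: H2.
Qed.

End KernelExpansion.

(** In the layer of index l only the m - l first terms of psi matter, as the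
    remainder s^l s^(1 + m - l - Re alpha) is already below s^m; the pairs
    (k, l) that are kept are those with k + l < m. *)
Lemma boundary_contribution (psi : R -> C) (alpha : C) (a r : nat -> C) (m : nat) :
  Re alpha < 1 -> CL1 psi -> (forall x, x <= 0 -> psi x = 0) -> expansion alpha psi a ->
  exists2 M : R, 0 <= M & forall s, 0 < s <= 1 ->
    (forall l, (l < m)%N -> CL1 (fun x => psi x * (ptail l (x / s))%:C%C)) /\
    cabs (- \sum_(l < m) (-1) ^+ l * r l * (s ^+ l)%:C%C *
              Cint setT (fun x => psi x * (ptail l (x / s))%:C%C) -
      \sum_(j < m) cpow (s ^+ 2) ((1 + j%:R - alpha) / 2) *
        \sum_(k < j.+1) c_coef k (j - k)%N alpha * a k * r (j - k)%N)
    <= M * s ^+ m.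
Proof.
move=> a1 ipsi psi0 exps.
pose B (l : nat) s := Cint setT (fun x => psi x * (ptail l (x / s))%:C%C).
have Hl l : exists M : R, 0 <= M /\ forall s, 0 < s ->
    CL1 (fun x => psi x * (ptail l (x / s))%:C%C) /\
    cabs (B l s - \sum_(k < m - l) a k * (s%:C%C * cpow s (k%:R - alpha) * mellin (k%:R - alpha) l))
    <= M * (s `^ (1 + ((m - l)%:R - Re alpha)) + s ^+ m).
  by have [M M0 HM] := boundary_term l (m - l) m a1 ipsi psi0 exps; exists M.
have [Mf HM] := choice Hl.
exists (\sum_(l < m) cabs (r l) * (Mf l * 2)).
  by apply: sumr_ge0 => l _; rewrite !mulr_ge0 ?cabs_ge0//; have [] := HM l.
move=> s /andP[s0 s1]; split; first by move=> l _; have [_ /(_ s s0)[]] := HM l.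
have E : \sum_(j < m) cpow (s ^+ 2) ((1 + j%:R - alpha) / 2) *
        \sum_(k < j.+1) c_coef k (j - k)%N alpha * a k * r (j - k)%N =
   - \sum_(l < m) (-1) ^+ l * r l * (s ^+ l)%:C%C *
     \sum_(k < m - l) a k * (s%:C%C * cpow s (k%:R - alpha) * mellin (k%:R - alpha) l).
  rewrite -sumrN.
  pose G k l := cpow (s ^+ 2) ((1 + (k + l)%:R - alpha) / 2) * (c_coef k l alpha * a k * r l).
  transitivity (\sum_(j < m) \sum_(k < j.+1) G k (j - k)%N).
    apply: eq_bigr => j _; rewrite mulr_sumr; apply: eq_bigr => k _.
    by rewrite /G subnKC// -ltnS.
  rewrite sum_triangle; apply: eq_bigr => l _; rewrite mulr_sumr -sumrN; apply: eq_bigr => k _.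
  rewrite /G cpow_half ?exprn_gt0// sqrtr_sqr gtr0_norm// natrD.
  have -> : 1 + (k%:R + l%:R) - alpha = 1%:R + (l%:R + (k%:R - alpha)) :> C by ring.
  rewrite !cpowD !cpow_nat// expr1 c_coef_mellin// exprS.
  by ring.
rewrite E opprK addrC -sumrB (le_trans (cabs_sum _ _ _))// mulr_suml; apply: ler_sum => l _.
rewrite -mulrBr cabsM -[cabs (_ - _)]cabsN opprB -/(B l s).
have [Ml0 /(_ s s0)[_ H]] := HM l.
have e1 : cabs ((-1) ^+ l * r l * (s ^+ l)%:C%C) = cabs (r l) * s ^+ l.
  rewrite !cabsM cabsX cabsN (_ : 1 = (1 : R)%:C%C)// cabs_real normr1 expr1n mul1r cabs_real.
  by rewrite gtr0_norm// exprn_gt0.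
have le_sl : s ^+ l <= 1 by rewrite exprn_ile1// ltW.
have e2 : s ^+ l * (s `^ (1 + ((m - l)%:R - Re alpha)) + s ^+ m) <= 2 * s ^+ m.
  rewrite mulrDr mulr_natl mulr2n lerD//; last first.
    by rewrite -[leRHS]mul1r ler_wpM2r// exprn_ge0// ltW.
  rewrite -[s ^+ l]powR_mulrn ?(ltW s0)// -powRD ?(gt_eqF s0) ?implybT//.
  rewrite -powR_mulrn ?(ltW s0)// (_ : l%:R + _ = m%:R + (1 - Re alpha)); last first.
    rewrite natrB ?(ltnW (ltn_ord l))//; ring.
  by rewrite ger_powR ?s0// lerDl subr_ge0 ltW.
rewrite e1 (le_trans (ler_wpM2l _ H)) ?mulr_ge0 ?cabs_ge0 ?exprn_ge0 ?(ltW s0)//.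
rewrite -!mulrA ler_wpM2l ?cabs_ge0// mulrCA ler_wpM2l//.
Qed.

End Assembly.

(** * The interior series and the theorem *)
Section Final.
Context {R : realType}.
Local Notation mu := (@lebesgue_measure R).
Local Notation C := R[i].
Local Notation Re := complex.Re.
Local Notation Im := complex.Im.
Local Notation I := (\1_(int_Omega : set R)).

Lemma Cint_lincomb (m : nat) (c : nat -> C) (F : nat -> R -> C) :
  (forall i, (i < m)%N -> CL1 (F i)) ->
  CL1 (fun x => \sum_(i < m) c i * F i x) /\
  Cint setT (fun x => \sum_(i < m) c i * F i x) = \sum_(i < m) c i * Cint setT (F i).
Proof.
move=> iF; have icF i : (i < m)%N -> CL1 (fun x => c i * F i x) by move=> im; apply: CL1Z; exact: iF.
split; first exact: (CL1_sum icF).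
by rewrite (Cint_sum icF); apply: eq_bigr => i _; rewrite (CintZ _ (iF i (ltn_ord i))).
Qed.

Lemma expansion_near (alpha : C) (f h : R -> C) (a : nat -> C) :
  (forall x, 0 < x < pi -> h x = f x) -> expansion alpha f a -> expansion alpha h a.
Proof.
move=> fh ef m; have [M HM] := ef m; exists M.
apply: filterS3 HM (nbhs_right_gt 0) (nbhs_right_lt (pi_gt0 R)) => x Hx x0 xp.
by rewrite fh// x0.
Qed.

(** The signs (-1)^n of the coefficient and of D^n = (-1)^n d^(2n)/dx^(2n)
    cancel. *)
Lemma interior_contribution (phi rho g : R -> C) (m : nat) (t : R) :
  smooth_on setT g -> (forall x, Omega x -> rho x = g x) ->
  CL1 (fun x => (I x)%:C%C * phi x) ->
  CL1 (fun x => (I x)%:C%C * phi x * \sum_(n < m) (t ^+ n)%:C%C / n`!%:R * dC g n.*2 x) /\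
  Cint setT (fun x => (I x)%:C%C * phi x * \sum_(n < m) (t ^+ n)%:C%C / n`!%:R * dC g n.*2 x)
  = \sum_(n < m) (t ^+ n)%:C%C * beta_interior phi rho n.
Proof.
move=> sg rg iphi; pose ph x := (I x)%:C%C * phi x.
have iD n : CL1 (fun x => ph x * dC g n x).
  have cRe := derivatives_continuous (n := n) (dRe_derivatives sg).
  have cIm := derivatives_continuous (n := n) (dIm_derivatives sg).
  have [G1 G10 H1] := continuous_bounded_itv 0 pi cRe.
  have [G2 G20 H2] := continuous_bounded_itv 0 pi cIm.
  apply: (@CL1_dom _ _ (fun x => (G1 + G2) * cabs (ph x))).
  - apply: cmeasM; first exact: CL1_meas.
    by split; exact: continuous_measurable_fun.
  - by apply: L1Z; exact: CL1_cabs.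
  - move=> x; rewrite cabsM mulrC /ph int_OmegaE.
    have [/andP[x0 xp]|_] := boolP (0 < x < pi); last by rewrite mul0r cabs0 !mulr0.
    rewrite ler_wpM2r ?cabs_ge0// (le_trans (cabs_le _))// lerD//.
      by apply: H1; rewrite !ltW.
    by apply: H2; rewrite !ltW.
have [] := @Cint_lincomb m (fun n => (t ^+ n)%:C%C / n`!%:R) (fun n x => ph x * dC g n.*2 x).
  by move=> n _; exact: iD.
rewrite (_ : (fun x => \sum_(n < m) _) =
  (fun x => ph x * \sum_(n < m) (t ^+ n)%:C%C / n`!%:R * dC g n.*2 x)); last first.
  apply/funext => x; rewrite mulr_sumr; apply: eq_bigr => n _; exact: mulrCA.
move=> i1 E; split; first exact: i1.
apply: etrans E _; apply: eq_bigr => n _.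
have E x : (I x)%:C%C * (phi x * iter n Dop rho x) = (-1) ^+ n * (ph x * dC g n.*2 x).
  rewrite /ph int_OmegaE; have [xO|_] := boolP (0 < x < pi); last by rewrite !mul0r mulr0.
  rewrite (iter_Dop sg rg); first by ring.
  by rewrite /int_Omega/= in_itv.
have {}E : (fun x => (I x)%:C%C * (phi x * iter n Dop rho x)) = (fun x => (-1) ^+ n * (ph x * dC g n.*2 x)).
  by apply/funext.
rewrite /beta_interior Cint_Omega; last by rewrite E; apply: CL1_meas; exact: CL1Z.
rewrite E (CintZ _ (iD _)) [in RHS]mulrA [in RHS]mulrA -!mulrA; congr (_ * _).
by rewrite [(-1) ^+ n * _]mulrCA [(-1) ^+ n * (_ * _)]mulrA -expr2 sqrr_sign mul1r.
Qed.

End Final.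

Theorem lemma1p4 (R : realType) (K : R -> R -> R -> R) (alpha : R[i])
    (phi rho : R -> R[i]) (phik rhol : R -> nat -> R[i])
    (hK : is_heat_kernel K)
    (halpha : complex.Re alpha < 1)
    (hphi : K_space alpha phi)
    (hrho : smooth_upto Omega rho)
    (hphik : forall b : R, bdry_Omega b ->
       expansion alpha (fun s => phi (inward b s)) (phik b))
    (hrhol : forall b : R, bdry_Omega b ->
       expansion 0 (fun s => rho (inward b s)) (rhol b)) :
  asymptotic_series alpha (heat_content K phi rho)
    (beta_interior phi rho) (beta_boundary alpha phik rhol).
Proof.
have p0 : 0 < pi :> R := pi_gt0 R.
have b0 : bdry_Omega (0 : R) by left.
have b1 : bdry_Omega (pi : R) by right.
have [sphi _] := hphi; have [g sg rg] := hrho.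
have in0 : inward (0 : R) = id by apply/funext => s; rewrite /inward eqxx.
have inp : inward (pi : R) = (fun s => pi - s) by apply/funext => s; rewrite /inward gt_eqF.
have e0 := hphik 0 b0; rewrite in0 /= in e0.
have e1 := hphik pi b1; rewrite inp /= in e1.
have r0 l : dC g l 0 / l`!%:R = rhol 0 l.
  by rewrite (expansion_unique (hrhol 0 b0) (rho_expansion sg rg b0)) eqxx mul1r.
have r1 l : dC g l pi / l`!%:R = (-1) ^+ l * rhol pi l.
  rewrite (expansion_unique (hrhol pi b1) (rho_expansion sg rg b1)) gt_eqF//.
  by rewrite [RHS]mulrA -expr2 sqrr_sign mul1r.
have iphi := integrable_datum halpha sphi e0 e1.
pose ph x := (\1_(int_Omega : set R) x)%:C%C * phi x.
(* The reflection moves the end point pi to 0. *)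
pose phr x := ph (pi - x).
have iphr : CL1 phr.
  have n1 : -1 != 0 :> R by rewrite oppr_eq0 oner_neq0.
  have [+ _] := Cint_affine pi n1 iphi.
  by congr CL1; apply/funext => x; rewrite mulN1r.
have ph0 x : x <= 0 -> ph x = 0.
  by move=> x0; rewrite /ph int_OmegaE ltNge x0 mul0r.
have phr0 x : x <= 0 -> phr x = 0.
  by move=> x0; rewrite /phr /ph int_OmegaE (ltNge _ pi) lerBrDl -lerBrDr subrr x0 andbF mul0r.
have eph : expansion alpha ph (phik 0).
  by apply: expansion_near e0 => x xO; rewrite /ph int_OmegaE xO mul1r.
have ephr : expansion alpha phr (phik pi).
  apply: expansion_near e1 => x /andP[x0 xp]; rewrite /phr /ph int_OmegaE subr_gt0 xp.
  by rewrite ltrBlDr ltrDl x0 mul1r.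
(* The remainders are powers of s with exponent at least 2N. *)
move=> N; exists (2 * N)%N => m1 m2 Nm1 Nm2.
have [MB MB0 HB] := boundary_contribution (rhol 0) m2 halpha iphi ph0 eph.
have [MD MD0 HD] := boundary_contribution (rhol pi) m2 halpha iphr phr0 ephr.
have [MK MK0 HK] := kernel_expansion sg m1 m2 hK.
pose V := \int[@lebesgue_measure R]_x cabs (ph x).
exists (2 * (MK * 2) * V + MB + MD).
near=> t.
have t0 : 0 < t by near: t; exact: nbhs_right_gt.
have t1 : t < 1 by near: t; exact: nbhs_right_lt.
pose s := Num.sqrt t.
have s0 : 0 < s by rewrite sqrtr_gt0.
have tE : t = s ^+ 2 by rewrite sqr_sqrtr// ltW.
have s1 : s <= 1 by rewrite -(@expr_le1 _ 2)// -?tE ltW.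
have s01 : 0 < s <= 1 by rewrite s0 s1.
have spow k : (2 * N <= k)%N -> s ^+ k <= t ^+ N.
  by move=> Nk; rewrite tE -exprM ler_wiXn2l// ltW.
have {HB} [iB HB] := HB s s01; have {HD} [iD HD] := HD s s01.
have [iU hcE] := heat_content_fubini hK t0 iphi
  (derivatives_continuous (n := 0) (dRe_derivatives sg))
  (derivatives_continuous (n := 0) (dIm_derivatives sg)) rg.
have [iA AE] := interior_contribution m1 t sg rg iphi.
have [iBs BE] := @Cint_lincomb R m2 (fun l => (-1) ^+ l * rhol 0 l * (s ^+ l)%:C%C)
  (fun l x => ph x * (ptail l (x / s))%:C%C) iB.
have n1 : -1 != 0 :> R by rewrite oppr_eq0 oner_neq0.
have reflect l : (l < m2)%N ->
   CL1 (fun x => ph x * (ptail l ((pi - x) / s))%:C%C) /\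
   Cint setT (fun x => ph x * (ptail l ((pi - x) / s))%:C%C) =
   Cint setT (fun x => phr x * (ptail l (x / s))%:C%C).
  move=> lm; have [i1 E] := Cint_affine pi n1 (iD l lm).
  have fE : (fun x => phr (pi + -1 * x) * (ptail l ((pi + -1 * x) / s))%:C%C) =
      (fun x => ph x * (ptail l ((pi - x) / s))%:C%C).
    by apply/funext => x; rewrite mulN1r /phr subKr.
  rewrite fE in i1 E; split; first exact: i1.
  by rewrite E normrN1 mul1r.
have [iDs DE] := @Cint_lincomb R m2 (fun l => (-1) ^+ l * rhol pi l * (s ^+ l)%:C%C)
  (fun l x => ph x * (ptail l ((pi - x) / s))%:C%C) (fun l lm => (reflect l lm).1).
have {}DE : Cint setT (fun x => \sum_(l < m2) (-1) ^+ l * rhol pi l * (s ^+ l)%:C%C *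
     (ph x * (ptail l ((pi - x) / s))%:C%C)) =
   \sum_(l < m2) (-1) ^+ l * rhol pi l * (s ^+ l)%:C%C *
     Cint setT (fun x => phr x * (ptail l (x / s))%:C%C).
  by apply: etrans DE _; apply: eq_bigr => l _; rewrite (reflect l (ltn_ord l)).2.
pose U x := Cint int_Omega (fun y => (K x y t)%:C%C * g y).
(* The solution at x is compared with the interior sum minus the layers at 0
   and at pi. *)
pose A x := \sum_(n < m1) (t ^+ n)%:C%C / n`!%:R * dC g n.*2 x.
pose B x := \sum_(l < m2) (-1) ^+ l * rhol 0 l * (s ^+ l)%:C%C * (ph x * (ptail l (x / s))%:C%C).
pose D x := \sum_(l < m2) (-1) ^+ l * rhol pi l * (s ^+ l)%:C%C * (ph x * (ptail l ((pi - x) / s))%:C%C).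
have iAB : CL1 (fun x => ph x * A x - B x) by exact: CL1B.
have iABD : CL1 (fun x => ph x * A x - B x - D x) by exact: CL1B.
have iE : CL1 (fun x => ph x * U x - (ph x * A x - B x - D x)) by exact: CL1B.
have Eb x : cabs (ph x * U x - (ph x * A x - B x - D x)) <= MK * 2 * t ^+ N * cabs (ph x).
  have -> : ph x * U x - (ph x * A x - B x - D x) = ph x * (U x - (A x
       - \sum_(l < m2) dC g l 0 / l`!%:R * ((- s) ^+ l * ptail l (x / s))%:C%C
       - \sum_(l < m2) dC g l pi / l`!%:R * (s ^+ l * ptail l ((pi - x) / s))%:C%C)).
    rewrite !mulrBr; congr (_ - (_ - _ - _)); rewrite mulr_sumr; apply: eq_bigr => l _.
      have sE : ((-1) ^+ l : R[i]) = ((-1) ^+ l : R)%:C%C by rewrite rmorphXn/= rmorphN1.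
      by rewrite r0 [(- s) ^+ l]exprNn !rmorphM/= sE; ring.
    by rewrite r1 rmorphM/=; ring.
  rewrite cabsM mulrC; have [xO|xO] := boolP (0 < x < pi); last first.
    by rewrite /ph int_OmegaE (negbTE xO) mul0r cabs0 !mulr0.
  rewrite ler_wpM2r ?cabs_ge0//.
  have := HK x s xO s0; rewrite -tE => /le_trans; apply.
  rewrite -mulrA ler_wpM2l// mulr_natl mulr2n lerD ?spow//.
  by rewrite -mul2n leq_mul2l/= (leq_trans _ Nm1)// leq_pmull.
have := cabs_Cint (CL1_meas iE) (L1Z (MK * 2 * t ^+ N) (CL1_cabs iphi)) Eb.
rewrite (@RintegralZl _ _ _ _ _ _ _ measurableT (CL1_cabs iphi)) -/V => key.
have IE : Cint setT (fun x => ph x * U x - (ph x * A x - B x - D x)) =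
   heat_content K phi rho t - (\sum_(n < m1) (t ^+ n)%:C%C * beta_interior phi rho n
      - \sum_(l < m2) (-1) ^+ l * rhol 0 l * (s ^+ l)%:C%C *
          Cint setT (fun x => ph x * (ptail l (x / s))%:C%C)
      - \sum_(l < m2) (-1) ^+ l * rhol pi l * (s ^+ l)%:C%C *
          Cint setT (fun x => phr x * (ptail l (x / s))%:C%C)).
  rewrite (CintB iU iABD) (CintB iAB iDs) (CintB iA iBs).
  by congr (_ - (_ - _ - _)).
rewrite IE in key.
have bdE : \sum_(j < m2) cpow t ((1 + j%:R - alpha) / 2) * beta_boundary alpha phik rhol j =
   \sum_(j < m2) cpow (s ^+ 2) ((1 + j%:R - alpha) / 2) *
        \sum_(k < j.+1) c_coef k (j - k)%N alpha * phik 0 k * rhol 0 (j - k)%N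
   + \sum_(j < m2) cpow (s ^+ 2) ((1 + j%:R - alpha) / 2) *
        \sum_(k < j.+1) c_coef k (j - k)%N alpha * phik pi k * rhol pi (j - k)%N.
  rewrite -big_split/= -tE; apply: eq_bigr => j _; rewrite -mulrDr -big_split/=.
  by [].
rewrite normcabs lecR bdE.
move: key HB HD.
move: (\sum_(l < m2) _ * Cint setT (fun x => ph x * _)) => X1.
move: (\sum_(l < m2) _ * Cint setT (fun x => phr x * _)) => X2.
move: (\sum_(j < m2) _ * \sum_(k < j.+1) _ * phik 0 k * _) => Y1.
move: (\sum_(j < m2) _ * \sum_(k < j.+1) _ * phik pi k * _) => Y2.
move: (heat_content K phi rho t) (\sum_(n < m1) _) => h a key HB HD.
have -> : h - (a + (Y1 + Y2)) = (h - (a - X1 - X2)) + ((- X1 - Y1) + (- X2 - Y2)) by ring.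
rewrite (le_trans (cabsD _ _))// (le_trans (lerD key (le_trans (cabsD _ _) (lerD HB HD))))//.
have h1 : MB * s ^+ m2 <= MB * t ^+ N by rewrite ler_wpM2l// spow.
have h2 : MD * s ^+ m2 <= MD * t ^+ N by rewrite ler_wpM2l// spow.
rewrite (_ : (_ + MB + MD) * _ = 2 * (MK * 2 * t ^+ N * V) + (MB * t ^+ N + MD * t ^+ N)); last by ring.
by rewrite lerD2l lerD.
Unshelve. all: by end_near.
Qed.
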